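(* Let $d\ge 2$ be an integer and let $S_d:=\{\mathbf{x}\in\mathbb{R}^d: x_i\ge 0 \text{ for all } i,\ x_1+\cdots+x_d\le 1\}$. Let $\mathbf{p}_1,\ldots,\mathbf{p}_n$ be independent random points, each uniformly distributed in $S_d$, and let $X_n$ be the number of Pareto records of the sequence $\mathbf{p}_1,\ldots,\mathbf{p}_n$. Then, as $n\to\infty$, \[ \sup_{x\in\mathbb{R}}\left|\mathbb{P}\left(\frac{X_n-\mathbb{E}[X_n]}{\sqrt{\mathbb{V}[X_n]}}<x\right)-\Phi(x)\right|=O\!\left(n^{-(d-1)/(4d)}(\log n)^2+n^{-1/d}(\log n)^{1/d}\right), \] where $\Phi$ is the standard normal distribution function.
   Context: For $\mathbf{p},\mathbf{q}\in\mathbb{R}^d$, $\mathbf{p}$ dominates $\mathbf{q}$ (written $\mathbf{q}\prec\mathbf{p}$) if every coordinate of $\mathbf{p}-\mathbf{q}$ is strictly positive. A point $\mathbf{p}_k$ is a Pareto record of the sequence $\mathbf{p}_1,\ldots,\mathbf{p}_n$ if $\mathbf{p}_k\nprec\mathbf{p}_i$ for all $1\le i<k$, i.e. $\mathbf{p}_k$ is not dominated by any earlier point. *)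

(* Defs.v *)
From HB Require Import structures.
From mathcomp Require Import all_boot all_order all_algebra.
From mathcomp Require Import all_classical all_reals all_analysis.
Set Implicit Arguments. Unset Strict Implicit. Unset Printing Implicit Defensive.
Import Order.TTheory GRing.Theory Num.Theory.
Local Open Scope classical_set_scope.
Local Open Scope ring_scope.

(* Points of R^d are represented as d.-tuples of reals; d.-tuple R carries the
   library's product sigma-algebra (generated by the coordinate projections). *)

Fixpoint iint {R : realType} (d : nat) : (d.-tuple R -> \bar R) -> \bar R :=
  match d with
  | 0 => fun f => f [tuple]
  | d'.+1 => fun f =>
      (\int[@lebesgue_measure R]_x iint (fun t : d'.-tuple R => f [tuple of x :: t]))%E
  end.

(* d-dimensional Lebesgue measure (volume) of a set A of R^d, defined by
   iterated integration of its indicator (Tonelli). *)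
Definition vol {R : realType} (d : nat) (A : set (d.-tuple R)) : \bar R :=
  iint (fun x => (\1_A x)%:E).

Definition simplex {R : realType} (d : nat) : set (d.-tuple R) :=
  [set x | (forall j : 'I_d, 0 <= tnth x j) /\ \sum_(j < d) tnth x j <= 1].

Definition dominated {R : realType} {d : nat} (q p : d.-tuple R) : bool :=
  [forall j : 'I_d, tnth q j < tnth p j].

Definition pareto_records {R : realType} {d : nat} (p : nat -> d.-tuple R) (n : nat) : nat :=
  count (fun k => [forall i : 'I_k, ~~ dominated (p k) (p i)]) (iota 0 n).

Definition uniform_on_simplex {R : realType} {dT : measure_display}
  {T : measurableType dT} (P : probability T R) {d : nat} (X : T -> d.-tuple R) : Prop :=
  forall A : set (d.-tuple R), measurable A ->
    P (X @^-1` A) = (fine (vol (A `&` @simplex R d)) / fine (vol (@simplex R d)))%:E.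

Definition mutually_independent {R : realType} {dT : measure_display}
  {T : measurableType dT} (P : probability T R) {d : nat} (X : nat -> T -> d.-tuple R) : Prop :=
  forall (s : seq nat) (A : nat -> set (d.-tuple R)), uniq s ->
    (forall i, i \in s -> measurable (A i)) ->
    P (\bigcap_(i in [set` s]) (X i @^-1` A i)) = (\prod_(i <- s) P (X i @^-1` A i))%E.

(* Main.v *)
(** The proof is Stein's method for functions of independent points. Let D_i F be the change
    of F when the i-th point is deleted, and let s_i exchange the first i points with those of an
    independent copy of the sequence. Telescoping over the s_i gives
      Cov(G, F) = sum_i E [D_i G (F o s_i - F o s_(i+1))],
    where F o s_i - F o s_(i+1) = D_i F o s_i - D_i F o s_(i+1). For the standardized record
    count W and a solution f of Stein's equation for a smoothed indicator of a half line, taking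
    G = f(W) bounds the distance to the normal law in terms of sum_i E |D_i F|^3 and of the
    variance of T = sum_i D_i F (D_i F o s_i - D_i F o s_(i+1)), whose mean is Var F.

    The geometry enters only through the slack s(x) = 1 - sum_j x_j of a point x of the simplex:
    a uniform point dominates x with probability v(x) = s(x)^d, and P(s <= u) is of order u.
    Hence the k-th point is a record with probability of order k^(-1/d), and E X_n and V X_n are
    of order n^(1-1/d). Deleting point i creates as records only later points that point i alone
    dominated, which gives sum_i E |D_i F|^3 = O(n^(1-1/d) log^2 n).

    For Var T, one counts only records with k v(x) <= 20 log n, which changes nothing with
    probability 1 - O(n^(-9)). Then the graph joining a counted point to the earlier points that
    dominate it has degrees O(log^2 n) with overwhelming probability, and the Efron-Stein
    inequality gives Var T = O(n^(1-1/d)) up to powers of log n. Smoothing at scale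
    n^(-(d-1)/(4d)) log n balances the two errors. *)
Require Import Defs.
From HB Require Import structures.
From mathcomp Require Import all_boot all_order all_algebra.
From mathcomp Require Import all_classical all_reals all_analysis.
From mathcomp Require Import measurable_realfun.
From mathcomp Require Import lra ring zify.
Set Implicit Arguments. Unset Strict Implicit. Unset Printing Implicit Defensive.
Import Order.TTheory GRing.Theory Num.Theory.
Import numFieldNormedType.Exports.
Local Open Scope classical_set_scope.
Local Open Scope ring_scope.

(** The given probability space need not carry a second sample, so the law is moved to a space of
    infinite sequences, where coordinates [n] to [2 * n - 1] serve as the independent copy.
    Conditioning is replaced by integrating one coordinate with the others frozen. A deleted point
    is overwritten by a fixed point outside the simplex, comparable with nothing.

    The delicate term is Var T. Bounding each of the [2 * n] squared differences by powers of the
    maximal degree would give order n, which for d = 2 is no smaller than the squared variance of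
    the count. Hence one factor of each square stays linear in the degrees, and its expectation sums
    to the order of the expected number of edges. Truncation makes this possible: with L = 20 log n,
    a counted point at time k is dominated by a given earlier point, and lies below a given point,
    with probability at most L / (k + 1). The powers of log n in Var T do no harm: divided by the
    variance of the count, the deviation of T is of order n^(-(d-1)/(2d)) up to logarithms, the
    square of the target rate. *)

Lemma eq_ler (R : numDomainType) (x y : R) : x = y -> x <= y.
Proof. by move=> ->. Qed.

(** * Independent sequences and expectations of bounded functions *)

Section SeqSpace.
Context d (E : measurableType d).

(** Constraining an initial segment, with trivial constraints allowed, makes the family stable under
    intersection: lengths are padded to their maximum. The uniqueness argument of
    [seqspace_measure_eq] rests on this. *)
Definition cylinders : set (set (nat -> E)) :=
  [set C | exists m (A : nat -> set E), (forall i, measurable (A i)) /\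
     C = [set z | forall i, (i < m)%N -> A i (z i)]].

Definition seqspace := g_sigma_algebraType cylinders.

Lemma measurable_seqspace_coord i : measurable_fun setT (fun z : seqspace => z i).
Proof.
move=> _ A mA; rewrite setTI; apply: sub_sigma_algebra.
exists i.+1, (fun j => if j == i then A else setT); split.
  by move=> j; case: eqP.
apply/seteqP; split => z /=.
  by move=> Az j _; case: eqP => // ->.
by move=> /(_ i (ltnSn i)); rewrite eqxx.
Qed.

Lemma measurable_cylinder m (A : nat -> set E) : (forall i, measurable (A i)) ->
  measurable ([set z | forall i, (i < m)%N -> A i (z i)] : set seqspace).
Proof. by move=> mA; apply: sub_sigma_algebra; exists m, A. Qed.

Lemma measurable_to_seqspace d' (S : measurableType d') (f : S -> seqspace) :
  (forall i, measurable_fun setT (fun x => f x i)) -> measurable_fun setT f.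
Proof.
move=> mf; apply: (@measurability _ _ S (seqspace) setT f cylinders) => //.
move=> _ [_ [m [A [mA ->]]] <-]; rewrite setTI.
rewrite (_ : _ @^-1` _ = \bigcap_(i in [set i | (i < m)%N])
   ((fun x => f x i) @^-1` (A i))).
  apply: bigcap_measurableType => i _.
  by rewrite -[X in measurable X]setTI; apply: mf.
by apply/seteqP; split => x /=.
Qed.

Lemma seqspace_measure_eq (R : realType) (m1 m2 : probability seqspace R) :
  (forall m (A : nat -> set E), (forall i, measurable (A i)) ->
    m1 [set z | forall i, (i < m)%N -> A i (z i)] =
    m2 [set z | forall i, (i < m)%N -> A i (z i)]) ->
  forall B, measurable B -> m1 B = m2 B.
Proof.
move=> h B mB.
apply: (@measure_unique _ R seqspace cylinders (fun=> setT) _ _ _ _ m1 m2) => //.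
- move=> _ _ [m [A [mA ->]]] [n [A' [mA' ->]]].
  exists (maxn m n), (fun i => (if (i < m)%N then A i else setT) `&`
    (if (i < n)%N then A' i else setT)); split.
    by move=> i; apply: measurableI; case: ifP.
  apply/seteqP; split => z /=.
    by move=> [h1 h2] i _; split; case: ifPn => // ?; [exact: h1|exact: h2].
  move=> h'; split => i im.
    by have := h' i; rewrite leq_max im/= => /(_ isT) [].
  by have := h' i; rewrite leq_max im orbT/= => /(_ isT) [].
- by move=> _; exists 0%N, (fun=> setT); split => //; apply/seteqP; split.
- by apply/seteqP; split => // z _; exists 0%N.
- by move=> _ [m [A [mA ->]]]; exact: h.
- by move=> k; rewrite (le_lt_trans (probability_le1 _ _))// ltry.
Qed.

End SeqSpace.

Section Expectation.
Context d (E : measurableType d) (R : realType).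
Notation Om := (seqspace E).
Variable Q : probability Om R.
Variable mu : set E -> \bar R.
Hypothesis Qind : forall (s : seq nat) (A : nat -> set E), uniq s ->
  (forall i, measurable (A i)) ->
  Q [set z | forall i, i \in s -> A i (z i)] = (\prod_(i <- s) mu (A i))%E.

(** All functionals here are built from finitely many indicators and bounded functions, so
    boundedness is carried along in place of integrability: it is stable under products and makes
    Fubini unconditional. *)
Definition bmeas d' (S : measurableType d') (F : S -> R) :=
  measurable_fun setT F /\ exists c, forall z, `|F z| <= c.

Lemma bmeas_integrable d' (S : measurableType d') (m : probability S R) F : bmeas F ->
  m.-integrable setT (EFin \o F).
Proof.
move=> [mF [c cF]]; apply: measurable_bounded_integrable => //.
  exact: fin_num_fun_lty.
by exists c; split; [exact: num_real|move=> x cx z _; exact: (le_trans (cF z) (ltW cx))].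
Qed.

Definition expct (F : Om -> R) : R := \int[Q]_z F z.
Notation Ex := expct.

Section bmeas.
Context d' (S : measurableType d').
Implicit Types F G : S -> R.

Lemma bmeas_cst c : bmeas (fun _ : S => c).
Proof. by split; [exact: measurable_cst|exists `|c|]. Qed.

Lemma bmeasD F G : bmeas F -> bmeas G -> bmeas (fun z => F z + G z).
Proof.
move=> [mF [a aF]] [mG [b bG]]; split; first exact: measurable_funD.
by exists (a + b) => z; rewrite (le_trans (ler_normD _ _))// lerD.
Qed.

Lemma bmeasM F G : bmeas F -> bmeas G -> bmeas (fun z => F z * G z).
Proof.
move=> [mF [a aF]] [mG [b bG]]; split; first exact: measurable_funM.
by exists (a * b) => z; rewrite normrM ler_pM.
Qed.

Lemma bmeasN F : bmeas F -> bmeas (fun z => - F z).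
Proof.
move=> [mF [a aF]]; split; first exact: measurableT_comp.
by exists a => z; rewrite normrN.
Qed.

Lemma bmeasB F G : bmeas F -> bmeas G -> bmeas (fun z => F z - G z).
Proof. by move=> bF bG; apply: bmeasD => //; apply: bmeasN. Qed.

Lemma bmeasX F k : bmeas F -> bmeas (fun z => F z ^+ k).
Proof.
move=> bF; elim: k => [|k ih].
  rewrite (_ : (fun _ => _) = fun=> 1); first exact: bmeas_cst.
  by apply/funext => z; rewrite expr0.
rewrite (_ : (fun _ => _) = (fun z => F z * F z ^+ k)); first exact: bmeasM.
by apply/funext => z; rewrite exprS.
Qed.

Lemma bmeas_abs F : bmeas F -> bmeas (fun z => `|F z|).
Proof.
move=> [mF [a aF]]; split; first exact: measurableT_comp.
by exists a => z; rewrite normr_id.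
Qed.

Lemma bmeas_sum (I : Type) (r : seq I) (P : pred I) (F : I -> S -> R) :
  (forall i, P i -> bmeas (F i)) -> bmeas (fun z => \sum_(i <- r | P i) F i z).
Proof.
move=> bF; elim: r => [|i r ih].
  rewrite (_ : (fun _ => _) = fun=> 0); first exact: bmeas_cst.
  by apply/funext => z; rewrite big_nil.
rewrite (_ : (fun _ => _) = fun z => (if P i then F i z else 0) +
   \sum_(i <- r | P i) F i z).
  by apply: bmeasD => //; case: (P i) (bF i) => [/(_ isT)//|_]; exact: bmeas_cst.
by apply/funext => z; rewrite big_cons; case: ifP; rewrite ?add0r.
Qed.

Lemma bmeas_prod (I : Type) (r : seq I) (P : pred I) (F : I -> S -> R) :
  (forall i, P i -> bmeas (F i)) -> bmeas (fun z => \prod_(i <- r | P i) F i z).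
Proof.
move=> bF; elim: r => [|i r ih].
  rewrite (_ : (fun _ => _) = fun=> 1); first exact: bmeas_cst.
  by apply/funext => z; rewrite big_nil.
rewrite (_ : (fun _ => _) = fun z => (if P i then F i z else 1) *
   \prod_(i <- r | P i) F i z).
  by apply: bmeasM => //; case: (P i) (bF i) => [/(_ isT)//|_]; exact: bmeas_cst.
by apply/funext => z; rewrite big_cons; case: ifP; rewrite ?mul1r.
Qed.

Lemma bmeas_pred (b : S -> bool) : measurable [set z | b z] ->
  bmeas (fun z => (b z)%:R).
Proof.
move=> mb; split; last by exists 1 => z; case: (b z); rewrite ?normr1 ?normr0.
rewrite (_ : (fun _ => _) = \1_[set z | b z]); first exact: measurable_indic.
by apply/funext => z; rewrite indicE; congr (nat_of_bool _)%:R; apply/idP/idP => [/mem_set//|/set_mem].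
Qed.

Lemma bmeas_comp d2 (S2 : measurableType d2) F (phi : S2 -> S) :
  measurable_fun setT phi -> bmeas F -> bmeas (F \o phi).
Proof.
move=> mphi [mF [c cF]]; split; first exact: measurableT_comp.
by exists c => z; exact: cF.
Qed.

End bmeas.

Lemma ExD F G : bmeas F -> bmeas G -> Ex (fun z => F z + G z) = Ex F + Ex G.
Proof. by move=> bF bG; apply: RintegralD => //; exact: bmeas_integrable. Qed.

Lemma ExB F G : bmeas F -> bmeas G -> Ex (fun z => F z - G z) = Ex F - Ex G.
Proof. by move=> bF bG; apply: RintegralB => //; exact: bmeas_integrable. Qed.

Lemma ExZ a F : bmeas F -> Ex (fun z => a * F z) = a * Ex F.
Proof. by move=> bF; apply: RintegralZl => //; exact: bmeas_integrable. Qed.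

Lemma Ex_cst c : Ex (fun=> c) = c.
Proof.
transitivity (c * fine (Q setT)); first exact: Rintegral_cst.
by rewrite probability_setT mulr1.
Qed.

Lemma Ex_le F G : bmeas F -> bmeas G -> (forall z, F z <= G z) -> Ex F <= Ex G.
Proof.
by move=> bF bG FG; apply: le_Rintegral => //; exact: bmeas_integrable.
Qed.

Lemma Ex_ge0 F : (forall z, 0 <= F z) -> 0 <= Ex F.
Proof. by move=> F0; apply: Rintegral_ge0. Qed.

Lemma Ex_sum (I : Type) (r : seq I) (P : pred I) (F : I -> Om -> R) :
  (forall i, P i -> bmeas (F i)) ->
  Ex (fun z => \sum_(i <- r | P i) F i z) = \sum_(i <- r | P i) Ex (F i).
Proof.
move=> bF; elim: r => [|i r ih].
  rewrite big_nil -[RHS](Ex_cst 0); congr Ex.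
  by apply/funext => z; rewrite big_nil.
rewrite big_cons; case: ifPn => Pi.
  rewrite -ih -ExD; [|exact: bF|exact: bmeas_sum].
  by congr Ex; apply/funext => z; rewrite big_cons Pi.
by rewrite -ih; congr Ex; apply/funext => z; rewrite big_cons (negbTE Pi).
Qed.

Lemma Ex_abs F : bmeas F -> `|Ex F| <= Ex (fun z => `|F z|).
Proof. by move=> bF; apply: le_normr_Rintegral => //; exact: bmeas_integrable. Qed.

Lemma Ex_pushforward d' (S : measurableType d') (m : probability S R)
   (phi : S -> Om) (F : Om -> R) : measurable_fun setT phi ->
  (forall n (A : nat -> set E), (forall i, measurable (A i)) ->
    m (phi @^-1` [set z | forall i, (i < n)%N -> A i (z i)]) =
    Q [set z | forall i, (i < n)%N -> A i (z i)]) ->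
  bmeas F -> Ex F = \int[m]_x F (phi x).
Proof.
move=> mphi h bF.
pose phi' : {mfun S >-> Om} := HB.pack phi (isMeasurableFun.Build _ _ _ _ phi mphi).
pose m' : probability Om R := distribution m phi'.
rewrite /expct /Rintegral; congr fine.
transitivity (\int[m']_z (F z)%:E)%E.
  apply: eq_measure_integral => A mA _.
  by apply: (seqspace_measure_eq (m1 := Q) (m2 := m')) => // n B mB; apply/esym; exact: h.
rewrite integral_pushforward//=.
  by apply/measurable_EFinP; case: bF.
exact: (bmeas_integrable m (bmeas_comp mphi bF)).
Qed.

Definition relabel (tau : nat -> nat) (z : Om) : Om := fun i => z (tau i).

Lemma measurable_relabel tau : measurable_fun setT (relabel tau).
Proof.
by apply: measurable_to_seqspace => i; exact: measurable_seqspace_coord.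
Qed.

Lemma measure_cylinder m (A : nat -> set E) : (forall i, measurable (A i)) ->
  Q [set z | forall i, (i < m)%N -> A i (z i)] = (\prod_(i <- iota 0 m) mu (A i))%E.
Proof.
move=> mA; rewrite -Qind ?iota_uniq//; congr (Q _).
by apply/seteqP; split => z h i /=; have := h i; rewrite mem_iota.
Qed.

Lemma Ex_relabel tau F : injective tau -> bmeas F ->
  Ex F = Ex (fun z => F (relabel tau z)).
Proof.
move=> inj bF; rewrite [LHS](@Ex_pushforward _ _ Q (relabel tau))//.
  exact: measurable_relabel.
move=> m A mA.
(* [A'] carries the constraint [A i] to the coordinate [tau i]; injectivity of [tau] makes this
   consistent. *)
pose s := map tau (iota 0 m); pose A' q := A (index q s).
have A'E i : (i < m)%N -> A' (tau i) = A i.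
  move=> im; rewrite /A' /s index_map//; congr A.
  by rewrite -[X in index X]add0n -(nth_iota 0 0 im) index_uniq ?size_iota ?iota_uniq.
rewrite measure_cylinder//.
have -> : (\prod_(i <- iota 0 m) mu (A i) = \prod_(i <- s) mu (A' i))%E.
  rewrite big_map; apply: eq_big_seq => i.
  by rewrite mem_iota/= add0n => im; rewrite A'E.
rewrite -Qind; last 2 first.
- by rewrite map_inj_uniq ?iota_uniq.
- by move=> i; exact: mA.
congr (Q _); apply/seteqP; split => z /= h.
  by move=> _ /mapP[i + ->]; rewrite mem_iota => im; rewrite A'E//; exact: h.
move=> i im; rewrite -A'E//; apply: h; apply/mapP; exists i => //.
by rewrite mem_iota.
Qed.

Definition splice (B : pred nat) (z z' : Om) : Om := fun i => if B i then z i else z' i.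

Lemma measurable_splice B : measurable_fun setT (fun zz : Om * Om => splice B zz.2 zz.1).
Proof.
apply: measurable_to_seqspace => i; rewrite /splice; case: (B i).
  exact: (measurableT_comp (measurable_seqspace_coord i) measurable_snd).
exact: (measurableT_comp (measurable_seqspace_coord i) measurable_fst).
Qed.

Lemma bmeas_splice1 B z' F : bmeas F -> bmeas (fun z => F (splice B z z')).
Proof.
move=> bF; apply: (@bmeas_comp _ _ _ _ F (fun z => splice B z z')) => //.
apply: measurable_to_seqspace => i; rewrite /splice; case: (B i) => //.
exact: measurable_seqspace_coord.
Qed.

(** Independence of disjoint blocks: splicing two independent sequences along [B] reproduces the
    law, since the product over a cylinder splits along [B]. The coordinates in [B] can thus be
    integrated first, with the others frozen at [z']. *)
Lemma Ex_splice B F : bmeas F ->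
  Ex F = Ex (fun z' => Ex (fun z => F (splice B z z'))).
Proof.
move=> bF.
rewrite [LHS](@Ex_pushforward _ _ (Q \x Q)%E (fun zz => splice B zz.2 zz.1))//.
- rewrite /expct /Rintegral; congr fine.
  rewrite -[LHS](integral12_prod_meas1 (m1 := Q) (m2 := Q)).
    apply: eq_integral => z' _; rewrite fineK//.
    exact: integrable_fin_num (bmeas_integrable Q (bmeas_splice1 B z' bF)).
  exact: (bmeas_integrable (Q \x Q)%E (bmeas_comp (measurable_splice B) bF)).
- exact: measurable_splice.
move=> m A mA.
rewrite (_ : _ @^-1` _ = [set z | forall i, i \in [seq i <- iota 0 m | ~~ B i] -> A i (z i)] `*`
   [set z | forall i, i \in [seq i <- iota 0 m | B i] -> A i (z i)]); last first.
  apply/seteqP; split => -[z z'] /=; rewrite /splice.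
    move=> h; split => i; rewrite mem_filter mem_iota add0n => /andP[Bi im];
    by have := h i im; rewrite ?Bi// (negbTE Bi).
  move=> [h1 h2] i im; case: ifPn => Bi; [apply: h2|apply: h1];
  by rewrite mem_filter Bi mem_iota.
have mS b : measurable ([set z | forall i, i \in [seq i <- iota 0 m | b i] -> A i (z i)] : set Om).
  rewrite (_ : [set _ | _] = [set z | forall i, (i < m)%N -> (if b i then A i else setT) (z i)]).
    by apply: (@measurable_cylinder _ E m (fun i => if b i then A i else setT)) => i; case: (b i).
  apply/seteqP; split => z /= h i.
    by move=> im; case: ifPn => // bi; apply: h; rewrite mem_filter bi mem_iota.
  by rewrite mem_filter mem_iota add0n => /andP[bi im]; have := h i im; rewrite bi.
etransitivity; first by apply: product_measure1E; exact: mS.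
have HQ b : Q [set z | forall i, i \in [seq i <- iota 0 m | b i] -> A i (z i)] =
    (\prod_(i <- iota 0 m | b i) mu (A i))%E.
  by rewrite Qind ?filter_uniq ?iota_uniq// big_filter.
rewrite measure_cylinder// [RHS](bigID (fun i => ~~ B i))/=; congr (_ * _)%E.
  exact: (HQ (fun i => ~~ B i)).
by rewrite (eq_bigl B) => [|i]; [exact: HQ|rewrite negbK].
Qed.

End Expectation.

(** * Resampling: covariance identity and Efron-Stein inequality *)

Section Resampling.
Context d (E : measurableType d) (R : realType).
Notation Om := (seqspace E).
Variable Q : probability Om R.
Variable mu : set E -> \bar R.
Hypothesis Qind : forall (s : seq nat) (A : nat -> set E), uniq s ->
  (forall i, measurable (A i)) ->
  Q [set z | forall i, i \in s -> A i (z i)] = (\prod_(i <- s) mu (A i))%E.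
(* [e0] stands for a deleted point: in the application it lies outside the simplex. *)
Variable e0 : E.

Notation Ex := (expct Q).
Implicit Types F G H : Om -> R.

Definition update (z : Om) (k : nat) (y : E) : Om := fun i => if i == k then y else z i.

Definition dep_below (N : nat) (F : Om -> R) :=
  forall z z', (forall i, (i < N)%N -> z i = z' i) -> F z = F z'.

Definition free_of (k : nat) (F : Om -> R) := forall z y, F (update z k y) = F z.

Definition dropdiff (k : nat) (F : Om -> R) (z : Om) : R := F z - F (update z k e0).
Notation Df := dropdiff.

Lemma dep_free N k F : dep_below N F -> (N <= k)%N -> free_of k F.
Proof.
move=> dF Nk z y; apply: dF => i iN; rewrite /update.
by case: eqP => // ik; move: iN; rewrite ik ltnNge Nk.
Qed.

Lemma measurable_update k y : measurable_fun setT (fun z : Om => update z k y).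
Proof.
apply: measurable_to_seqspace => i; rewrite /update; case: (i == k) => //.
exact: measurable_seqspace_coord.
Qed.

Lemma bmeas_update k y F : bmeas F -> bmeas (fun z => F (update z k y)).
Proof. by move=> bF; exact: (bmeas_comp (measurable_update k y) bF). Qed.

Lemma bmeas_Df k F : bmeas F -> bmeas (Df k F).
Proof. by move=> bF; apply: bmeasB => //; exact: bmeas_update. Qed.

Lemma bmeas_relabel tau F : bmeas F -> bmeas (fun z => F (relabel tau z)).
Proof.
move=> bF; apply: (@bmeas_comp _ _ _ _ _ F (relabel tau)) => //.
exact: measurable_relabel.
Qed.

Lemma bmeas_update1 k z' F : bmeas F -> bmeas (fun z : Om => F (update z' k (z k))).
Proof.
move=> bF; apply: (bmeas_comp (phi := fun z : Om => update z' k (z k))) => //.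
apply: measurable_to_seqspace => i; rewrite /update; case: (i == k) => //.
exact: measurable_seqspace_coord.
Qed.

Lemma update_splice k (z z' : Om) : update z' k (z k) = splice (pred1 k) z z'.
Proof. by apply/funext => i; rewrite /update /splice /=; case: eqP => [->|]. Qed.

Lemma Ex_update k F : bmeas F -> Ex F = Ex (fun z' => Ex (fun z => F (update z' k (z k)))).
Proof.
move=> bF; rewrite (Ex_splice Qind (pred1 k) bF); congr (expct Q).
by apply/funext => z'; congr (expct Q); apply/funext => z; rewrite update_splice.
Qed.

Lemma bmeas_Ex_splice B F : bmeas F -> bmeas (fun z' => Ex (fun z => F (splice B z z'))).
Proof.
move=> bF; split; last first.
  case: (bF) => _ [c cF]; exists c => z'.
  apply: (le_trans (Ex_abs Q (bmeas_splice1 B z' bF))).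
  rewrite -[leRHS](Ex_cst Q); apply: Ex_le => //; first exact/bmeas_abs/bmeas_splice1.
  exact: bmeas_cst.
have := @measurable_fubini_F _ _ _ _ R Q Q (EFin \o (F \o (fun zz => splice B zz.2 zz.1)))
  (bmeas_integrable (Q \x Q)%E (bmeas_comp (@measurable_splice _ E B) bF)).
move=> mf; apply: (measurableT_comp (f := fine)) => //.
Qed.

Lemma bmeas_Ex_update k F : bmeas F -> bmeas (fun z' => Ex (fun z => F (update z' k (z k)))).
Proof.
move=> bF; have := bmeas_Ex_splice (pred1 k) bF.
rewrite (_ : (fun _ => _) = (fun z' => Ex (fun z => F (update z' k (z k)))))//.
by apply/funext => z'; congr (expct Q); apply/funext => z; rewrite update_splice.
Qed.

(** The substitute for conditioning on all coordinates but [k]: a factor free of [k] leaves the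
    inner integral. The moment bounds on records repeat this step. *)
Lemma Ex_coord_le k F G H : bmeas F -> bmeas G -> bmeas H -> (forall z, 0 <= F z) ->
  free_of k F -> (forall z', Ex (fun z => G (update z' k (z k))) <= H z') ->
  Ex (fun z => F z * G z) <= Ex (fun z => F z * H z).
Proof.
move=> bF bG bH F0 nF GH; rewrite (Ex_update k); last exact: bmeasM.
apply: Ex_le; [exact: (bmeas_Ex_update k (bmeasM bF bG))|exact: bmeasM|].
move=> z'; rewrite (_ : (fun _ => _) = (fun z => F z' * G (update z' k (z k)))).
  by rewrite ExZ; [apply: ler_wpM2l|exact: bmeas_update1].
by apply/funext => z; rewrite nF.
Qed.

Lemma Ex_coord_le_cst k F G b : bmeas F -> bmeas G -> (forall z, 0 <= F z) ->
  free_of k F -> (forall z', Ex (fun z => G (update z' k (z k))) <= b) ->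
  Ex (fun z => F z * G z) <= b * Ex F.
Proof.
move=> bF bG F0 nF Gb.
rewrite -ExZ//; apply: (le_trans (Ex_coord_le bF bG (bmeas_cst _ b) F0 nF Gb)).
apply: Ex_le => [||z]; [by apply: bmeasM => //; exact: bmeas_cst|by apply: bmeasM => //; exact: bmeas_cst|].
by rewrite mulrC.
Qed.

Definition swap_first N i m : nat :=
  if (m < i)%N then (m + N)%N else if (N <= m < N + i)%N then (m - N)%N else m.

Lemma swap_firstK N i : (i <= N)%N -> involutive (swap_first N i).
Proof.
move=> iN m; rewrite /swap_first; have [mi|mi] := ltnP m i.
  have -> : (m + N < i)%N = false by lia.
  have -> : (N <= m + N < N + i)%N by lia.
  by rewrite addnK.
have [h|h] := boolP (N <= m < N + i)%N.
  have -> : (m - N < i)%N by lia.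
  by rewrite subnK; lia.
have -> : (m < i)%N = false by lia.
by rewrite (negbTE h).
Qed.

Lemma relabel_swap0 N (z : Om) : relabel (swap_first N 0) z = z.
Proof.
apply/funext => m; rewrite /relabel /swap_first ltn0.
by have -> : (N <= m < N + 0)%N = false by lia.
Qed.

Lemma Ex_swap N i F : (i <= N)%N -> bmeas F -> Ex (fun z => F (relabel (swap_first N i) z)) = Ex F.
Proof.
by move=> iN bF; apply/esym; apply: (Ex_relabel Qind) => //; exact/inv_inj/swap_firstK.
Qed.

(** [swap_first N N] moves the argument of [F] to coordinates [N] to [2 * N - 1], disjoint from
    those of [G]. *)
Lemma Ex_indep N F G : bmeas F -> bmeas G -> dep_below N F -> dep_below N G ->
  Ex (fun z => G z * F (relabel (swap_first N N) z)) = Ex G * Ex F.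
Proof.
move=> bF bG dF dG.
have bFs : bmeas (fun z => F (relabel (swap_first N N) z)) by exact: bmeas_relabel.
rewrite (Ex_splice Qind (fun i => (i < N)%N)); last exact: bmeasM.
transitivity (Ex (fun z' => Ex G * F (relabel (fun m => (m + N)%N) z'))).
  congr (expct Q); apply/funext => z'.
  rewrite mulrC -ExZ//; congr (expct Q); apply/funext => z; rewrite mulrC; congr (_ * _).
    by apply: dF => i iN; rewrite /relabel /splice /swap_first iN; case: ltnP => //; lia.
  by apply: dG => i iN; rewrite /splice iN.
rewrite ExZ; last exact: bmeas_relabel.
by rewrite -(Ex_relabel Qind)// => a b /addIn.
Qed.

(** Below [N] the two relabelled sequences differ only at coordinate [i], so deleting [i] makes the
    subtracted terms equal. *)
Lemma diff_swap N i F (z : Om) : (i < N)%N -> dep_below N F ->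
  F (relabel (swap_first N i) z) - F (relabel (swap_first N i.+1) z) =
  Df i F (relabel (swap_first N i) z) - Df i F (relabel (swap_first N i.+1) z).
Proof.
move=> iN dF; rewrite /dropdiff.
suff -> : F (update (relabel (swap_first N i) z) i e0) = F (update (relabel (swap_first N i.+1) z) i e0).
  by rewrite opprB addrA subrK.
apply: dF => m mN; rewrite /update; case: eqP => // mi; rewrite /relabel /swap_first.
have -> : (m < i.+1)%N = (m < i)%N by lia.
by case: ifP => // _; have -> : (N <= m)%N = false by lia.
Qed.

(* Telescope [F \o swap_first i] from [i = 0] to [i = N], where it is independent of [G].
   Deleting point [i] in [G] does not change the increment: the transposition of [i] and
   [N + i] maps one of its two terms to the other. *)
Theorem cov_identity N F G : bmeas F -> bmeas G -> dep_below N F -> dep_below N G ->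
  Ex (fun z => G z * F z) - Ex G * Ex F =
  \sum_(i < N) Ex (fun z => Df i G z *
     (Df i F (relabel (swap_first N i) z) - Df i F (relabel (swap_first N i.+1) z))).
Proof.
move=> bF bG dF dG.
have bFs i : bmeas (fun z => F (relabel (swap_first N i) z)) by exact: bmeas_relabel.
pose h i := Ex (fun z => G z * F (relabel (swap_first N i) z)).
have -> : Ex (fun z => G z * F z) = h 0%N.
  by congr (expct Q); apply/funext => z; rewrite relabel_swap0.
rewrite -(Ex_indep bF bG dF dG) -/(h N).
have -> : h 0%N - h N = \sum_(i < N) (h i - h i.+1).
  rewrite -(big_mkord xpredT (fun i => h i - h i.+1)).
  rewrite (@telescope_sumr_eq _ _ _ (fun i => - h i))// => [|i _]; first by rewrite opprK addrC.
  by rewrite opprK addrC.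
apply: eq_bigr => -[i /= iN] _.
have -> : Ex (fun z => Df i G z * (Df i F (relabel (swap_first N i) z) - Df i F (relabel (swap_first N i.+1) z))) =
    Ex (fun z => (G z * F (relabel (swap_first N i) z) - G z * F (relabel (swap_first N i.+1) z)) -
      (G (update z i e0) * F (relabel (swap_first N i) z) - G (update z i e0) * F (relabel (swap_first N i.+1) z))).
  by congr (expct Q); apply/funext => z; rewrite -diff_swap// /dropdiff; ring.
have bG' := bmeas_update i e0 bG.
rewrite ExB; [|by apply: bmeasB; apply: bmeasM|by apply: bmeasB; apply: bmeasM].
rewrite ExB ?ExB; try by apply: bmeasM.
rewrite -/(h i) -/(h i.+1) [X in _ = _ - (X - _)](_ : _ = Ex (fun z =>
   G (update z i e0) * F (relabel (swap_first N i.+1) z))); first by rewrite subrr subr0.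
pose tr m := if m == i then (N + i)%N else if m == (N + i)%N then i else m.
have trK : involutive tr.
  move=> m; rewrite /tr; case: (eqVneq m i) => [->|mi].
    by rewrite eqxx; case: eqP => //; lia.
  case: (eqVneq m (N + i)%N) => [->|mi']; first by rewrite eqxx.
  by rewrite (negbTE mi) (negbTE mi').
rewrite (Ex_relabel Qind (inv_inj trK)); last exact: bmeasM.
congr (expct Q); apply/funext => z; congr (_ * _).
  by apply: dG => m mN; rewrite /update /relabel /tr; case: eqP => // _; case: eqP => //; lia.
apply: dF => m mN; rewrite /relabel /swap_first /tr.
have -> : (N <= m)%N = false by lia.
rewrite /=; case: (ltngtP m i) => mi.
- have -> : (m < i.+1)%N by lia.
  by case: eqP => [|_]; [lia|case: eqP => //; lia].
- have -> : (m < i.+1)%N = false by lia.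
  by case: eqP => [|_]; [lia|case: eqP => //; lia].
- by rewrite mi ltnSn eqxx addnC.
Qed.

(* [2 a b <= a ^+ 2 + b ^+ 2] in the covariance identity with [G = F]. *)
Theorem efron_stein N F : bmeas F -> dep_below N F ->
  Ex (fun z => F z ^+ 2) - Ex F ^+ 2 <= 2 * \sum_(i < N) Ex (fun z => Df i F z ^+ 2).
Proof.
move=> bF dF.
rewrite -[X in X - _](_ : Ex (fun z => F z * F z) = _); last first.
  by congr (expct Q); apply/funext => z; rewrite expr2.
rewrite expr2 (cov_identity bF bF dF dF) mulr_sumr; apply: ler_sum => -[i /= iN] _.
have bD := bmeas_Df i bF; have bDs j := bmeas_relabel (swap_first N j) bD.
set e := Ex _; have -> : 2 * Ex (fun z => Df i F z ^+ 2) = Ex (fun z =>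
  Df i F z ^+ 2 + 2^-1 * (Df i F (relabel (swap_first N i) z) ^+ 2 + Df i F (relabel (swap_first N i.+1) z) ^+ 2)).
  rewrite ExD; [|exact: bmeasX|by apply: bmeasM; [exact: bmeas_cst|apply: bmeasD; apply: bmeasX]].
  rewrite ExZ; last by apply: bmeasD; apply: bmeasX.
  rewrite ExD; [|by apply: bmeasX|by apply: bmeasX].
  rewrite (Ex_swap (F := fun z => Df i F z ^+ 2))//; [|lia|exact: bmeasX].
  rewrite (Ex_swap (F := fun z => Df i F z ^+ 2))//; [|exact: bmeasX].
  by lra.
apply: Ex_le => [||z].
- by apply: bmeasM => //; apply: bmeasB.
- by apply: bmeasD; [exact: bmeasX|apply: bmeasM; [exact: bmeas_cst|apply: bmeasD; apply: bmeasX]].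
set a := Df i F z; set b := Df i F _; set c := Df i F _.
have := sqr_ge0 (a - b); have := sqr_ge0 (a + c); rewrite !expr2; nra.
Qed.

End Resampling.

(** * Stein's equation with smoothed indicator data *)

Section Calculus.
Context {R : realType}.
Implicit Types f g u q : R -> R.

Definition has_derive f g := forall x : R, is_derive x 1 f (g x).

Lemma has_derive_continuous f g : has_derive f g -> continuous f.
Proof. by move=> fg x; apply: differentiable_continuous; apply/derivable1_diffP; case: (fg x). Qed.

Lemma has_derive_MVT f g (a b : R) : has_derive f g -> a <= b ->
  exists2 c, a <= c <= b & f b - f a = g c * (b - a).
Proof.
move=> fg ab; have [//|c] := @MVT_segment R f g a b ab (fun x _ => fg x).
  by apply: continuous_subspaceT; exact: has_derive_continuous fg.
by rewrite in_itv/=; exists c.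
Qed.

Lemma has_derive_lipschitz f g (K : R) : has_derive f g -> (forall x, `|g x| <= K) ->
  forall a b, `|f b - f a| <= K * `|b - a|.
Proof.
move=> fg gK a b; wlog ab : a b / a <= b.
  by move=> h; have [/h//|/ltW/h] := leP a b; rewrite distrC (distrC a).
have [c _ ->] := has_derive_MVT fg ab.
by rewrite normrM ler_wpM2r.
Qed.

(** For a piecewise polynomial, a quadratic remainder bound can be checked by cases on signs,
    without one-sided limits at the knots. *)
Lemma has_derive_quad F G (K : R) :
  (forall a b, `|F b - F a - G a * (b - a)| <= K * (b - a) ^+ 2) -> has_derive F G.
Proof.
move=> FG x.
have K0 : 0 <= K.
  by have := le_trans (normr_ge0 _) (FG 0 1); rewrite subr0 expr1n mulr1.
suff h : (fun h => h^-1 *: (F (h *: 1 + x) - F x)) @ 0^' --> G x.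
  by split; [apply/cvg_ex; exists (G x)|exact: cvg_lim].
apply/cvgrPdist_le => e e0; near=> h.
have h0 : h != 0 by near: h; exact: nbhs_dnbhs_neq.
rewrite (_ : _ - _ = - (h^-1 * (F (h + x) - F x - G x * (h + x - x)))); last first.
  by rewrite /GRing.scale/= mulr1; field.
rewrite normrN normrM normfV ler_pdivrMl ?normr_gt0//.
apply: (le_trans (FG x (h + x))); rewrite addrK -real_normK ?num_real// expr2 mulrCA.
rewrite ler_wpM2l//.
have : `|h| <= e / (K + 1).
  near: h; apply: (@dnbhs0_le _ R); rewrite divr_gt0//; lra.
rewrite ler_pdivlMr; last lra.
by move=> /(le_trans _); apply; rewrite mulrC; have := normr_ge0 h; nra.
Unshelve. all: by end_near. Qed.

Lemma has_derive_eq f g g' : has_derive f g -> g =1 g' -> has_derive f g'.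
Proof. by move=> h gg' x; rewrite -gg'. Qed.

Lemma has_derive_cst (c : R) : has_derive (fun=> c) (fun=> 0).
Proof. by move=> x; exact: is_derive_cst. Qed.

Lemma has_deriveD f f' g g' : has_derive f f' -> has_derive g g' ->
  has_derive (fun x => f x + g x) (fun x => f' x + g' x).
Proof. by move=> df dg x; exact: (is_deriveD (df x) (dg x)). Qed.

Lemma has_deriveM f f' g g' : has_derive f f' -> has_derive g g' ->
  has_derive (fun x => f x * g x) (fun x => f x * g' x + f' x * g x).
Proof.
move=> df dg x; apply: (is_derive_eq (is_deriveM (df x) (dg x))).
by rewrite /GRing.scale/=; ring.
Qed.

Lemma has_deriveN f f' : has_derive f f' -> has_derive (fun x => - f x) (fun x => - f' x).
Proof. by move=> df x; exact: (is_deriveN (df x)). Qed.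

Lemma has_derive_expR_sqr : has_derive (fun w => expR (- (w ^+ 2 / 2)) : R)
  (fun w => - w * expR (- (w ^+ 2 / 2))).
Proof.
have d : has_derive (fun w : R => - (w ^+ 2 / 2)) (fun w => - w).
  apply: (has_derive_quad (K := 1)) => a b.
  rewrite (_ : _ - _ - _ = - ((b - a) ^+ 2 / 2)); last by field.
  rewrite normrN ger0_norm ?divr_ge0 ?sqr_ge0// mul1r.
  by have := sqr_ge0 (b - a); move: (_ ^+ 2) => s; lra.
by move=> x; have := is_derive1_comp (is_derive_expR _) (d x); rewrite mulrC.
Qed.

Lemma mul_exp_gt (a c M : R) : 0 < a -> exists2 t, 0 <= t & M < c + a * expR t.
Proof.
move=> a0; exists (`|M - c| / a); first by rewrite divr_ge0// ltW.
have := expR_ge1Dx (`|M - c| / a); rewrite -(ler_pM2l a0) mulrDr mulr1 mulrCA mulfV ?gt_eqF// mulr1.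
have := ler_norm (M - c); lra.
Qed.

(* If [w * u w > m] at some [w0 > 0] then [(u - m / w0) * exp (- w ^+ 2 / 2)] increases
   beyond [w0], so that [u] grows like [exp (w ^+ 2 / 2)]. *)
Lemma stein_ode_aux u q (M m : R) : has_derive u (fun w => w * u w + q w) ->
  (forall w, `|u w| <= M) -> (forall w, `|q w| <= m) ->
  forall w, 0 < w -> w * u w <= m.
Proof.
move=> du uM qm w0 w00; rewrite leNgt; apply/negP => h.
have m0 : 0 <= m := le_trans (normr_ge0 _) (qm 0).
have dy : has_derive (fun w => (u w - m / w0) * expR (- (w ^+ 2 / 2)))
   (fun w => (q w + w * (m / w0)) * expR (- (w ^+ 2 / 2))).
  apply: (has_derive_eq (has_deriveM (has_deriveD du (has_derive_cst _)) has_derive_expR_sqr)) => w /=.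
  by ring.
have mono w : w0 <= w -> (u w0 - m / w0) * expR (- (w0 ^+ 2 / 2)) <=
    (u w - m / w0) * expR (- (w ^+ 2 / 2)).
  move=> w0w; rewrite -subr_ge0; have [c /andP[c0 cw] ->] := has_derive_MVT dy w0w.
  rewrite mulr_ge0 ?subr_ge0// mulr_ge0 ?expR_ge0//.
  have : m <= c * (m / w0) by rewrite mulrCA ler_peMr// ler_pdivlMr ?mul1r.
  by have := qm c; rewrite ler_norml => /andP[]; lra.
have a0 : 0 < u w0 - m / w0 by rewrite subr_gt0 ltr_pdivrMr// mulrC.
have [t t0 ht] := mul_exp_gt (m / w0) M a0.
(* With [w^2 / 2 = w0^2 / 2 + t], monotonicity forces [u w >= m / w0 + (u w0 - m / w0) * exp t],
   which exceeds [M] by the choice of [t]. *)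
pose w := Num.sqrt (w0 ^+ 2 + 2 * t).
have w2 : w ^+ 2 = w0 ^+ 2 + 2 * t by rewrite sqr_sqrtr// addr_ge0 ?sqr_ge0//; lra.
have w0w : w0 <= w.
  have : w0 ^+ 2 <= w ^+ 2 by rewrite w2; lra.
  by rewrite ler_pXn2r// nnegrE ?sqrtr_ge0//; exact: ltW.
have E : expR (- (w0 ^+ 2 / 2)) = expR t * expR (- (w ^+ 2 / 2)).
  by rewrite -expRD; congr expR; rewrite w2; field.
have := mono _ w0w; rewrite E mulrA ler_pM2r ?expR_gt0//.
by have := uM w; rewrite ler_norml => /andP[]; lra.
Qed.

(** Changing the sign of [u] and reflecting the variable both preserve the form of the equation, so
    an upper bound at positive [w] suffices. It serves twice: for the Stein solution [f], and for
    its derivative, which solves an equation of the same shape. *)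
Lemma stein_ode u q (M m : R) : has_derive u (fun w => w * u w + q w) ->
  (forall w, `|u w| <= M) -> (forall w, `|q w| <= m) ->
  forall w, `|w * u w| <= m.
Proof.
move=> du uM qm.
have m0 : 0 <= m := le_trans (normr_ge0 _) (qm 0).
have pos u' q' : has_derive u' (fun w => w * u' w + q' w) -> (forall w, `|u' w| <= M) ->
    (forall w, `|q' w| <= m) -> forall w, 0 < w -> `|w * u' w| <= m.
  move=> du' u'M q'm w w0; rewrite ler_norml; apply/andP; split; last exact: stein_ode_aux w w0.
  rewrite lerNl -mulrN.
  apply: (@stein_ode_aux (fun w => - u' w) (fun w => - q' w) M m) w0.
  - by apply: (has_derive_eq (has_deriveN du')) => x; ring.
  - by move=> x; rewrite normrN.
  - by move=> x; rewrite normrN.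
move=> w; have [w0|w0|->] := ltgtP w 0; [|exact: pos|by rewrite mul0r normr0].
have dN : has_derive (fun w => u (- w)) (fun w => - (- w * u (- w) + q (- w))).
  move=> x; have := is_derive1_comp (du (- x)) (is_deriveNid x 1).
  by rewrite mulrN1.
have dN' : has_derive (fun w => u (- w)) (fun w => w * u (- w) + - q (- w)).
  by apply: (has_derive_eq dN) => x; ring.
have := pos _ _ dN' (fun x => uM (- x)).
move=> /(_ _ (- w)); rewrite opprK mulNr normrN; apply; last by rewrite oppr_gt0.
by move=> x; rewrite normrN.
Qed.

End Calculus.

(** * The bounded solution of Stein's equation for a centred test function *)

Section GaussianStein.
Context {R : realType}.
Notation leb := (@lebesgue_measure R).
Notation phi := (normal_pdf (0 : R) 1).
Notation gauss := (normal_prob (0 : R) 1).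

Lemma normal_pdf01E (x : R) : phi x = normal_peak 1 * expR (- (x ^+ 2 / 2)).
Proof.
rewrite normal_pdfE ?oner_eq0// /normal_fun subr0 expr1n; congr (_ * expR _).
by rewrite mulNr -mulr_natr mul1r.
Qed.

Lemma normal_pdf01_gt0 (x : R) : 0 < phi x.
Proof. by rewrite normal_pdf01E mulr_gt0 ?expR_gt0 ?normal_peak_gt0 ?oner_eq0. Qed.

Lemma has_derive_normal_pdf : has_derive phi (fun w => - w * phi w).
Proof.
have h := has_deriveM (has_derive_cst (normal_peak (1 : R))) (has_derive_expR_sqr (R := R)).
rewrite (_ : phi = fun x => normal_peak 1 * expR (- (x ^+ 2 / 2))); last first.
  by apply/funext => x; rewrite normal_pdf01E.
by apply: (has_derive_eq h) => x; ring.
Qed.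

Lemma normal_pdf_tail (e : R) : 0 < e -> exists B, forall w, B <= `|w| -> phi w <= e.
Proof.
move=> e0; have p0 : 0 < normal_peak (1:R) by rewrite normal_peak_gt0 ?oner_eq0.
exists (1 + 2 * normal_peak 1 / e) => w Bw.
rewrite normal_pdf01E expRN ler_pdivrMr ?expR_gt0//.
have := expR_ge1Dx (w ^+ 2 / 2); rewrite -(ler_pM2l e0) => /(le_trans _); apply.
set p := normal_peak 1 in p0 Bw *.
have q0 : 0 <= 2 * p / e by rewrite divr_ge0 ?ltW// mulr_gt0.
have h : 2 * p / e <= w ^+ 2.
  rewrite -real_normK ?num_real//; set v := `|w| in Bw *.
  by rewrite expr2; nra.
by move: h; rewrite ler_pdivrMr//; lra.
Qed.

Lemma gam_tail (e : R) : 0 < e -> exists2 B, 0 < B & forall w, B <= w ->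
  fine (gauss `]-oo, (- w)]) <= e /\ fine (gauss `]w, +oo[) <= e.
Proof.
move=> e0.
pose idR : measurableTypeR R -> R := idfun.
pose X : {mfun measurableTypeR R >-> R} := HB.pack idR (isMeasurableFun.Build _ _ _ _ idR (@measurable_id _ _ setT)).
pose P : probability (measurableTypeR R) R := gauss.
have fP A : measurable A -> P A \is a fin_num by exact: fin_num_measure.
have h1 := @cvg_cdfNy0 _ _ R P X.
have h2 := @cvg_cdfy1 _ _ R P X.
have [B1 h1'] : exists B, forall w, w <= B -> fine (gauss `]-oo, w]) <= e.
  have /fine_cvgP[_ /cvgrPdist_le/(_ e e0)] := h1.
  move=> [M [_ hM]]; exists (M - 1) => w wM.
  have /= := hM w; rewrite sub0r normrN => /(_ (le_lt_trans wM _)).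
  rewrite ltrBlDr ltrDl ltr01 => /(_ isT); apply: le_trans; exact: ler_norm.
have [B2 h2'] : exists B, forall w, B <= w -> 1 - fine (gauss `]-oo, w]) <= e.
  have /fine_cvgP[_ /cvgrPdist_le/(_ e e0)] := h2.
  move=> [M [_ hM]]; exists (M + 1) => w wM.
  have /= := hM w; move=> /(_ (lt_le_trans _ wM)).
  rewrite ltrDl ltr01 => /(_ isT); apply: le_trans; exact: ler_norm.
exists (1 + `|B1| + `|B2|); first by have := normr_ge0 B1; have := normr_ge0 B2; lra.
move=> w Bw; split.
  by apply: h1'; rewrite lerNl; have := ler_norm (- B1); rewrite normrN; have := normr_ge0 B2; lra.
have := h2' w; rewrite (_ : B2 <= w); last by have := ler_norm B2; have := normr_ge0 B1; lra.
move=> /(_ isT); apply: le_trans.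
have := probability_setC P (measurable_itv `]-oo, w]).
rewrite setCitvl/= => /(congr1 fine) -> .
have fI := fP _ (measurable_itv `]-oo, w]).
by rewrite fineB.
Qed.

Variable k : R -> R.
Hypothesis ck : continuous k.
Hypothesis k1 : forall x, `|k x| <= 1.
Hypothesis k0 : \int[leb]_x (k x * phi x) = 0.

Let A w := \int[leb]_(t in `]-oo, w]) (k t * phi t).

Let ckphi : continuous (fun t => k t * phi t).
Proof. by move=> t; apply: cvgM; [exact: ck|exact: continuous_normal_pdf]. Qed.

Let ikphi (D : set R) : measurable D -> leb.-integrable D (EFin \o (fun t => k t * phi t)).
Proof.
move=> mD; apply: (@integrableS _ _ _ _ setT) => //.
apply: le_integrable (integrable_normal_pdf 0 1) => //.
  by apply/measurable_EFinP; exact: continuous_measurable_fun.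
move=> x _ /=; rewrite lee_fin normrM ler_piMl// .
Qed.

Let A_le (D : set R) : measurable D ->
  `|\int[leb]_(t in D) (k t * phi t)| <= fine (gauss D).
Proof.
move=> mD; apply: (le_trans (le_normr_Rintegral _ _)) => //; first exact: ikphi.
apply: le_Rintegral => //.
- exact: (integrable_abse (ikphi mD)).
- by apply: (@integrableS _ _ _ _ setT) => //; exact: integrable_normal_pdf.
- move=> x _; rewrite normrM [X in _ * X]ger0_norm ?ler_piMl// ?normal_pdf_ge0//.
Qed.

(** The centring [k0] turns the left tail integral into a right tail integral, so that [A] decays at
    plus infinity as well. *)
Let A_right w : A w = - \int[leb]_(t in `]w, +oo[) (k t * phi t).
Proof.
apply/eqP; rewrite -addr_eq0; apply/eqP; rewrite -[RHS]k0.
rewrite -Rintegral_setU//.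
- by rewrite -itv_bndbnd_setU// set_itvNyy.
- by rewrite -itv_bndbnd_setU// set_itvNyy; exact: ikphi.
- apply/disj_setPS => x [] /=; rewrite !in_itv/= andbT => h1 h2.
  by move: (le_lt_trans h1 h2); rewrite ltxx.
Qed.

Let dA : has_derive A (fun w => k w * phi w).
Proof.
move=> w.
have ww : w < w + 1 by rewrite ltrDl.
have [h1 h2] := @continuous_FTC1 R (fun t => k t * phi t) -oo%O w (w + 1) ww
  (ikphi (measurable_itv _)) (ltNyr w) (@ckphi w).
split; first exact: h1.
by rewrite -derive1E; exact: h2.
Qed.

Let A1 w : `|A w| <= 1.
Proof.
apply: (le_trans (A_le _)) => //; rewrite -[leRHS]/(fine 1%E) fine_le ?fin_num_measure//.
exact: (@probability_le1 _ _ _ gauss).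
Qed.

Let A_small (e : R) : 0 < e -> exists2 B, 0 < B & forall w, B <= w ->
  `|A w| + phi w <= e /\ `|A (- w)| + phi (- w) <= e.
Proof.
move=> e0; have e20 : 0 < e / 2 by rewrite divr_gt0.
have [B B0 hB] := gam_tail e20; have [B' hB'] := normal_pdf_tail e20.
exists (B + `|B'|); first by have := normr_ge0 B'; lra.
move=> w hw; have := normr_ge0 B'; have := ler_norm B' => b1 b2.
have [|h1 h2] := hB w; first lra.
have nw : `|w| = w by rewrite ger0_norm//; lra.
have h3 : phi w <= e / 2 by apply: hB'; rewrite nw; lra.
have h4 : phi (- w) <= e / 2 by apply: hB'; rewrite normrN nw; lra.
rewrite A_right normrN; have := A_le (measurable_itv `]w, +oo[).
have := A_le (measurable_itv `]-oo, (- w)]); rewrite -/(A (- w)).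
move: h1 h2 h3 h4; lra.
Qed.

Let ndec (F G : R -> R) : has_derive F G -> forall a b, (forall x, a <= x <= b -> 0 <= G x) ->
  a <= b -> F a <= F b.
Proof.
move=> FG a b G0 ab; rewrite -subr_ge0; have [c cab ->] := has_derive_MVT FG ab.
by rewrite mulr_ge0 ?subr_ge0// G0.
Qed.

(** A Mills ratio bound by monotonicity: for [s = 1] and [s = -1], once the variable is at least 1
    in absolute value its sign decides that of [s * k w + w], because [k] is bounded by 1. So
    [s * A - phi] is monotone there, and it tends to 0 at infinity; the slack [e] stands for that
    limit. *)
Let A_phi w : 1 <= `|w| -> `|A w| <= phi w.
Proof.
move=> w1; apply/ler_addgt0Pr => e e0.
have [B B0 hB] := A_small e0.
have phi0 := @normal_pdf_ge0 R 0 1.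
have dp s : has_derive (fun w => s * A w + phi w) (fun w => (s * k w - w) * phi w).
  apply: (has_derive_eq (has_deriveD (has_deriveM (has_derive_cst s) dA) has_derive_normal_pdf)) => x; ring.
have dm s : has_derive (fun w => s * A w - phi w) (fun w => (s * k w + w) * phi w).
  apply: (has_derive_eq (has_deriveD (has_deriveM (has_derive_cst s) dA) (has_deriveN has_derive_normal_pdf))) => x; ring.
have main s : `|s| = 1 -> s * A w <= phi w + e.
  move=> s1; have sk x : `|s * k x| <= 1 by rewrite normrM s1 mul1r.
  have [w0|w0] := leP 0 w.
    rewrite ger0_norm// in w1.
    pose b := B + w; have [|hb _] := hB b; first by rewrite lerDl.
    have : s * A w - phi w <= s * A b - phi b.
      apply: (ndec (dm s)); last by rewrite lerDr ltW.
      move=> x /andP[wx _]; rewrite mulr_ge0//.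
      by have := sk x; rewrite ler_norml => /andP[]; lra.
    have := ler_norm (s * A b); rewrite normrM s1 mul1r.
    by have := phi0 b; lra.
  rewrite ltr0_norm// in w1.
  pose b := B - w; have [|_ hb] := hB b; first by rewrite lerDl; lra.
  have : - (s * A (- b) - phi (- b)) <= - (s * A w - phi w).
    apply: (ndec (has_deriveN (dm s))); last by rewrite /b; lra.
    move=> x /andP[_ wx]; rewrite -mulNr mulr_ge0//.
    by have := sk x; rewrite ler_norml => /andP[]; lra.
  have := ler_norm (s * A (- b)); rewrite normrM s1 mul1r.
  by have := phi0 (- b); lra.
rewrite ler_norml; apply/andP; split.
  by have := main (-1); rewrite normrN1 => /(_ erefl); lra.
by have := main 1; rewrite normr1 => /(_ erefl); lra.
Qed.

(** Dividing [A] by the density solves the equation by the quotient rule. Boundedness comes from two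
    regimes: [A_phi] away from the interval between -1 and 1, and inside it the trivial bound 1 on
    [A] with [phi w >= phi 1]. *)
Lemma stein_solution : exists f : R -> R,
  (forall w, `|f w| <= 1 + (phi 1)^-1) /\ has_derive f (fun w => w * f w + k w).
Proof.
exists (fun w => A w / phi w); split.
  move=> w; rewrite normrM normfV (ger0_norm (normal_pdf_ge0 _ _ _)).
  have i0 : 0 < (phi 1)^-1 by rewrite invr_gt0 normal_pdf01_gt0.
  rewrite ler_pdivrMr ?normal_pdf01_gt0//.
  have [w1|w1] := leP 1 `|w|.
    apply: (le_trans (A_phi w1)); rewrite ler_peMl ?normal_pdf_ge0//; lra.
  apply: (le_trans (A1 w)).
  have : phi 1 <= phi w.
    rewrite !normal_pdf01E ler_wpM2l ?normal_peak_ge0// ler_expR lerN2 ler_pM2r// expr1n.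
    by rewrite -real_normK ?num_real// expr_le1// ltW.
  rewrite -(ler_pM2l i0) mulVf ?gt_eqF ?normal_pdf01_gt0// => /le_trans; apply.
  by rewrite ler_wpM2r ?normal_pdf_ge0//; lra.
have dV : has_derive (fun w => (phi w)^-1) (fun w => w / phi w).
  move=> w; have := is_deriveV (lt0r_neq0 (normal_pdf01_gt0 w)) (has_derive_normal_pdf w).
  rewrite (_ : _ *: _ = w / phi w)//.
  rewrite /GRing.scale/=; field; exact: lt0r_neq0 (normal_pdf01_gt0 w).
apply: (has_derive_eq (has_deriveM dA dV)) => w.
by rewrite mulrCA mulrA mulfK ?gt_eqF ?normal_pdf01_gt0.
Qed.

End GaussianStein.

(** * Smoothed indicators of half lines and the regularity of their Stein solutions *)

Section SteinTest.
Context {R : realType}.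
Notation leb := (@lebesgue_measure R).
Notation phi := (normal_pdf (0 : R) 1).
Notation gauss := (normal_prob (0 : R) 1).

Definition Phi (x : R) : R := fine (gauss `]-oo, x[).

Let pos (t : R) : R := Num.max 0 t.

Let posP (t : R) : (0 <= t /\ pos t = t) \/ (t <= 0 /\ pos t = 0).
Proof. by rewrite /pos; case: (leP 0 t) => h; [left|right]; split => //; exact: ltW. Qed.

Let pos_sqr a b : `|b * pos b - a * pos a - 2 * pos a * (b - a)| <= (b - a) ^+ 2.
Proof.
have s1 := sqr_ge0 a; have s2 := sqr_ge0 b; have s3 := sqr_ge0 (b - a).
rewrite !expr2 in s1 s2 s3; rewrite ler_norml expr2.
by case: (posP a) => -[ha ->]; case: (posP b) => -[hb ->]; apply/andP; split; nra.
Qed.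

(* A quadratic spline decreasing from 1 at [0] to 0 at [1]; only [pos] itself
   fails to be differentiable at the knots. *)
Let step (t : R) := 1 - 2 * (t * pos t) + 4 * ((t - 2^-1) * pos (t - 2^-1))
   - 2 * ((t - 1) * pos (t - 1)).
Let step' (t : R) := - 4 * pos t + 8 * pos (t - 2^-1) - 4 * pos (t - 1).

Let step_quad a b : `|step b - step a - step' a * (b - a)| <= 8 * (b - a) ^+ 2.
Proof.
have h1 := pos_sqr a b.
have h2 := pos_sqr (a - 2^-1) (b - 2^-1).
have h3 := pos_sqr (a - 1) (b - 1).
have e2 : b - 2^-1 - (a - 2^-1) = b - a by ring.
have e3 : b - 1 - (a - 1) = b - a by ring.
rewrite e2 in h2; rewrite e3 in h3.
move: h1 h2 h3; rewrite /step /step' !ler_norml => /andP[? ?] /andP[? ?] /andP[? ?].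
by apply/andP; split; lra.
Qed.

Let step'_le t : `|step' t| <= 2.
Proof.
rewrite ler_norml /step'.
case: (posP t) => -[h1 ->]; case: (posP (t - 2^-1)) => -[h2 ->];
case: (posP (t - 1)) => -[h3 ->]; apply/andP; split; lra.
Qed.

Let step0 t : t <= 0 -> step t = 1.
Proof.
move=> t0; rewrite /step.
case: (posP t) => -[h1 ->]; case: (posP (t - 2^-1)) => -[h2 ->];
case: (posP (t - 1)) => -[h3 ->]; nra.
Qed.

Let step1 t : 1 <= t -> step t = 0.
Proof.
move=> t0; rewrite /step.
case: (posP t) => -[h1 ->]; case: (posP (t - 2^-1)) => -[h2 ->];
case: (posP (t - 1)) => -[h3 ->]; nra.
Qed.

Let step01 t : 0 <= step t <= 1.
Proof.
rewrite /step.
case: (posP t) => -[h1 ->]; case: (posP (t - 2^-1)) => -[h2 ->];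
case: (posP (t - 1)) => -[h3 ->]; apply/andP; split; nra.
Qed.

Let integrable_phi (D : set R) : measurable D -> leb.-integrable D (EFin \o phi).
Proof.
by move=> mD; apply: (@integrableS _ _ _ _ setT) => //; exact: integrable_normal_pdf.
Qed.

Lemma PhiE x : Phi x = \int[leb]_(t in `]-oo, x[) phi t.
Proof. by []. Qed.

Lemma Phi_lipschitz (x e : R) : 0 < e -> Phi (x + e) <= Phi x + normal_peak 1 * e.
Proof.
move=> e0; rewrite !PhiE.
have xe : x < x + e by rewrite ltrDl.
have eqU : [set` `]-oo, (x + e)%R[] = [set` `]-oo, x[] `|` [set` `[x, (x + e)%R[].
  by rewrite -itv_bndbnd_setU// bnd_simp ltW.
have -> : \int[leb]_(t in `]-oo, (x + e)%R[) phi t =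
    \int[leb]_(t in `]-oo, x[) phi t + \int[leb]_(t in `[x, (x + e)%R[) phi t.
  rewrite eqU; apply: Rintegral_setU => //.
    by apply: integrable_phi; apply: measurableU.
  apply/disj_setPS => t [] /=; rewrite !in_itv/= => h1 /andP[h2 _].
  by move: (lt_le_trans h1 h2); rewrite ltxx.
rewrite lerD2l.
apply: (@le_trans _ _ (\int[leb]_(t in `[x, (x + e)%R[) normal_peak 1)).
  apply: le_Rintegral => //; first exact: integrable_phi.
    apply: measurable_bounded_integrable => //=.
      by rewrite lebesgue_measure_itv/= lte_fin xe -EFinD ltry.
    exists (normal_peak 1); split; first exact: num_real.
    by move=> y hy t _ /=; rewrite ger0_norm ?normal_peak_ge0// ltW.
  by move=> t _; apply: normal_pdf_ub; exact: oner_neq0.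
by rewrite Rintegral_cst//= lebesgue_measure_itv/= lte_fin xe/= addrAC subrr add0r.
Qed.

(** The smoothed indicator lies between those of [w < x] and [w < x + e], so its Gaussian mean
    exceeds [Phi x] by [O(e)] at most. Its slope, at most [2 / e], passes through [stein_ode] to the
    derivative of [g]; thus [g] is Lipschitz of order [1 + 1 / e], whence the quadratic
    remainder. *)
Lemma stein_smoothed_indicator : exists2 K : R, 0 < K & forall x e : R, 0 < e ->
  exists f g : R -> R, [/\ continuous f /\ continuous g,
   forall w, `|f w| <= K /\ `|g w| <= K,
   forall a b, `|f b - f a - g a * (b - a)| <= K * (1 + e^-1) * (b - a) ^+ 2,
   forall w : R, (w < x)%R%:R - (Phi x + K * e) <= g w - w * f w &
   forall w : R, g w - w * f w <= (w < x + e)%R%:R - Phi x].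
Proof.
have p0 : 0 < normal_peak (1:R) by rewrite normal_peak_gt0 ?oner_eq0.
pose K0 : R := 1 + (phi 1)^-1.
have K01 : 1 < K0 by rewrite ltrDl invr_gt0 normal_pdf01_gt0.
(* The constant covers the bound [K0] on [f], the bound 2 on [g], the Lipschitz constant
   [2 * (K0 + 2 / e)] of [g], and the increment [normal_peak 1 * e] of [Phi]. *)
exists (normal_peak 1 + 2 * K0 + 4); first lra.
move=> x e e0.
have ei : 0 < e^-1 by rewrite invr_gt0.
pose h w := step ((w - x) / e); pose h' w := step' ((w - x) / e) / e.
have dh : has_derive h h'.
  apply: (has_derive_quad (K := 8 / e ^+ 2)) => a b.
  have := step_quad ((a - x) / e) ((b - x) / e); rewrite -/(h a) -/(h b).
  have -> : (b - x) / e - (a - x) / e = (b - a) / e by field; lra.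
  rewrite /h' mulrA mulrAC => /le_trans; apply.
  by rewrite expr_div_n; rewrite mulrCA mulrC.
have h01 w : 0 <= h w <= 1 by exact: step01.
have hx w : w < x -> h w = 1.
  by move=> wx; apply: step0; rewrite pmulr_lle0//; lra.
have hxe w : x + e <= w -> h w = 0.
  by move=> wx; apply: step1; rewrite ler_pdivlMr//; lra.
have ch : continuous h := has_derive_continuous dh.
have ihphi : leb.-integrable setT (EFin \o (fun t => h t * phi t)).
  apply: le_integrable (integrable_phi measurableT) => //.
    apply/measurable_EFinP; apply: measurable_funM; first exact: continuous_measurable_fun.
    exact: measurable_normal_pdf.
  move=> t _ /=; rewrite lee_fin normrM ler_piMl//.
  by have /andP[? ?] := h01 t; rewrite ger0_norm.
pose N := \int[leb]_t (h t * phi t).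
have NPhi (y : R) (b : R -> bool) : (forall w, b w = (w < y)) ->
    \int[leb]_t ((b t)%:R * phi t) = Phi y /\ leb.-integrable setT (EFin \o (fun t => (b t)%:R * phi t)).
  move=> bE; split.
    rewrite PhiE [RHS]Rintegral_mkcond; apply: eq_Rintegral => t _.
    rewrite patchE bE (_ : (t \in _) = (t < y)); last by apply/idP/idP; rewrite inE/= in_itv.
    by case: (t < y); rewrite ?mul1r ?mul0r.
  apply: le_integrable (integrable_phi measurableT) => //.
    apply/measurable_EFinP; apply: measurable_funM; last exact: measurable_normal_pdf.
    rewrite (_ : (fun _ => _) = \1_(`]-oo, y[)); first exact: measurable_indic.
    apply/funext => w; rewrite indicE bE; congr (nat_of_bool _)%:R.
    by apply/idP/idP; rewrite inE/= in_itv.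
  by move=> t _ /=; rewrite lee_fin normrM ler_piMl//; case: (b t); rewrite ?normr1 ?normr0.
have [P1 I1] := NPhi x (fun w => w < x) (fun=> erefl).
have [P2 I2] := NPhi (x + e) (fun w => w < x + e) (fun=> erefl).
have phi0 := @normal_pdf_ge0 R 0 1.
have hlow (w : R) : (w < x)%R%:R <= h w.
  by case: ltP => [/hx ->//|_]; have /andP[] := h01 w.
have hup (w : R) : h w <= (w < x + e)%R%:R.
  by case: ltP => [_|/hxe ->//]; have /andP[] := h01 w.
have N1 : Phi x <= N.
  by rewrite -P1; apply: le_Rintegral => // t _; rewrite ler_wpM2r.
have N2 : N <= Phi x + normal_peak 1 * e.
  apply: le_trans (Phi_lipschitz x e0).
  by rewrite -P2; apply: le_Rintegral => // t _; rewrite ler_wpM2r.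
have iphi1 : \int[leb]_t phi t = 1.
  by rewrite /Rintegral integral_normal_pdf.
have N0 : 0 <= N by apply: Rintegral_ge0 => t _; rewrite mulr_ge0//; have /andP[] := h01 t.
have N01 : N <= 1.
  rewrite -iphi1; apply: le_Rintegral => //; first exact: integrable_phi.
  by move=> t _; rewrite ler_piMl//; have /andP[] := h01 t.
pose k w := h w - N.
have ck : continuous k.
  by move=> w; apply: cvgB; [exact: ch|exact: cvg_cst].
have k1 w : `|k w| <= 1.
  by rewrite ler_norml; have /andP[? ?] := h01 w; apply/andP; split; rewrite /k; lra.
have k0 : \int[leb]_t (k t * phi t) = 0.
  have -> : \int[leb]_t (k t * phi t) = \int[leb]_t (h t * phi t - N * phi t).
    by apply: eq_Rintegral => t _; rewrite mulrBl.
  rewrite RintegralB//; last first.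
    rewrite (_ : _ \o _ = (fun t => N%:E * (phi t)%:E)%E)//.
    by apply: integrableZl => //; exact: integrable_phi.
  by rewrite RintegralZl//; [rewrite iphi1 mulr1 subrr|exact: integrable_phi].
have [f [fK df]] := stein_solution ck k1 k0.
rewrite -/K0 in fK.
pose g w := w * f w + k w.
have wf := stein_ode df fK k1.
have gK w : `|g w| <= 2 by rewrite (le_trans (ler_normD _ _))//; have := wf w; have := k1 w; lra.
have did : has_derive (fun w : R => w) (fun=> 1) by move=> w; exact: is_derive_id.
have dk : has_derive k h'.
  by apply: (has_derive_eq (has_deriveD dh (has_derive_cst (- N)))) => w; rewrite addr0.
have dg : has_derive g (fun w => w * g w + (f w + h' w)).
  by apply: (has_derive_eq (has_deriveD (has_deriveM did df) dk)) => w; rewrite /= /g; ring.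
have h'K w : `|f w + h' w| <= K0 + 2 * e^-1.
  rewrite (le_trans (ler_normD _ _))// lerD// normrM (gtr0_norm ei).
  by rewrite ler_pM2r//; exact: step'_le.
have gLip := has_derive_lipschitz (K := 2 * (K0 + 2 * e^-1)) dg.
have wg := stein_ode dg gK h'K.
exists f, g; split.
- by split; [exact: has_derive_continuous df|exact: has_derive_continuous dg].
- by move=> w; have := fK w; have := gK w; split; lra.
- move=> a b.
  have gL : forall a b, `|g b - g a| <= 2 * (K0 + 2 * e^-1) * `|b - a|.
    apply: gLip => w; rewrite (le_trans (ler_normD _ _))//.
    by have := wg w; have := h'K w; lra.
  have main a' b' y : a' <= b' -> `|f b' - f a' - g y * (b' - a')| <=
      2 * (K0 + 2 * e^-1) * (b' - a') ^+ 2 \/ ~ (a' <= y <= b').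
    move=> ab; have [yab|?] := boolP (a' <= y <= b'); last by right; apply/negP.
    left; have [c cab ->] := has_derive_MVT df ab.
    rewrite -/(g c) -mulrBl normrM [X in _ * X]ger0_norm ?subr_ge0// expr2 mulrA.
    rewrite ler_wpM2r ?subr_ge0//.
    apply: (le_trans (gL _ _)); rewrite ler_wpM2l//; first lra.
    by move: cab yab => /andP[? ?] /andP[? ?]; rewrite ler_norml; apply/andP; split; lra.
  have X0 : 0 <= (b - a) ^+ 2 by exact: sqr_ge0.
  apply: (@le_trans _ _ (2 * (K0 + 2 * e^-1) * (b - a) ^+ 2)); last first.
    by rewrite ler_wpM2r//; nra.
  have [ab|/ltW ba] := leP a b.
    by have [//|] := main a b a ab; rewrite lexx.
  have [|] := main b a a ba; last by rewrite lexx ba.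
  have -> : f b - f a - g a * (b - a) = - (f a - f b - g a * (a - b)) by ring.
  by move=> hm; rewrite normrN; have -> : (b - a) ^+ 2 = (a - b) ^+ 2 by ring.
- move=> w; rewrite /g /k; have := hlow w; have := mulr_gt0 p0 e0; nra.
- by move=> w; rewrite /g /k; have := hup w; lra.
Qed.

End SteinTest.

(** * Kolmogorov distance bound by Stein's method *)

Section Stein.
Context d (E : measurableType d) (R : realType).
Notation Om := (seqspace E).
Variable Q : probability Om R.
Variable mu : set E -> \bar R.
Hypothesis Qind : forall (s : seq nat) (A : nat -> set E), uniq s ->
  (forall i, measurable (A i)) ->
  Q [set z | forall i, i \in s -> A i (z i)] = (\prod_(i <- s) mu (A i))%E.
Variable e0 : E.

Notation Ex := (expct Q).
Notation Df := (dropdiff e0).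
Implicit Types F G : Om -> R.

Lemma Ex_var F : bmeas F -> Ex (fun z => (F z - Ex F) ^+ 2) = Ex (fun z => F z ^+ 2) - Ex F ^+ 2.
Proof.
move=> bF; have b2 := bmeasX 2 bF.
rewrite (_ : (fun _ => _) = (fun z => F z ^+ 2 - (2 * Ex F * F z - Ex F ^+ 2))); last first.
  by apply/funext => z; rewrite sqrrB -mulr_natl; ring.
rewrite ExB//; last by apply: bmeasB; [apply: bmeasM => //; exact: bmeas_cst|exact: bmeas_cst].
rewrite ExB; [|by apply: bmeasM => //; exact: bmeas_cst|exact: bmeas_cst].
by rewrite ExZ// Ex_cst; ring.
Qed.

Lemma Ex_abs_le_sqrt F : bmeas F -> Ex (fun z => `|F z|) <= Num.sqrt (Ex (fun z => F z ^+ 2)).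
Proof.
move=> bF; have bA := bmeas_abs bF.
have h0 : 0 <= Ex (fun z => `|F z|) by exact: Ex_ge0.
rewrite -[leLHS]ger0_norm// -sqrtr_sqr ler_wsqrtr// -subr_ge0.
have := Ex_var bA; rewrite (_ : (fun z => `|F z| ^+ 2) = (fun z => F z ^+ 2)).
  by move=> <-; apply: Ex_ge0 => z; exact: sqr_ge0.
by apply/funext => z; rewrite real_normK// num_real.
Qed.

Lemma sqr_mul_le (a b : R) : 0 <= a -> 0 <= b -> a ^+ 2 * b <= a ^+ 3 + b ^+ 3.
Proof.
move=> a0 b0; have [ab|/ltW ab] := leP b a.
  by rewrite (exprSr a 2) -[leLHS]addr0 lerD ?exprn_ge0// ler_wpM2l ?exprn_ge0.
rewrite (exprSr b 2) -[leLHS]add0r lerD ?exprn_ge0// ler_wpM2r// ler_pXn2r// nnegrE.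
Qed.

(** The variable T of the overview, for a general functional [F]. *)
Definition exch_var n F (z : Om) : R := \sum_(i < n)
  Df i F z * (Df i F (relabel (swap_first n i) z) - Df i F (relabel (swap_first n i.+1) z)).

Lemma bmeas_exch_var n F : bmeas F -> bmeas (exch_var n F).
Proof.
move=> bF; apply: bmeas_sum => i _; apply: bmeasM; first exact: bmeas_Df.
by apply: bmeasB; apply: bmeas_relabel; exact: bmeas_Df.
Qed.

Lemma Ex_exch_var n F : bmeas F -> dep_below n F -> Ex (exch_var n F) = Ex (fun z => F z ^+ 2) - Ex F ^+ 2.
Proof.
move=> bF dF; rewrite Ex_sum; last first.
  move=> i _; apply: bmeasM; first exact: bmeas_Df.
  by apply: bmeasB; apply: bmeas_relabel; exact: bmeas_Df.
by rewrite -(cov_identity Qind e0 bF bF dF dF).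
Qed.

(* The covariance identity for [f \o W] and [F], with [Df i (f \o W)] linearized by Taylor. *)
Lemma stein_bound n F (m s K K' : R) (f g : R -> R) (W := fun z => (F z - m) / s) : bmeas F -> dep_below n F -> 0 < s ->
  continuous f -> continuous g -> (forall w, `|f w| <= K /\ `|g w| <= K) ->
  (forall a b, `|f b - f a - g a * (b - a)| <= K' * (b - a) ^+ 2) ->
  `|Ex (fun z => g (W z) - W z * f (W z))| <=
  K * ((`|s ^+ 2 - (Ex (fun z => F z ^+ 2) - Ex F ^+ 2)| +
        Num.sqrt (Ex (fun z => exch_var n F z ^+ 2) - Ex (exch_var n F) ^+ 2)) / s ^+ 2 +
       `|Ex F - m| / s) +
  4 * K' * (\sum_(i < n) Ex (fun z => `|Df i F z| ^+ 3)) / s ^+ 3.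
Proof.
move=> bF dF s0 cf cg fgK taylor.
have K0 : 0 <= K by have [h _] := fgK 0; exact: le_trans h.
have K'0 : 0 <= K'.
  have := le_trans (normr_ge0 _) (taylor 0 1).
  by rewrite subr0 expr1n mulr1.
have sn0 : s != 0 by rewrite gt_eqF.
have bW : bmeas W.
  by apply: bmeasM; [apply: bmeasB => //; exact: bmeas_cst|exact: bmeas_cst].
have bcomp (h : R -> R) : continuous h -> (forall w, `|h w| <= K) -> bmeas (fun z => h (W z)).
  move=> ch hK; split; last by exists K => z; exact: hK.
  by apply: (measurableT_comp (continuous_measurable_fun ch)); case: bW.
have bf : bmeas (fun z => f (W z)) by apply: bcomp => // w; have [] := fgK w.
have bg : bmeas (fun z => g (W z)) by apply: bcomp => // w; have [] := fgK w.
pose G z := f (W z).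
have dG : dep_below n G by move=> z z' h; rewrite /G /W (dF _ _ h).
have bT := bmeas_exch_var n bF.
pose D i z := Df i F (relabel (swap_first n i) z) - Df i F (relabel (swap_first n i.+1) z).
have bDf i : bmeas (Df i F) by exact: bmeas_Df.
have bD i : bmeas (D i) by apply: bmeasB; apply: bmeas_relabel; exact: bmeas_Df.
pose rho i z := Df i G z - g (W z) * (Df i F z / s).
have bGG : bmeas G by [].
have bDG i : bmeas (Df i G) by exact: bmeas_Df.
have bDs i : bmeas (fun z => Df i F z / s) by apply: bmeasM => //; exact: bmeas_cst.
have brho i : bmeas (rho i) by apply: bmeasB => //; exact: bmeasM.
have rhole i z : `|rho i z| <= K' * (Df i F z / s) ^+ 2.
  have := taylor (W z) (W (update z i e0)).
  have -> : W (update z i e0) - W z = - (Df i F z / s) by rewrite /W /dropdiff; field.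
  rewrite sqrrN mulrN opprK; apply: le_trans.
  by rewrite -normrN; apply: eq_ler; congr `|_|; rewrite /rho /dropdiff /G; ring.
have cov := cov_identity Qind e0 bF bGG dF dG.
pose Rem := \sum_(i < n) Ex (fun z => rho i z * D i z).
have covE : Ex (fun z => G z * F z) - Ex G * Ex F = Ex (fun z => g (W z) * exch_var n F z) / s + Rem.
  rewrite cov mulrC -ExZ; last exact: bmeasM.
  rewrite (_ : (fun z => _ * _) =
     (fun z => \sum_(i < n) g (W z) * (Df i F z / s) * D i z)); last first.
    apply/funext => z; rewrite /exch_var mulrA mulr_sumr; apply: eq_bigr => i _.
    by rewrite /D; ring.
  rewrite Ex_sum; last by move=> i _; apply: bmeasM => //; apply: bmeasM.
  rewrite -big_split/=; apply: eq_bigr => i _; rewrite -ExD; last 2 first.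
  - by apply: bmeasM => //; exact: bmeasM.
  - exact: bmeasM.
  by congr (expct Q); apply/funext => z; rewrite /rho -/(D i z); ring.
(* A remainder quadratic in [Df i F] meets an increment of [Df i F]. The factor 4 comes from
   [a^2 * (b + c) <= 2 * a^3 + b^3 + c^3], as swaps preserve third moments. *)
have RemE : `|Rem| <= 4 * K' * (\sum_(i < n) Ex (fun z => `|Df i F z| ^+ 3)) / s ^+ 2.
  apply: (le_trans (ler_norm_sum _ _ _)).
  rewrite mulr_sumr mulr_suml; apply: ler_sum => -[i /= iN] _.
  have bX : bmeas (fun z => `|Df i F z| ^+ 3) by apply/bmeasX/bmeas_abs.
  have bX1 : bmeas (fun z => `|Df i F (relabel (swap_first n i) z)| ^+ 3) by exact: (bmeas_relabel _ bX).
  have bX2 : bmeas (fun z => `|Df i F (relabel (swap_first n i.+1) z)| ^+ 3) by exact: (bmeas_relabel _ bX).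
  have b2 : bmeas (fun z => 2 * `|Df i F z| ^+ 3) by apply: bmeasM => //; exact: bmeas_cst.
  apply: (le_trans (Ex_abs Q (bmeasM (brho i) (bD i)))).
  apply: (@le_trans _ _ (Ex (fun z => K' / s ^+ 2 * (2 * `|Df i F z| ^+ 3 +
     `|Df i F (relabel (swap_first n i) z)| ^+ 3 + `|Df i F (relabel (swap_first n i.+1) z)| ^+ 3)))).
    apply: Ex_le.
    - by apply: bmeas_abs; exact: bmeasM.
    - by apply: bmeasM; [exact: bmeas_cst|apply: bmeasD => //; apply: bmeasD].
    move=> z; rewrite normrM.
    apply: (@le_trans _ _ (K' * (Df i F z / s) ^+ 2 * `|D i z|)).
      by rewrite ler_wpM2r.
    have -> : K' * (Df i F z / s) ^+ 2 * `|D i z| = K' / s ^+ 2 * (`|Df i F z| ^+ 2 * `|D i z|).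
      by rewrite real_normK ?num_real// exprMn exprVn; ring.
    apply: ler_wpM2l; first by rewrite divr_ge0// exprn_ge0// ltW.
    apply: (@le_trans _ _ (`|Df i F z| ^+ 2 * (`|Df i F (relabel (swap_first n i) z)| +
       `|Df i F (relabel (swap_first n i.+1) z)|))).
      by apply: ler_wpM2l; [exact: exprn_ge0|exact: ler_normB].
    have h1 := sqr_mul_le (normr_ge0 (Df i F z)) (normr_ge0 (Df i F (relabel (swap_first n i) z))).
    have h2 := sqr_mul_le (normr_ge0 (Df i F z)) (normr_ge0 (Df i F (relabel (swap_first n i.+1) z))).
    by rewrite mulrDr; lra.
  rewrite ExZ; last by apply: bmeasD => //; apply: bmeasD.
  rewrite ExD//; last by apply: bmeasD.
  rewrite ExD// ExZ//.
  have := Ex_swap Qind (F := fun z => `|Df i F z| ^+ 3) (ltnW iN) bX.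
  have := Ex_swap Qind (F := fun z => `|Df i F z| ^+ 3) iN bX.
  by move=> -> ->; apply: eq_ler; ring.
have b1 : bmeas (fun z => g (W z) * exch_var n F z) by exact: bmeasM.
have bs2 : bmeas (fun z => s ^+ 2 * g (W z)) by apply: bmeasM => //; exact: bmeas_cst.
have main : Ex (fun z => g (W z) - W z * f (W z)) =
   Ex (fun z => g (W z) * (s ^+ 2 - exch_var n F z)) / s ^+ 2 - Rem / s - Ex G * ((Ex F - m) / s).
  rewrite ExB//; last exact: bmeasM.
  have -> : Ex (fun z => W z * f (W z)) = (Ex (fun z => G z * F z) - m * Ex G) / s.
    rewrite -ExZ// -ExB; [|exact: bmeasM|by apply: bmeasM => //; exact: bmeas_cst].
    rewrite mulrC -ExZ; last by apply: bmeasB; apply: bmeasM => //; exact: bmeas_cst.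
    by congr (expct Q); apply/funext => z; rewrite /W /G; ring.
  rewrite (_ : (fun z => _ * (s ^+ 2 - _)) = (fun z => s ^+ 2 * g (W z) - g (W z) * exch_var n F z)); last first.
    by apply/funext => z; ring.
  rewrite ExB// ExZ//.
  have -> : Ex (fun z => G z * F z) = Ex G * Ex F + (Ex (fun z => g (W z) * exch_var n F z) / s + Rem).
    by rewrite -covE addrC subrK.
  by field.
rewrite main.
have s20 : 0 < s ^+ 2 by exact: exprn_gt0.
have hG : `|Ex G| <= K.
  apply: (le_trans (Ex_abs Q bGG)); rewrite -[leRHS](Ex_cst Q).
  by apply: Ex_le; [exact: bmeas_abs|exact: bmeas_cst|move=> z; have [] := fgK (W z)].
have bST : bmeas (fun z => s ^+ 2 - exch_var n F z) by apply: bmeasB => //; exact: bmeas_cst.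
have hA : `|Ex (fun z => g (W z) * (s ^+ 2 - exch_var n F z))| <=
   K * (`|s ^+ 2 - (Ex (fun z => F z ^+ 2) - Ex F ^+ 2)| +
        Num.sqrt (Ex (fun z => exch_var n F z ^+ 2) - Ex (exch_var n F) ^+ 2)).
  rewrite -(Ex_exch_var bF dF); apply: (le_trans (Ex_abs Q (bmeasM bg bST))).
  pose c := `|s ^+ 2 - Ex (exch_var n F)|.
  have bTc : bmeas (fun z => exch_var n F z - Ex (exch_var n F)) by apply: bmeasB => //; exact: bmeas_cst.
  apply: (@le_trans _ _ (Ex (fun z => K * (c + `|exch_var n F z - Ex (exch_var n F)|)))).
    apply: Ex_le.
    - by apply: bmeas_abs; exact: bmeasM.
    - by apply: bmeasM; [exact: bmeas_cst|apply: bmeasD; [exact: bmeas_cst|exact: bmeas_abs]].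
    move=> z; rewrite normrM; apply: ler_pM => //; first by have [] := fgK (W z).
    by rewrite /c [X in _ <= _ + X]distrC; exact: (ler_distD (Ex (exch_var n F))).
  rewrite ExZ; last by apply: bmeasD; [exact: bmeas_cst|exact: bmeas_abs].
  rewrite ExD; [|exact: bmeas_cst|exact: bmeas_abs].
  rewrite Ex_cst ler_wpM2l// lerD2l -Ex_var//.
  exact: (Ex_abs_le_sqrt bTc).
have nd (a c : R) : 0 < c -> `|a / c| = `|a| / c.
  by move=> c0; rewrite normrM normfV (gtr0_norm c0).
apply: (le_trans (ler_normB _ _)).
rewrite mulrDr -addrA [X in _ <= _ + X]addrC addrA; apply: lerD.
  apply: (le_trans (ler_normB _ _)); rewrite !nd//; apply: lerD.
    rewrite [leRHS]mulrA; apply: ler_wpM2r hA.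
    by rewrite invr_ge0 ltW.
  have -> : s ^- 3 = s ^- 2 / s by rewrite exprSr invfM.
  rewrite [leRHS]mulrA; apply: ler_wpM2r RemE.
  by rewrite invr_ge0 ltW.
rewrite normrM nd//; apply: ler_wpM2r hG.
by apply: mulr_ge0 => //; rewrite invr_ge0 ltW.
Qed.

(** [m] and [s] are not tied to [F]: later [F] is the truncated record count while [m] and [s]
    standardize the untruncated one, and the two mismatches appear as explicit error terms. The
    smoothing width [e] is still free here. *)
Lemma stein_kolmogorov : exists2 K : R, 0 < K & forall n F (m s e : R), bmeas F -> dep_below n F ->
  0 < s -> 0 < e -> forall x : R,
  `|Ex (fun z => ((F z - m) / s < x)%R%:R) - Phi x| <=
  K * (e + (`|s ^+ 2 - (Ex (fun z => F z ^+ 2) - Ex F ^+ 2)| +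
        Num.sqrt (Ex (fun z => exch_var n F z ^+ 2) - Ex (exch_var n F) ^+ 2)) / s ^+ 2 +
       `|Ex F - m| / s +
   4 * (1 + e^-1) * (\sum_(i < n) Ex (fun z => `|Df i F z| ^+ 3)) / s ^+ 3).
Proof.
have [K K0 hK] := @stein_smoothed_indicator R.
have p0 := normal_peak_ge0 (1:R).
exists (K + normal_peak 1); first lra.
move=> n F m s e bF dF s0 e0' x.
set A := (_ + Num.sqrt _) / _; set B := `|Ex F - m| / s; set C := 4 * _ * _ / _.
have si : 0 <= s^-1 by rewrite invr_ge0 ltW.
have sn i : 0 <= s ^- i by rewrite invr_ge0 exprn_ge0// ltW.
have A0 : 0 <= A by apply: mulr_ge0 => //; rewrite addr_ge0 ?sqrtr_ge0.
have B0 : 0 <= B by apply: mulr_ge0.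
have C0 : 0 <= C.
  apply: mulr_ge0 => //; apply: mulr_ge0.
    by rewrite mulr_ge0// addr_ge0// invr_ge0 ltW.
  by apply: sumr_ge0 => i _; apply: Ex_ge0 => z; exact: exprn_ge0.
have bW : bmeas (fun z => (F z - m) / s).
  by apply: bmeasM; [apply: bmeasB => //; exact: bmeas_cst|exact: bmeas_cst].
have bI y : bmeas (fun z => ((F z - m) / s < y)%R%:R : R).
  apply: bmeas_pred; have [mW _] := bW.
  by rewrite -[X in measurable X]setTI; apply: (measurable_fun_ltr mW (measurable_cst y)).
have bgf (f g : R -> R) : continuous f -> continuous g -> (forall w, `|f w| <= K /\ `|g w| <= K) ->
   bmeas (fun z => g ((F z - m) / s) - (F z - m) / s * f ((F z - m) / s)).
  move=> cf cg fgK.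
  have bcomp (h : R -> R) : continuous h -> (forall w, `|h w| <= K) -> bmeas (fun z => h ((F z - m) / s)).
    move=> ch hK'; split; last by exists K => z; exact: hK'.
    by apply: (measurableT_comp (continuous_measurable_fun ch)); case: bW.
  by apply: bmeasB; [|apply: bmeasM => //]; apply: bcomp => // w; have [] := fgK w.
have key (f g : R -> R) : continuous f -> continuous g -> (forall w, `|f w| <= K /\ `|g w| <= K) ->
   (forall a b, `|f b - f a - g a * (b - a)| <= K * (1 + e^-1) * (b - a) ^+ 2) ->
   `|Ex (fun z => g ((F z - m) / s) - (F z - m) / s * f ((F z - m) / s))| <= K * (A + B + C).
  move=> cf cg fgK ty; apply: (le_trans (stein_bound m bF dF s0 cf cg fgK ty)).
  by rewrite -/A -/B; apply: eq_ler; rewrite [RHS]mulrDr; congr (_ + _); rewrite /C; ring.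
rewrite ler_norml; apply/andP; split.
  (* The lower estimate smooths between [x - e] and [x], the upper one between [x] and [x + e]; each
     costs [O(e)]. *)
  have [f [g [[cf cg] fgK ty _ h]]] := hK (x - e) e e0'.
  have := key f g cf cg fgK ty; rewrite ler_norml => /andP[_ h2]; move: h2 => _.
  have := key f g cf cg fgK ty; rewrite ler_norml => /andP[h1 _].
  have : Ex (fun z => g ((F z - m) / s) - (F z - m) / s * f ((F z - m) / s)) <=
     Ex (fun z => ((F z - m) / s < x)%R%:R - Phi (x - e)).
    apply: Ex_le; [exact: bgf|by apply: bmeasB => //; exact: bmeas_cst|move=> z].
    by have := h ((F z - m) / s); rewrite subrK.
  rewrite (ExB Q (bI x) (bmeas_cst _ _)).
  rewrite Ex_cst; have := Phi_lipschitz (x - e) e0'; rewrite subrK.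
  have := mulr_ge0 p0 (addr_ge0 (addr_ge0 A0 B0) C0); have := mulr_ge0 (ltW K0) (ltW e0').
  by lra.
have [f [g [[cf cg] fgK ty h _]]] := hK x e e0'.
have := key f g cf cg fgK ty; rewrite ler_norml => /andP[_ h1].
have : Ex (fun z => ((F z - m) / s < x)%R%:R - (Phi x + K * e)) <=
   Ex (fun z => g ((F z - m) / s) - (F z - m) / s * f ((F z - m) / s)).
  by apply: Ex_le; [by apply: bmeasB => //; exact: bmeas_cst|exact: bgf|move=> z; exact: h].
rewrite (ExB Q (bI x) (bmeas_cst _ _)).
rewrite Ex_cst.
have := mulr_ge0 p0 (addr_ge0 (addr_ge0 A0 B0) C0); have := mulr_ge0 p0 (ltW e0').
by lra.
Qed.

End Stein.

(** * Volumes of corner regions of the simplex *)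

Section AffineVolume.
Context {R : realType}.
Notation leb := (@lebesgue_measure R).
Local Open Scope ereal_scope.

(** By uniqueness of Lebesgue measure, tested on half-open intervals. Negative ratios are included
    for [law_down], where the points below [y] fill part of a reflected simplex; the preimage of a
    half-open interval is then closed at its other end. *)
Lemma ge0_integral_affine (a c : R) (f : R -> \bar R) : c != 0%R ->
  measurable_fun setT f -> (forall x, 0 <= f x) ->
  \int[leb]_x f x = `|c|%:E * \int[leb]_x f (a + c * x)%R.
Proof.
move=> c0 mf f0.
pose tau : measurableTypeR R -> measurableTypeR R := fun x => (a + c * x)%R.
have mtau : measurable_fun setT tau.
  by apply: (@measurable_funD _ R R) => //; apply: (@measurable_funM _ R R).
pose m'' : {measure set (measurableTypeR R) -> \bar R} :=
  mscale (NngNum (normr_ge0 c)) (pushforward leb tau : {measure set (measurableTypeR R) -> \bar R}) : {measure set (measurableTypeR R) -> \bar R}.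
pose m' := m'' mtau.
transitivity (\int[m']_x f x).
  apply: eq_measure_integral => A mA _; apply: lebesgue_measure_unique => //.
  move=> _ [[u v] _ <-].
  rewrite /m'/m''/= /mscale/= /pushforward.
  have [cp|cn|/eqP] := ltgtP c 0%R; last by rewrite (negbTE c0).
  - rewrite (_ : _ @^-1` _ = [set` `[((v - a) / c)%R, ((u - a) / c)%R[]); last first.
      apply/seteqP; split => x /=; rewrite /tau !in_itv/= => /andP[h1 h2]; apply/andP; split.
      + by rewrite ler_ndivrMr// mulrC; lra.
      + by rewrite ltr_ndivlMr// mulrC; lra.
      + by move: h2; rewrite ltr_ndivlMr// mulrC; lra.
      + by move: h1; rewrite ler_ndivrMr// mulrC; lra.
    rewrite !lebesgue_measure_itv/= !lte_fin ltr_nM2r ?invr_lt0// ltrD2r.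
    case: ifPn => _; last by rewrite mule0.
    by rewrite -!EFinD -EFinM ltr0_norm//; congr (_%:E); field.
  - rewrite (_ : _ @^-1` _ = [set` `]((u - a) / c)%R, ((v - a) / c)%R]]); last first.
      apply/seteqP; split => x /=; rewrite /tau !in_itv/= => /andP[h1 h2]; apply/andP; split.
      + by rewrite ltr_pdivrMr// mulrC; lra.
      + by rewrite ler_pdivlMr// mulrC; lra.
      + by move: h1; rewrite ltr_pdivrMr// mulrC; lra.
      + by move: h2; rewrite ler_pdivlMr// mulrC; lra.
    rewrite !lebesgue_measure_itv/= !lte_fin ltr_pM2r ?invr_gt0// ltrD2r.
    case: ifPn => _; last by rewrite mule0.
    by rewrite -!EFinD -EFinM gtr0_norm//; congr (_%:E); field.
rewrite ge0_integral_mscale//; congr (_ * _).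
by rewrite ge0_integral_pushforward.
Qed.

Lemma iint_ge0 d (f : d.-tuple R -> \bar R) : (forall x, 0 <= f x) -> 0 <= iint f.
Proof.
elim: d f => [|d ih] f f0 /=; first exact: f0.
by apply: integral_ge0 => x _; apply: ih.
Qed.

(** The parameter space [S] is general so that the induction can move the outer variable of
    integration into it. *)
Lemma measurable_iint d dS (S : measurableType dS) (f : S * d.-tuple R -> \bar R) :
  measurable_fun setT f -> (forall x, 0 <= f x) ->
  measurable_fun setT (fun s => iint (fun t => f (s, t))).
Proof.
elim: d dS S f => [|d ih] dS S f mf f0 /=.
  apply: (measurableT_comp mf); apply: measurable_fun_pair => //.
pose f' : (S * R) * d.-tuple R -> \bar R := fun q => f (q.1.1, [the (d.+1).-tuple R of q.1.2 :: q.2]).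
have mf' : measurable_fun setT f'.
  apply: (measurableT_comp mf); apply: measurable_fun_pair.
    exact: measurableT_comp.
  by apply: measurable_cons => //; exact: measurableT_comp.
have h := ih _ (S * R)%type f' mf' (fun x => f0 _).
have := @measurable_fun_fubini_tonelli_F _ _ S (measurableTypeR R) R leb
  (fun q => iint (fun t => f' (q, t))) h (fun q => iint_ge0 (fun t => f0 _)).
by rewrite /fubini_F/=; congr measurable_fun; apply/funext => s.
Qed.

Definition affine d (a : d.-tuple R) (c : R) (x : d.-tuple R) : d.-tuple R :=
  [tuple (tnth a i + c * tnth x i)%R | i < d].

Lemma measurable_affine d (a : d.-tuple R) c : measurable_fun setT (affine a c).
Proof.
apply/measurable_fun_tnthP => i.
rewrite (_ : _ \o _ = fun x => (tnth a i + c * tnth x i)%R); last first.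
  by apply/funext => x /=; rewrite tnth_mktuple.
by apply: measurable_funD => //; apply: measurable_funM => //; exact: measurable_tnth.
Qed.

Lemma iint_affine d (f : d.-tuple R -> \bar R) (a : d.-tuple R) (c : R) : c != 0%R ->
  measurable_fun setT f -> (forall x, 0 <= f x) ->
  iint f = (`|c| ^+ d)%:E * iint (fun x => f (affine a c x)).
Proof.
move=> c0; elim: d f a => [|d ih] f a mf f0 /=.
  by rewrite expr0 mul1e; congr f; rewrite [RHS]tuple0 [LHS]tuple0.
have mcons : measurable_fun setT (fun q : R * d.-tuple R => [the (d.+1).-tuple R of q.1 :: q.2]).
  by apply: measurable_cons.
have mg x : measurable_fun setT (fun t : d.-tuple R => f [tuple of x :: t]).
  by apply: (measurableT_comp mf); apply: measurable_cons.
rewrite (ge0_integral_affine (thead a) c0).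
- rewrite exprS EFinM -muleA; congr (_ * _).
  rewrite -ge0_integralZl//=.
  + apply: eq_integral => x _; rewrite (ih _ [tuple of behead a])//.
    congr (_ * _); congr iint; apply/funext => t; congr f.
    apply: eq_from_tnth => i; rewrite tnth_mktuple.
    case: (unliftP ord0 i) => [j ->|->].
      rewrite !tnthS tnth_mktuple; congr (_ + _)%R.
      by rewrite !(tnth_nth 0%R)/= nth_behead.
    by rewrite !tnth0 /thead.
  + pose f' (q : R * d.-tuple R) := f (affine a c [tuple of q.1 :: q.2]).
    have : measurable_fun setT f'.
      apply: (measurableT_comp mf); apply: (measurableT_comp (measurable_affine a c)).
      exact: mcons.
    by move=> /measurable_iint; apply => q; exact: f0.
  + by move=> x _; apply: iint_ge0.
- pose f' (q : R * d.-tuple R) := f ([tuple of q.1 :: q.2]).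
  have : measurable_fun setT f' by apply: (measurableT_comp mf).
  by move=> /measurable_iint; apply => q; exact: f0.
- by move=> x; apply: iint_ge0.
Qed.

Lemma vol_affine d (A : set (d.-tuple R)) (a : d.-tuple R) (c : R) : c != 0%R ->
  measurable A -> vol A = (`|c| ^+ d)%:E * vol (affine a c @^-1` A).
Proof.
move=> c0 mA; rewrite /vol (iint_affine a c0)//.
by apply/measurable_EFinP; exact: measurable_indic.
Qed.

End AffineVolume.

(** * Dominance probabilities under the uniform law *)

Section UniformSimplex.
Context {R : realType} (d : nat) (d0 : (0 < d)%N).
Notation E := (d.-tuple R).
Notation S := (@simplex R d).
Variable m : probability E R.
Hypothesis mU : forall A : set E, measurable A ->
  m A = (fine (vol (A `&` S)) / fine (vol S))%:E.

Definition coord_sum (x : E) : R := \sum_(j < d) tnth x j.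
Definition slack (x : E) : R := 1 - coord_sum x.
Definition in_simplex (x : E) : bool := [forall j : 'I_d, 0 <= tnth x j] && (coord_sum x <= 1).
(** Requiring both points to lie in the simplex makes an outside point incomparable with all others,
    so that overwriting a point by such a one amounts to deleting it. Under the uniform law this
    differs from [dominated] only on a null set. *)
Definition prec (x y : E) : bool := [&& in_simplex x, in_simplex y & dominated x y].
Definition dom_prob (x : E) : R := slack x ^+ d.

Lemma in_simplexP x : reflect (S x) (in_simplex x).
Proof.
apply: (iffP andP) => -[h1 h2]; split => //; first exact/forallP.
by apply/forallP.
Qed.

Lemma measurable_coord_sum : measurable_fun setT coord_sum.
Proof. by apply: measurable_sum => j; exact: measurable_tnth. Qed.

Lemma measurable_slack : measurable_fun setT slack.
Proof. by apply: measurable_funB => //; exact: measurable_coord_sum. Qed.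

Lemma measurable_dom_prob : measurable_fun setT dom_prob.
Proof. by apply: measurable_funX; exact: measurable_slack. Qed.

Lemma measurable_in_simplex d' (T : measurableType d') (f : T -> E) : measurable_fun setT f ->
  measurable [set t | in_simplex (f t)].
Proof.
move=> mf.
rewrite (_ : [set _ | _] = (\bigcap_(j in [set: 'I_d]) [set t | 0 <= tnth (f t) j]) `&`
   [set t | coord_sum (f t) <= 1]).
  apply: measurableI.
    apply: fin_bigcap_measurable => [|j _]; first exact: finite_finset.
    rewrite -[X in measurable X]setTI.
    rewrite (_ : [set t | 0 <= _] = (fun t => tnth (f t) j) @^-1` `[0, +oo[); last first.
      by apply/seteqP; split => t /=; rewrite in_itv/= andbT.
    exact: (measurableT_comp (measurable_tnth j) mf measurableT (measurable_itv _)).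
  rewrite -[X in measurable X]setTI.
  rewrite (_ : [set t | _] = (fun t => coord_sum (f t)) @^-1` `]-oo, 1]); last first.
    by apply/seteqP; split => t /=; rewrite in_itv.
  exact: (measurableT_comp measurable_coord_sum mf measurableT (measurable_itv _)).
apply/seteqP; split => t /=.
  by move=> /andP[/forallP h1 h2]; split => // j _; exact: h1.
by move=> [h1 h2]; apply/andP; split => //; apply/forallP => j; exact: h1.
Qed.

Lemma measurable_simplex : measurable S.
Proof.
rewrite (_ : S = [set x | in_simplex x]); first exact: measurable_in_simplex.
by apply/seteqP; split => x /in_simplexP.
Qed.

Lemma measurable_dominated d' (T : measurableType d') (f g : T -> E) :
  measurable_fun setT f -> measurable_fun setT g ->
  measurable [set t | dominated (f t) (g t)].
Proof.
move=> mf mg.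
rewrite (_ : [set _ | _] = \bigcap_(j in [set: 'I_d]) [set t | tnth (f t) j < tnth (g t) j]).
  apply: fin_bigcap_measurable => [|j _]; first exact: finite_finset.
  rewrite -[X in measurable X]setTI.
  rewrite (_ : [set t | _ < _] = (fun t => tnth (g t) j - tnth (f t) j) @^-1` `]0, +oo[); last first.
    by apply/seteqP; split => t /=; rewrite in_itv/= andbT subr_gt0.
  apply: (measurable_funB (measurableT_comp (measurable_tnth j) mg)
     (measurableT_comp (measurable_tnth j) mf)) => //.
apply/seteqP; split => t /=; first by move=> /forallP h j _; exact: h.
by move=> h; apply/forallP => j; exact: h.
Qed.

Lemma measurable_prec d' (T : measurableType d') (f g : T -> E) :
  measurable_fun setT f -> measurable_fun setT g ->
  measurable [set t | prec (f t) (g t)].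
Proof.
move=> mf mg.
rewrite (_ : [set _ | _] = [set t | in_simplex (f t)] `&` ([set t | in_simplex (g t)] `&` [set t | dominated (f t) (g t)])).
  apply: measurableI; [exact: measurable_in_simplex|apply: measurableI; [exact: measurable_in_simplex|exact: measurable_dominated]].
by apply/seteqP; split => t /= => [/and3P[]//|[? [? ?]]]; apply/and3P.
Qed.

Let V := fine (vol S).

(** The volume of the simplex is never computed: that it is positive and finite follows from total
    mass 1, since [fine] sends an infinite value to 0. *)
Let V0 : V != 0.
Proof.
apply/eqP => h; have := probability_setT m; rewrite mU// -/V h invr0 mulr0.
by move=> [] /eqP; rewrite eq_sym oner_eq0.
Qed.

Let vol_ge0 (A : set E) : (0 <= vol A)%E.
Proof. by apply: iint_ge0 => x; rewrite lee_fin. Qed.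

Let volS : vol S = V%:E.
Proof.
rewrite /V fineK//; have := V0; rewrite /V; move: (vol_ge0 S).
by case: (vol S) => [r||] //=; rewrite eqxx.
Qed.

Let Vgt0 : 0 < V.
Proof. by rewrite lt_neqAle eq_sym V0/= fine_ge0. Qed.

Lemma iint_le n (f g : n.-tuple R -> \bar R) : measurable_fun setT f ->
  measurable_fun setT g -> (forall x, 0 <= f x)%E -> (forall x, f x <= g x)%E ->
  (iint f <= iint g)%E.
Proof.
elim: n f g => [|n ih] f g mf mg f0 fg /=; first exact: fg.
have g0 x : (0 <= g x)%E := le_trans (f0 x) (fg x).
have mc (h : n.+1.-tuple R -> \bar R) : measurable_fun setT h ->
    measurable_fun setT (fun q : R * n.-tuple R => h [tuple of q.1 :: q.2]).
  by move=> mh; apply: (measurableT_comp mh); exact: measurable_cons.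
have mc1 (h : n.+1.-tuple R -> \bar R) x : measurable_fun setT h ->
    measurable_fun setT (fun t : n.-tuple R => h [tuple of x :: t]).
  by move=> mh; apply: (measurableT_comp mh); exact: measurable_cons.
apply: ge0_le_integral => //.
- by move=> x _; exact: iint_ge0.
- by have := measurable_iint (mc f mf); apply => q; exact: f0.
- by have := measurable_iint (mc g mg); apply => q; exact: g0.
- by move=> x _; apply: ih => //; exact: mc1.
Qed.

Let vol_le (A B : set E) : measurable A -> measurable B -> A `<=` B -> (vol A <= vol B)%E.
Proof.
move=> mA mB AB; apply: iint_le.
- by apply/measurable_EFinP; exact: measurable_indic.
- by apply/measurable_EFinP; exact: measurable_indic.
- by move=> x; rewrite lee_fin.
- move=> x; rewrite lee_fin !indicE ler_nat.
  by case: (boolP (x \in A)) => // /set_mem /AB /mem_set ->.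
Qed.

(* The sets below are compared with preimages of the simplex under homotheties, whose
   volumes are [`|r| ^+ d * vol S]. *)
Definition homothety (w : E) (r : R) (y : E) : E := [tuple (tnth y i - tnth w i) / r | i < d].

Let coord_sum_homothety w r y : coord_sum (homothety w r y) = (coord_sum y - coord_sum w) / r.
Proof.
rewrite /coord_sum -sumrB mulr_suml; apply: eq_bigr => i _.
by rewrite tnth_mktuple.
Qed.

Let simplex_homothety w r y : r != 0 -> S (homothety w r y) <->
  (forall i, 0 <= (tnth y i - tnth w i) / r) /\ (coord_sum y - coord_sum w) / r <= 1.
Proof.
move=> r0; rewrite -coord_sum_homothety; split => -[h1 h2]; split => // i.
  by have := h1 i; rewrite tnth_mktuple.
by rewrite tnth_mktuple.
Qed.

Let measurable_homothety w r : measurable (homothety w r @^-1` S).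
Proof.
rewrite -[X in measurable X]setTI.
suff mh : measurable_fun setT (homothety w r) by apply: mh => //; exact: measurable_simplex.
apply/measurable_fun_tnthP => i.
rewrite (_ : _ \o _ = fun x => (tnth x i - tnth w i) / r); last first.
  by apply/funext => x /=; rewrite tnth_mktuple.
apply: measurable_funM => //; apply: measurable_funB => //; exact: measurable_tnth.
Qed.

Let vol_homothety w r : r != 0 -> vol (homothety w r @^-1` S) = (`|r| ^+ d * V)%:E.
Proof.
move=> r0; rewrite (vol_affine w r0); last exact: measurable_homothety.
rewrite (_ : _ @^-1` _ = S) ?volS ?EFinM//.
apply/seteqP; split => x /=; rewrite (_ : homothety w r (affine w r x) = x)//;
 by apply: eq_from_tnth => i; rewrite !tnth_mktuple addrAC subrr add0r mulrC mulKf.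
Qed.

Lemma law_le w r (A : set E) : r != 0 -> measurable A ->
  A `&` S `<=` homothety w r @^-1` S -> fine (m A) <= `|r| ^+ d.
Proof.
move=> r0 mA AB; rewrite mU//= ler_pdivrMr// -/V.
have mAS : measurable (A `&` S) by apply: measurableI => //; exact: measurable_simplex.
have h := vol_le mAS (measurable_homothety w r) AB.
rewrite vol_homothety// in h.
by rewrite -[leRHS]/(fine (_%:E)) fine_le// ge0_fin_numE// (le_lt_trans h)// ltry.
Qed.

Lemma law_ge w r (A : set E) : r != 0 -> measurable A ->
  homothety w r @^-1` S `<=` A `&` S -> `|r| ^+ d <= fine (m A).
Proof.
move=> r0 mA AB; rewrite mU//= ler_pdivlMr// -/V.
have mAS : measurable (A `&` S) by apply: measurableI => //; exact: measurable_simplex.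
have h := vol_le (measurable_homothety w r) mAS AB.
have h' : (vol (A `&` S) <= vol S)%E by apply: vol_le => //; exact: measurable_simplex.
rewrite vol_homothety// in h; rewrite -[leLHS]/(fine (_%:E)) fine_le//.
by rewrite ge0_fin_numE// (le_lt_trans h')// volS ltry.
Qed.

Lemma law_in_simplex : m [set x | in_simplex x] = 1%E.
Proof.
rewrite mU; last exact: measurable_in_simplex.
rewrite (_ : _ `&` _ = S); first by rewrite divff.
by apply/seteqP; split => x /= => [[]//|Sx]; split => //; apply/in_simplexP.
Qed.

Lemma exprn_lip n (a b : R) : 0 <= a -> a <= b -> b <= 1 -> b ^+ n - a ^+ n <= n%:R * (b - a).
Proof.
move=> a0 ab b1; elim: n => [|n ih]; first by rewrite !expr0 subrr mul0r.
rewrite !exprS -natr1.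
have : 0 <= b ^+ n <= 1 by rewrite exprn_ge0 ?exprn_ile1//; lra.
have : 0 <= a ^+ n <= 1 by rewrite exprn_ge0 ?exprn_ile1//; lra.
move: ih; set x := _ ^+ n; set y := _ ^+ n; set k := _%:R => ih /andP[y0 y1] /andP[x0 x1].
have : b * x - a * y = a * (x - y) + (b - a) * x by ring.
have k0 : 0 <= k * (b - a) by rewrite mulr_ge0 ?ler0n ?subr_ge0.
have h1 : a * (x - y) <= a * (k * (b - a)) by rewrite ler_wpM2l.
have h2 : a * (k * (b - a)) <= k * (b - a) by rewrite ler_piMl//; lra.
have h3 : (b - a) * x <= b - a by rewrite ler_piMr// subr_ge0.
by move=> ->; lra.
Qed.

Lemma slack01 x : in_simplex x -> 0 <= slack x <= 1.
Proof.
move=> /andP[/forallP h1 h2]; rewrite subr_ge0 h2 lerBlDr lerDl /=.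
by apply: sumr_ge0 => j _.
Qed.

(** Up to boundary, the points of the simplex above [x] form the homothetic copy with vertex [x] and
    ratio [slack x]. Strict dominance loses some faces, so the lower bound uses a smaller copy with
    shifted vertex and lets the loss tend to 0. *)
Lemma law_up x : in_simplex x -> fine (m [set y | prec x y]) = dom_prob x.
Proof.
move=> xS; have mA : measurable [set y | prec x y].
  by apply: measurable_prec => //; exact: measurable_cst.
have /andP[s0 s1] := slack01 xS; have /andP[/forallP x0 x1] := xS.
have [sz|sn0] := eqVneq (slack x) 0.
  rewrite /dom_prob sz expr0n gtn_eqF//= (_ : [set _ | _] = set0) ?measure0//.
  apply/seteqP; split => y //= /and3P[_ /andP[_ y1] /forallP xy].
  suff : coord_sum x < coord_sum y by move: sz y1; rewrite /slack; lra.
  apply: ltr_sum => [|j _]; last exact: xy.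
  by apply/hasP; exists (Ordinal d0); rewrite ?mem_index_enum.
have sp : 0 < slack x by rewrite lt_neqAle eq_sym sn0.
apply/eqP; rewrite eq_le; apply/andP; split.
  rewrite /dom_prob -[X in X ^+ d]gtr0_norm//; apply: (law_le (w := x)) => //.
  move=> y /= [/and3P[_ /andP[_ y1] /forallP xy] _]; apply/simplex_homothety => //; split.
    by move=> i; rewrite divr_ge0 ?ltW// subr_gt0 xy.
  by rewrite ler_pdivrMr// mul1r /slack; lra.
apply/ler_addgt0Pr => e e0.
have dR : 1 <= d%:R :> R by rewrite ler1n.
(* [del <= slack x / 2] keeps the ratio positive, and [d * del <= e] bounds the loss in [exprn_lip].
   Shifting each coordinate by [del / d] raises the coordinate sum by [del]. *)
pose del := Num.min (slack x / 2) (e / d%:R).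
have del0 : 0 < del by rewrite lt_min !divr_gt0//; lra.
have dele : d%:R * del <= e by rewrite mulrC -ler_pdivlMr ?ge_min ?lexx ?orbT//; lra.
have dels : del < slack x by rewrite gt_min; apply/orP; left; lra.
pose eps := del / d%:R.
have eps0 : 0 < eps by rewrite divr_gt0//; lra.
have deps : d%:R * eps = del by rewrite mulrC divfK//; lra.
pose w : E := [tuple tnth x i + eps | i < d].
have cw : coord_sum w = coord_sum x + del.
  rewrite /coord_sum -deps -[X in X * eps](_ : \sum_(i < d) 1 = _).
    by rewrite mulr_suml -big_split; apply: eq_bigr => i _; rewrite tnth_mktuple mul1r.
  by rewrite sumr_const card_ord.
have r0 : 0 < slack x - del by lra.
have : `|slack x - del| ^+ d <= fine (m [set y | prec x y]).
  apply: (law_ge (w := w)) => //; first by rewrite gt_eqF.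
  move=> y /simplex_homothety[|h1 h2]; first by rewrite gt_eqF.
  have h1' i : tnth x i + eps <= tnth y i.
    by have := h1 i; rewrite tnth_mktuple pmulr_lge0 ?invr_gt0// subr_ge0.
  have yS : in_simplex y.
    apply/andP; split; first by apply/forallP => i; have := h1' i; have := x0 i; lra.
    by move: h2; rewrite ler_pdivrMr// cw mul1r /slack; lra.
  split => /=; last exact/in_simplexP.
  by apply/and3P; split => //; apply/forallP => i; have := h1' i; lra.
rewrite gtr0_norm// => /(le_trans _) h.
have := @exprn_lip d (slack x - del) (slack x); rewrite /dom_prob => /(_ _ _ s1) h2.
have : (slack x - del) ^+ d <= fine (m [set y | prec x y]) by apply: h.
by move: h2 (ltW r0) => h2 r0'; have := h2 r0'; rewrite lerBlDr lerDl ltW// => /(_ isT); lra.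
Qed.

(** If [x] lies below [y], the coordinates of [y - x] are positive with sum at most [slack x], hence
    at most the [d]-th root of [t]. So [x] lies in a reflected copy of the simplex with vertex [y]
    and volume ratio [t], whatever [y] is. *)
Lemma law_down y t : 0 < t -> fine (m [set x | prec x y && (dom_prob x <= t)]) <= t.
Proof.
move=> t0; have mA : measurable [set x | prec x y && (dom_prob x <= t)].
  rewrite (_ : [set _ | _] = [set x | prec x y] `&` [set x | dom_prob x <= t]).
    apply: measurableI; first by apply: measurable_prec => //; exact: measurable_cst.
    rewrite -[X in measurable X]setTI.
    rewrite (_ : [set x | _] = dom_prob @^-1` `]-oo, t]); first exact: measurable_dom_prob.
    by apply/seteqP; split => x /=; rewrite in_itv.
  by apply/seteqP; split => x /= /andP.
pose rho := t `^ (d%:R^-1).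
have rho0 : 0 < rho by rewrite powR_gt0.
have rhoE : rho ^+ d = t.
  by rewrite -powR_mulrn ?ltW// -powRrM mulVf ?powRr1 ?ltW// pnatr_eq0 -lt0n.
rewrite -[leRHS]rhoE -[X in _ <= X ^+ d]gtr0_norm// -normrN.
apply: (law_le (w := y)) => //; first by rewrite oppr_eq0 gt_eqF.
move=> x [/= /andP[/and3P[xS /andP[_ y1] /forallP xy] vt] _].
apply/simplex_homothety; first by rewrite oppr_eq0 gt_eqF.
split.
  by move=> i; rewrite invrN mulrN -mulNr opprB divr_ge0 ?ltW// subr_gt0.
rewrite invrN mulrN -mulNr opprB ler_pdivrMr// mul1r.
have /andP[s0 _] := slack01 xS.
have : slack x <= rho.
  by rewrite -(ler_pXn2r d0) ?nnegrE ?(ltW rho0)// rhoE.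
by rewrite /slack; lra.
Qed.

Lemma measurable_low (u : R) : measurable [set x : E | in_simplex x && (dom_prob x <= u ^+ d)].
Proof.
rewrite (_ : [set _ | _] = [set x | in_simplex x] `&` [set x | dom_prob x <= u ^+ d]).
  apply: measurableI; first exact: measurable_in_simplex.
  rewrite -[X in measurable X]setTI.
  rewrite (_ : [set x | dom_prob _ <= _] = dom_prob @^-1` `]-oo, u ^+ d]); first exact: measurable_dom_prob.
  by apply/seteqP; split => x /=; rewrite in_itv.
by apply/seteqP; split => x /= /andP.
Qed.

Let law_C (A : set E) : measurable A -> fine (m (~` A)) = 1 - fine (m A).
Proof. by move=> mA; rewrite probability_setC// fineB// fin_num_measure. Qed.

Lemma law_low_ge u : 0 <= u <= 1 -> u <= fine (m [set x | in_simplex x && (dom_prob x <= u ^+ d)]).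
Proof.
move=> /andP[u0 u1]; have mA := measurable_low u.
have [->|un1] := eqVneq u 1.
  rewrite (_ : [set _ | _] = [set x | in_simplex x]) ?law_in_simplex//.
  apply/seteqP; split => x /= => [/andP[]//|xS]; rewrite xS/= expr1n.
  by have /andP[? ?] := slack01 xS; rewrite exprn_ile1.
have u1' : u < 1 by rewrite lt_neqAle un1.
have : fine (m (~` [set x | in_simplex x && (dom_prob x <= u ^+ d)])) <= `|1 - u| ^+ d.
  apply: (law_le (w := [tuple 0 | i < d])) => //; first by rewrite subr_eq0 eq_sym.
    exact: measurableC.
  move=> x [/= /negP h /in_simplexP xS]; rewrite xS/= -ltNge in h.
  have /andP[s0 _] := slack01 xS.
  have {}h : u < slack x by rewrite -(ltr_pXn2r d0).
  have c0 : coord_sum [tuple 0 | i < d] = 0.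
    by rewrite /coord_sum big1// => i _; rewrite tnth_mktuple.
  apply/simplex_homothety; first by rewrite subr_eq0 eq_sym.
  rewrite c0 subr0 ler_pdivrMr ?subr_gt0// mul1r; split; last by move: h; rewrite /slack; lra.
  move=> i; rewrite tnth_mktuple subr0 divr_ge0 ?subr_ge0//.
  by move: xS => /andP[/forallP].
rewrite law_C// gtr0_norm ?subr_gt0//.
have : (1 - u) ^+ d <= 1 - u.
  by case: d d0 => // n _; rewrite exprS ler_piMr ?exprn_ile1//; lra.
by lra.
Qed.

Lemma law_low_le u : 0 <= u -> fine (m [set x | in_simplex x && (dom_prob x <= u ^+ d)]) <= d%:R * u.
Proof.
move=> u0; have mA := measurable_low u.
have dR : 1 <= d%:R :> R by rewrite ler1n.
have m1 : fine (m [set x | in_simplex x && (dom_prob x <= u ^+ d)]) <= 1.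
  rewrite -[leRHS]/(fine 1%E) fine_le ?fin_num_measure//.
  exact: (@probability_le1 _ _ _ m).
have [u1|u1] := leP 1 u; first by apply: (le_trans m1); nra.
apply/ler_addgt0Pr => e e0.
(* The points in the copy of ratio [1 - u'] have slack at least [u' > u]; the margin is needed since
   the complement is given by a strict inequality. *)
pose u' := Num.min ((1 + u) / 2) (u + e / d%:R).
have ed : 0 < e / d%:R by rewrite divr_gt0//; lra.
have uu' : u < u' by rewrite lt_min; apply/andP; split; lra.
have u'1 : u' < 1 by rewrite gt_min; apply/orP; left; lra.
have u'e : d%:R * u' <= d%:R * u + e.
  have : u' <= u + e / d%:R by rewrite ge_min lexx orbT.
  rewrite -(ler_pM2l (_ : 0 < d%:R)) ?mulrDr; last lra.
  by rewrite [_ * (e / _)]mulrC divfK//; lra.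
have : `|1 - u'| ^+ d <= fine (m (~` [set x | in_simplex x && (dom_prob x <= u ^+ d)])).
  apply: (law_ge (w := [tuple 0 | i < d])) => //; first by rewrite subr_eq0 gt_eqF.
    exact: measurableC.
  have c0 : coord_sum [tuple 0 | i < d] = 0.
    by rewrite /coord_sum big1// => i _; rewrite tnth_mktuple.
  move=> x /simplex_homothety[|h1 h2]; first by rewrite subr_eq0 gt_eqF.
  have xS : in_simplex x.
    apply/andP; split.
      by apply/forallP => i; have := h1 i; rewrite tnth_mktuple subr0 pmulr_lge0// invr_gt0 subr_gt0.
    by move: h2; rewrite c0 subr0 ler_pdivrMr ?subr_gt0//; lra.
  split; last exact/in_simplexP.
  rewrite /= xS/=; apply/negP; rewrite -ltNge ltr_pXn2r// ?nnegrE//; last by have /andP[] := slack01 xS.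
  by move: h2; rewrite c0 subr0 ler_pdivrMr ?subr_gt0// /slack; lra.
rewrite law_C// gtr0_norm ?subr_gt0//.
have := @exprn_lip d (1 - u') 1; rewrite expr1n subr_ge0 (ltW u'1) => /(_ isT _ (lexx _)).
by rewrite gerBl; move=> /(_ (ltW (le_lt_trans u0 uu'))); lra.
Qed.

End UniformSimplex.

(** * Numerical estimates *)

Section Numeric.
Variable R : realType.

Lemma expR_half_le2 : expR (2^-1 : R) <= 2.
Proof.
have h : 2^-1 <= expR (- 2^-1 : R) by have := expR_ge1Dx (- 2^-1 : R); lra.
by move: h; rewrite expRN lef_pV2 ?posrE ?expR_gt0.
Qed.

Lemma half_expn_le (M : nat) : 2^-1 ^+ M <= expR (- (M%:R / 2)) :> R.
Proof.
rewrite -mulrN expRM_natl lerXn2r ?nnegrE ?expR_ge0//.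
by have := expR_ge1Dx (- 2^-1 : R); lra.
Qed.

Lemma ln_ge1 (n : nat) : (4 <= n)%N -> 1 <= ln n%:R :> R.
Proof.
move=> n4; have n0 : 0 < n%:R :> R by rewrite ltr0n; lia.
rewrite -ler_expR lnK// (@le_trans _ _ 4%:R) ?ler_nat//.
rewrite [X in expR X](_ : 1 = 2^-1 + 2^-1); last by lra.
rewrite expRD (_ : 4%:R = 2 * 2 :> R); last by rewrite -natrM.
by apply: ler_pM; rewrite ?expR_ge0 ?expR_half_le2.
Qed.

Lemma harmonic_le (n : nat) : (0 < n)%N -> \sum_(k < n) k.+1%:R^-1 <= 1 + ln n%:R :> R.
Proof.
case: n => // n _; elim: n => [|n ih]; first by rewrite big_ord1 ln1 addr0 invr1.
rewrite big_ord_recr/=; apply: (le_trans (lerD ih (lexx _))).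
rewrite -addrA lerD2l.
have n1 : 0 < n.+1%:R :> R by rewrite ltr0n.
have n2 : 0 < n.+2%:R :> R by rewrite ltr0n.
have := @le_ln1Dx R (- n.+2%:R^-1).
have -> : 1 + - n.+2%:R^-1 = n.+1%:R / n.+2%:R :> R.
  apply: (mulIf (lt0r_neq0 n2)); rewrite mulrDl divfK ?lt0r_neq0// mulNr mulVf ?lt0r_neq0//.
  by rewrite mul1r -natr1 addrK.
rewrite ln_div ?posrE// ltrN2 invf_lt1// ltr1n => /(_ isT).
by rewrite lerBlDl lerBrDr.
Qed.

Lemma harmonic_gap_le (c : R) (n l : nat) : 0 <= c -> (l < n)%N ->
  \sum_(m < n | (l < m)%N) c / (m - l)%:R <= c * (1 + ln n%:R).
Proof.
move=> c0 ln; have n0 : (0 < n)%N by lia.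
apply: (@le_trans _ _ (c * \sum_(k < n) k.+1%:R^-1)); last first.
  by rewrite ler_wpM2l// harmonic_le.
rewrite -(big_mkord (fun m => (l < m)%N) (fun m => c / (m - l)%:R)).
rewrite -(@big_nat_widenl _ _ _ l.+1 0 n predT)//.
rewrite -[l.+1]add0n big_addn big_mkord mulr_sumr.
rewrite (big_ord_widen n (fun i => c / (i + l.+1 - l)%:R)) ?leq_subr// big_mkcond/=.
apply: ler_sum => i _; case: ifP => _; last by rewrite divr_ge0.
by rewrite addnS -addSn addnK.
Qed.

(** From [ln x < x] at [x = n^(1/32)]. The exponent 1/8 is the least value of [(1 - 1/d) / 4] for
    [d >= 2], so four logarithms are absorbed by one factor of the final rate. *)
Lemma ln_pow4_le (n : nat) : (0 < n)%N -> ln n%:R ^+ 4 <= 32 ^+ 4 * n%:R `^ (8^-1) :> R.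
Proof.
move=> n0; have n1 : 0 < n%:R :> R by rewrite ltr0n.
have l0 : 0 <= ln n%:R :> R by rewrite ln_ge0// ler1n.
have -> : n%:R `^ (8^-1) = (n%:R `^ (32^-1)) ^+ 4 :> R.
  by rewrite -powR_mulrn ?powR_ge0// -powRrM; congr (_ `^ _); lra.
rewrite -exprMn ler_pXn2r ?nnegrE ?mulr_ge0 ?powR_ge0//.
have := ln_sublinear (powR_gt0 (32^-1) n1); rewrite ln_powR => /ltW h.
by rewrite mulrC -ler_pdivrMr// mulrC.
Qed.

End Numeric.

(** Here [q^4] is the variance scale, so [s] is at least of order [q^2]; [S3] is the sum of third
    moments, [sv] the deviation of T, and [dl], [A] are truncation errors. The cubic term is of
    order [l^2 / (e * q^2)], which the width [e = l / q] balances. The T term is of order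
    [l^6 / q^2], at most a constant times [l^2 / q] because [l^4 <= a4 * q]. *)
Lemma kolmogorov_bound_assembly (R : realType) (K a av a3 a4 q l s dl A sv S3 : R) :
  0 <= K -> 0 <= a -> 0 <= av -> 0 <= a3 -> 0 <= a4 -> 1 <= q -> 1 <= l -> 0 < s -> q ^+ 2 <= a * s ->
  0 <= dl <= q^-1 -> 0 <= A <= 4 -> 0 <= sv <= av * l ^+ 6 * q ^+ 2 ->
  l ^+ 4 <= a4 * q -> 0 <= S3 <= a3 * l ^+ 2 * q ^+ 4 ->
  dl + K * (l / q + (A + sv) / s ^+ 2 + dl / s + 4 * (1 + (l / q)^-1) * S3 / s ^+ 3) <=
  (1 + K * (1 + a ^+ 2 * (4 + av * a4) + a + 8 * a ^+ 3 * a3)) * (q^-1 * l ^+ 2).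
Proof.
move=> K0 a0 av0 a30 a40 q1 l1 s0 qs /andP[dl0 dl1] /andP[A0 A4] /andP[sv0 sv1] la /andP[S0 S1].
have q0 : 0 < q by lra.
have l0 : 0 < l by lra.
have qn0 : q != 0 by rewrite gt_eqF.
have qi0 : 0 < q^-1 by rewrite invr_gt0.
have qi1 : q^-1 <= 1 by rewrite invf_le1.
have si0 : 0 < s^-1 by rewrite invr_gt0.
have si : s^-1 <= a * q^-1 ^+ 2.
  rewrite exprVn ler_pdivlMr ?exprn_gt0// mulrC ler_pdivrMr//.
have l21 : 1 <= l ^+ 2 by rewrite exprn_ege1.
have T0 : 0 < q^-1 * l ^+ 2 by rewrite mulr_gt0// exprn_gt0.
have T1 : q^-1 <= q^-1 * l ^+ 2 by rewrite ler_peMr// ltW.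
have qiX k : q^-1 ^+ k.+1 <= q^-1 by rewrite exprS ler_piMr ?(ltW qi0)// exprn_ile1// ltW.
have siX k : s^-1 ^+ k <= (a * q^-1 ^+ 2) ^+ k.
  by rewrite lerXn2r// ?nnegrE ?(ltW si0)// mulr_ge0// exprn_ge0// ltW.
have h1 : l / q <= q^-1 * l ^+ 2.
  by rewrite mulrC ler_wpM2l ?(ltW qi0)// expr2 ler_peMr// ltW.
have h2 : (A + sv) / s ^+ 2 <= a ^+ 2 * (4 + av * a4) * (q^-1 * l ^+ 2).
  rewrite -exprVn; apply: (@le_trans _ _ ((4 + av * l ^+ 6 * q ^+ 2) * (a * q^-1 ^+ 2) ^+ 2)).
    apply: ler_pM => //; [exact: addr_ge0|by rewrite exprn_ge0// ltW|exact: lerD].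
  have -> : (4 + av * l ^+ 6 * q ^+ 2) * (a * q^-1 ^+ 2) ^+ 2 =
    a ^+ 2 * (4 * q^-1 ^+ 4 + av * (l ^+ 2 * q^-1 ^+ 2 * l ^+ 4)) by field.
  rewrite -[leRHS]mulrA ler_wpM2l ?exprn_ge0// [leRHS]mulrDl; apply: lerD.
    by rewrite ler_wpM2l// (le_trans (qiX 3)).
  rewrite -[leRHS]mulrA; apply: ler_wpM2l => //.
  have -> : a4 * (q^-1 * l ^+ 2) = l ^+ 2 * q^-1 ^+ 2 * (a4 * q) by field.
  by apply: ler_wpM2l la; rewrite mulr_ge0// exprn_ge0// ltW.
have h3 : dl / s <= a * (q^-1 * l ^+ 2).
  apply: (@le_trans _ _ (q^-1 * (a * q^-1 ^+ 2))).
    by apply: ler_pM => //; exact: ltW.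
  by rewrite mulrCA -exprS ler_wpM2l// (le_trans (qiX 2)).
have h4 : 4 * (1 + (l / q)^-1) * S3 / s ^+ 3 <= 8 * a ^+ 3 * a3 * (q^-1 * l ^+ 2).
  have lq : 0 <= (l / q)^-1 <= q.
    rewrite invf_div; apply/andP; split; first by rewrite divr_ge0// ltW.
    by rewrite ler_pdivrMr// ler_peMr// ltW.
  have /andP[lq0 lq1] := lq.
  rewrite -(exprVn s 3); apply: (@le_trans _ _ (4 * (q + q) * (a3 * l ^+ 2 * q ^+ 4) * (a * q^-1 ^+ 2) ^+ 3)).
    apply: ler_pM => //.
    - by rewrite !mulr_ge0// addr_ge0.
    - by rewrite exprn_ge0// ltW.
    apply: ler_pM => //; first by rewrite mulr_ge0// addr_ge0.
    by rewrite ler_wpM2l// lerD.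
  by apply: eq_ler; field.
rewrite [leRHS]mulrDl mul1r -[K * _ * _]mulrA; apply: lerD; first exact: le_trans T1.
apply: ler_wpM2l => //; rewrite [leRHS]mulrDl; apply: lerD h4; rewrite [leRHS]mulrDl; apply: lerD h3.
by rewrite [leRHS]mulrDl mul1r; apply: lerD.
Qed.

(** Turns the bound of [variance_lower] into a power of [n]: the estimates [n <= 512 * (n %/ 256)]
    and [(4 * n)^a <= 4 * n^a] lose a factor 2048, below [256^2 / 16]. *)
Lemma powR_block_lower (R : realType) (n : nat) (a : R) : 0 < a <= 1 -> (256 <= n)%N ->
  n%:R `^ (1 - a) <= 256 ^+ 2 * (16^-1 * ((n %/ 256)%:R * (4 * n%:R)^-1 `^ a)).
Proof.
move=> /andP[a0 a1] n256; have n0 : 0 < n%:R :> R by rewrite ltr0n (leq_trans _ n256).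
have n4 : 0 < 4 * n%:R :> R by rewrite mulr_gt0.
have hk : n%:R <= 512 * (n %/ 256)%:R :> R.
  by rewrite -natrM ler_nat; move: n256; clear; lia.
have hx : (4 * n%:R)^-1 `^ a = ((4 * n%:R) `^ a)^-1.
  apply: (mulIf (lt0r_neq0 (powR_gt0 a n4))); rewrite mulVf ?gt_eqF ?powR_gt0//.
  by rewrite -powRM ?invr_ge0 ?(ltW n4)// mulVf ?gt_eqF// powR1.
have h4 : (4 * n%:R) `^ a <= 4 * n%:R `^ a.
  rewrite powRM// ?(ltW n0)// ler_wpM2r ?powR_ge0//.
  by rewrite -[leRHS]powRr1//; apply: ler_powR => //; rewrite ler1n.
rewrite hx powRB ?(gt_eqF n0) ?implybT//.
rewrite powRr1 ?(ltW n0)//.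
have p0 : 0 < n%:R `^ a by exact: powR_gt0.
have q0 : 0 < (4 * n%:R) `^ a by exact: powR_gt0.
move: hk h4 p0 q0; set k := (n %/ 256)%:R; set x := n%:R `^ a; set y := (4 * _) `^ a.
move=> hk h4 p0 q0; rewrite ler_pdivrMr//.
have -> : 256 ^+ 2 * (16^-1 * (k / y)) * x = 4096 * k * x / y by field; rewrite gt_eqF.
rewrite ler_pdivlMr//; apply: (@le_trans _ _ (512 * k * (4 * x))).
  by apply: ler_pM => //; exact: ltW.
have k0 : 0 <= k * x by rewrite mulr_ge0// ltW.
lra.
Qed.

Lemma exists_powR_ge (R : realType) (c a : R) : 0 < a -> 0 <= c ->
  exists b : nat, c <= b%:R `^ a.
Proof.
move=> a0 c0; exists (Num.trunc (c `^ a^-1)).+1.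
rewrite -[leLHS](powRr1 c0) -[X in c `^ X](mulVf (lt0r_neq0 a0)) powRrM.
by apply: ge0_ler_powR; rewrite ?nnegrE ?powR_ge0 ?(ltW a0)// ltW// truncnS_gt.
Qed.

(** * Record counts *)

Ltac bmt := repeat first
  [ done | assumption | apply: bmeas_cst | apply: bmeasX | apply: bmeasM | apply: bmeasB | apply: bmeasD | apply: bmeasN
  | apply: bmeas_abs
  | apply: bmeas_sum => ? ? | apply: bmeas_prod => ? ? ].

(** The left side is at most the geometric sum of [u * (1 - u)^i] over [i <= m], whose smallest term
    is the last. *)
Lemma mul_pow_le1 (R : realType) (m : nat) (u : R) : 0 <= u <= 1 -> m.+1%:R * u * (1 - u) ^+ m <= 1.
Proof.
move=> /andP[u0 u1].
have h : \sum_(i < m.+1) u * (1 - u) ^+ i <= 1.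
  have -> : \sum_(i < m.+1) u * (1 - u) ^+ i = 1 - (1 - u) ^+ m.+1.
    have := subrXX (1 : R) (1 - u) m.+1; rewrite expr1n => ->.
    rewrite -mulr_sumr; congr (_ * _); first by ring.
    by apply: eq_bigr => i _; rewrite expr1n mul1r.
  by rewrite gerBl exprn_ge0// subr_ge0.
apply: le_trans h; rewrite -mulrA mulr_natl -[X in _ *+ X]card_ord -sumr_const.
apply: ler_sum => i _; rewrite ler_wpM2l// ler_wiXn2l ?subr_ge0//; first lra.
by rewrite -ltnS.
Qed.

Lemma pow_le_inv_sqr (R : realType) (m : nat) (u : R) : 0 < u <= 1 ->
  (1 - u) ^+ m <= 4 / (m.+1%:R * u) ^+ 2.
Proof.
move=> /andP[u0 u1]; have u0' := ltW u0; have u01 : 0 <= u <= 1 by rewrite u0'.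
rewrite ler_pdivlMr; last by rewrite exprn_gt0// mulr_gt0.
pose h := (m %/ 2)%N.
have hm : (h + h <= m)%N by rewrite /h; lia.
have mh : (m.+1 <= 2 * h.+1)%N by rewrite /h; lia.
have e1 := mul_pow_le1 h u01.
have e2 : 0 <= h.+1%:R * u * (1 - u) ^+ h.
  by rewrite mulr_ge0 ?exprn_ge0 ?subr_ge0// mulr_ge0.
have e3 : (1 - u) ^+ m <= (1 - u) ^+ h * (1 - u) ^+ h.
  by rewrite -exprD ler_wiXn2l ?subr_ge0//; lra.
have e4 : (m.+1%:R * u) ^+ 2 <= 4 * (h.+1%:R * u) ^+ 2.
  have -> : 4 * (h.+1%:R * u) ^+ 2 = ((2 * h.+1)%:R * u) ^+ 2 by rewrite natrM; ring.
  by rewrite ler_pXn2r ?nnegrE ?mulr_ge0// ler_pM2r// ler_nat.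
have e5 : (h.+1%:R * u * (1 - u) ^+ h) ^+ 2 <= 1 by rewrite exprn_ile1.
apply: (@le_trans _ _ ((1 - u) ^+ h * (1 - u) ^+ h * (4 * (h.+1%:R * u) ^+ 2))).
  by apply: ler_pM => //; rewrite exprn_ge0 ?subr_ge0// mulr_ge0.
by move: e5; rewrite exprMn !expr2; lra.
Qed.

(** Half of the exponent pays for the factor [k.+1 * (1 - w)] by [mul_pow_le1]; the other half is
    kept for the decay in [k]. *)
Lemma mid_pow_le (R : realType) (k : nat) (w : R) : 0 <= w <= 1 ->
  k.+1%:R * ((1 - w) * w ^+ k) <= 2 * w ^+ (k - k %/ 2)%N.
Proof.
move=> w01; have w1 : 0 <= 1 - w <= 1 by move: w01 => /andP[? ?]; apply/andP; split; lra.
have := mul_pow_le1 (k %/ 2) w1; rewrite subKr => h.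
have kk : (k = k %/ 2 + (k - k %/ 2))%N by lia.
rewrite {2}kk exprD; have /andP[w0 _] := w01.
have h0 : 0 <= w ^+ (k - k %/ 2) by rewrite exprn_ge0.
have h1 : 0 <= (1 - w) * w ^+ (k %/ 2) by rewrite mulr_ge0 ?exprn_ge0//; have /andP[] := w1.
have h2 : k.+1%:R <= 2 * (k %/ 2).+1%:R :> R by rewrite -natrM ler_nat; lia.
have h3 : k.+1%:R * ((1 - w) * w ^+ (k %/ 2)) <= 2.
  by apply: (le_trans (ler_wpM2r h1 h2)); lra.
by rewrite (mulrA (1 - w)) mulrA ler_wpM2r.
Qed.

Lemma powRN_half (R : realType) (k h : nat) (a : R) : (k.+1 <= 2 * h.+1)%N -> 0 < a <= 1 ->
  h.+1%:R `^ (- a) <= 2 * k.+1%:R `^ (- a).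
Proof.
move=> kh /andP[a0 a1].
rewrite !powRN ler_pdivlMr ?powR_gt0// mulrC ler_pdivrMr ?powR_gt0//.
apply: (@le_trans _ _ ((2 * h.+1)%:R `^ a)).
  by apply: ge0_ler_powR; rewrite ?nnegrE ?(ltW a0)// ler_nat.
rewrite natrM powRM// ler_wpM2r ?powR_ge0//.
by rewrite -[leRHS]powRr1//; apply: ler_powR => //; rewrite ler1n.
Qed.

(** In the induction [(n / (n + 1))^(1 - a)] is at most the square root of [n / (n + 1)], as
    [a <= 1/2], hence at most [1 - 1 / (2 * (n + 1))]. For [a = 1/d] the hypothesis reads
    [d >= 2]. *)
Lemma sum_powRN_le (R : realType) (n : nat) (a : R) : 0 < a <= 2^-1 ->
  \sum_(k < n) k.+1%:R `^ (- a) <= 2 * n%:R `^ (1 - a).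
Proof.
move=> /andP[a0 a1]; elim: n => [|n ih]; first by rewrite big_ord0 mulr_ge0 ?powR_ge0.
rewrite big_ord_recr/=; apply: (le_trans (lerD ih (lexx _))).
have n1 : 0 < (n.+1%:R : R) by [].
have pD (x : R) : 0 < x -> x `^ (1 - a) = x * x `^ (- a).
  by move=> x0; rewrite powRD ?(lt0r_neq0 x0) ?implybT// powRr1 ?(ltW x0).
rewrite (pD _ n1).
have [->|n0] := eqVneq n 0%N.
  have a1' : 0 < 1 - a by lra.
  by rewrite [_ `^ (1 - a)]powR0 ?(gt_eqF a1')// powR1; lra.
have n0' : 0 < (n%:R : R) by rewrite ltr0n lt0n.
pose x : R := n%:R / n.+1%:R.
have x01 : 0 < x <= 1 by rewrite divr_gt0//= ler_pdivrMr// mul1r ler_nat.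
have -> : (n%:R : R) `^ (1 - a) = x `^ (1 - a) * (n.+1%:R * n.+1%:R `^ (- a)).
  have -> : (n%:R : R) = x * n.+1%:R by rewrite divfK// gt_eqF.
  rewrite powRM// ?(ltW (proj1 (andP x01)))//; congr (_ * _).
  exact: pD.
have hx : x `^ (1 - a) <= 1 - 1 / (2 * n.+1%:R).
  apply: (@le_trans _ _ (x `^ (2^-1))).
    rewrite /powR gt_eqF ?(proj1 (andP x01))// ler_expR.
    have : ln x <= 0 by apply: ln_le0; case/andP: x01.
    by nra.
  have h0 : 0 <= 1 - 1 / (2 * n.+1%:R) :> R.
    rewrite subr_ge0 ler_pdivrMr ?mulr_gt0// mul1r -natrM ler1n; lia.
  rewrite -(@ler_pXn2r _ 2)// ?nnegrE ?powR_ge0// -powR_mulrn ?powR_ge0// -powRrM.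
  rewrite mulVf// powRr1 ?(ltW (proj1 (andP x01)))//.
  have -> : x = 1 - n.+1%:R^-1 by rewrite /x -[n.+1]addn1 natrD; field; rewrite ?natr1 ?nat1r ?pnatr_eq0.
  set y : R := n.+1%:R^-1; rewrite (_ : 1 / _ = y / 2); last by rewrite /y; field; rewrite ?natr1 ?nat1r ?pnatr_eq0.
  have := sqr_ge0 y; rewrite !expr2; lra.
have p0 : 0 < (n.+1%:R : R) `^ (- a) by rewrite powR_gt0.
set p := _ `^ (- a) in p0 *.
have : x `^ (1 - a) * (n.+1%:R * p) <= (1 - 1 / (2 * n.+1%:R)) * (n.+1%:R * p).
  by rewrite ler_wpM2r// mulr_ge0// ltW.
have -> : (1 - 1 / (2 * n.+1%:R)) * (n.+1%:R * p) = n.+1%:R * p - p / 2.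
  by field; rewrite ?natr1 ?nat1r ?pnatr_eq0.
lra.
Qed.

(** * Abstract dominance order and integration of the earlier points *)

Section Records.
Context d (E : measurableType d) (R : realType).
Notation Om := (seqspace E).
Variable Q : probability Om R.
Variable mu : set E -> \bar R.
Hypothesis Qind : forall (s : seq nat) (A : nat -> set E), uniq s ->
  (forall i, measurable (A i)) ->
  Q [set z | forall i, i \in s -> A i (z i)] = (\prod_(i <- s) mu (A i))%E.
(* [v x] is the probability that a fresh point dominates [x]; in the simplex it is the
   [d]-th power of the slack [1 - \sum_j x_j]. *)
Variables (e0 : E) (dd : nat) (inS : E -> bool) (prec : E -> E -> bool) (v : E -> R).
Hypothesis dd2 : (2 <= dd)%N.
Hypothesis mprec : forall d' (T : measurableType d') (f g : T -> E),
  measurable_fun setT f -> measurable_fun setT g -> measurable [set t | prec (f t) (g t)].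
Hypothesis minS : measurable [set x | inS x].
Hypothesis mv : measurable_fun setT v.
Hypothesis v01 : forall x, inS x -> 0 <= v x <= 1.
Hypothesis precS : forall x y, prec x y -> inS x && inS y.
Hypothesis e0S : ~~ inS e0.

Notation Ex := (expct Q).
Notation Df := (dropdiff e0).
Hypothesis Ex_inS : forall k, Ex (fun z => (inS (z k))%:R) = 1.
Hypothesis Ex_prec_up : forall k x, inS x -> Ex (fun z => (prec x (z k))%:R) = v x.
Hypothesis Ex_prec_down : forall k y t, 0 < t ->
  Ex (fun z => (prec (z k) y && (v (z k) <= t))%:R) <= t.
Hypothesis Ex_low_ub : forall k u, 0 <= u ->
  Ex (fun z => (inS (z k) && (v (z k) <= u ^+ dd))%:R) <= dd%:R * u.
Hypothesis Ex_low_lb : forall k u, 0 <= u <= 1 ->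
  u <= Ex (fun z => (inS (z k) && (v (z k) <= u ^+ dd))%:R).

Implicit Types F G : Om -> R.
Notation alpha := ((dd%:R : R)^-1).

(** The probability that a fresh point fails to dominate [x]. The value 0 off the simplex, where [v]
    is unconstrained, keeps it between 0 and 1. *)
Definition escape (x : E) : R := if inS x then 1 - v x else 0.

Lemma escape01 x : 0 <= escape x <= 1.
Proof. by rewrite /escape; case: ifP => [/v01|_]; rewrite ?lexx ?ler01//; lra. Qed.

Let mc i : measurable_fun setT (fun z : Om => z i) := @measurable_seqspace_coord _ E i.

Lemma bmeas_prec i j : bmeas (fun z : Om => (prec (z i) (z j))%:R : R).
Proof. by apply: bmeas_pred; exact: mprec. Qed.

Lemma bmeas_nprec i j : bmeas (fun z : Om => (~~ prec (z i) (z j))%:R : R).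
Proof.
apply: bmeas_pred; rewrite (_ : [set _ | _] = ~` [set z | prec (z i) (z j)]).
  by apply: measurableC; exact: mprec.
by apply/seteqP; split => z /= /negP.
Qed.

Lemma bmeas_coordb (b : E -> bool) k : measurable [set x | b x] -> bmeas (fun z : Om => (b (z k))%:R : R).
Proof.
move=> mb; apply: bmeas_pred; rewrite -[X in measurable X]setTI.
exact: (mc k measurableT mb).
Qed.

Lemma bmeas_inS k : bmeas (fun z : Om => (inS (z k))%:R : R).
Proof. exact: bmeas_coordb. Qed.

Lemma measurable_vle t : measurable [set x | v x <= t].
Proof.
rewrite -[X in measurable X]setTI.
rewrite (_ : [set x | _] = v @^-1` `]-oo, t]); first exact: mv.
by apply/seteqP; split => x /=; rewrite in_itv.
Qed.

Lemma measurable_setb_and (b c : E -> bool) : measurable [set x | b x] -> measurable [set x | c x] ->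
  measurable [set x | b x && c x].
Proof.
move=> mb mc'; rewrite (_ : [set _ | _] = [set x | b x] `&` [set x | c x]).
  exact: measurableI.
by apply/seteqP; split => x /= /andP.
Qed.

Lemma bmeas_escape k : bmeas (fun z : Om => escape (z k)).
Proof.
split; last by exists 1 => z; have /andP[? ?] := escape01 (z k); rewrite ger0_norm.
apply: (measurableT_comp (f := escape)) => //; rewrite /escape.
apply: measurable_fun_ifT => //=; last exact: measurable_funB.
by apply: (measurable_fun_bool true); rewrite setTI.
Qed.

(** Dyadic layers: [(1 - u)^m] decays at least quadratically in [(m + 1) * u], so the layer
    [v <= 2^j / (m + 1)] enters with weight [16 * 4^(-j)], while the bound on its probability grows
    like [2^(j * a) <= 2^j]. The resulting weights [16 * 2^(-j)] add up to at most 32. *)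
Lemma Ex_escape_tail (b : E -> bool) (k m : nat) (c a : R) : measurable [set x | b x] ->
  0 <= c -> 0 < a <= 1 -> (forall x, b x -> inS x) ->
  (forall t, 0 < t -> Ex (fun z => (b (z k) && (v (z k) <= t))%:R) <= c * t `^ a) ->
  Ex (fun z => (b (z k))%:R * escape (z k) ^+ m) <= 32 * c * m.+1%:R `^ (- a).
Proof.
move=> mb c0 /andP[a0 a1] bS h.
have m0 : 0 < (m.+1%:R : R) by [].
pose s j : R := 2 ^+ j / m.+1%:R.
have s0 j : 0 < s j by rewrite divr_gt0// exprn_gt0.
have point (u : R) J : 0 <= u <= 1 -> u <= s J ->
    (1 - u) ^+ m <= \sum_(j < J.+1) 16 * 4^-1 ^+ j * (u <= s j)%R%:R.
  move=> /andP[u0 u1]; elim: J => [|J ih] uJ.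
    rewrite big_ord1 uJ mulr1 expr0 mulr1.
    by apply: (@le_trans _ _ 1); [rewrite exprn_ile1//; lra|lra].
  rewrite big_ord_recr/= uJ mulr1.
  have [uJ'|uJ'] := leP u (s J).
    by rewrite ler_wpDr ?ih// mulr_ge0// exprn_ge0// invr_ge0.
  rewrite ler_wpDl//; first by apply: sumr_ge0 => j _; rewrite !mulr_ge0 ?exprn_ge0 ?invr_ge0.
  have u0' : 0 < u := lt_trans (s0 J) uJ'.
  apply: (le_trans (pow_le_inv_sqr m _)); first by rewrite u0'.
  rewrite ler_pdivrMr ?exprn_gt0 ?mulr_gt0//.
  have h2 : 2 ^+ J <= m.+1%:R * u by move: uJ'; rewrite /s ltr_pdivrMr// mulrC => /ltW.
  have h3 : 4 ^+ J <= (m.+1%:R * u) ^+ 2.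
    have -> : (4 : R) ^+ J = (2 ^+ J) ^+ 2 by rewrite -exprM mulnC exprM; congr (_ ^+ _); ring.
    by rewrite ler_pXn2r ?nnegrE ?exprn_ge0 ?mulr_ge0.
  have h4 : 4^-1 ^+ J * (4 : R) ^+ J = 1 by rewrite -exprMn mulVf ?expr1n.
  have h5 : 0 <= (4^-1 : R) ^+ J by rewrite exprn_ge0// invr_ge0.
  have : 4^-1 ^+ J * (4 : R) ^+ J <= 4^-1 ^+ J * (m.+1%:R * u) ^+ 2 by rewrite ler_wpM2l.
  by rewrite h4 [_ ^+ J.+1]exprS; move: ((4^-1 : R) ^+ J) ((m.+1%:R * u) ^+ 2) => X Y; lra.
have sm : 1 <= s m.+1.
  rewrite ler_pdivlMr// mul1r -natrX ler_nat; apply: ltnW; exact: ltn_expl.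
have bmj j : bmeas (fun z : Om => (b (z k) && (v (z k) <= s j))%:R : R).
  by apply: (@bmeas_coordb (fun x => b x && (v x <= s j))); apply: measurable_setb_and => //; exact: measurable_vle.
apply: (@le_trans _ _ (Ex (fun z => \sum_(j < m.+2) 16 * 4^-1 ^+ j * (b (z k) && (v (z k) <= s j))%:R))).
  apply: Ex_le.
  - by apply: bmeasM; [exact: bmeas_coordb|apply: bmeasX; exact: bmeas_escape].
  - by bmt.
  - move=> z; case: (boolP (b (z k))) => [bz|_] /=; last first.
      by rewrite mul0r; apply: sumr_ge0 => j _; rewrite mulr0.
    rewrite mul1r /escape bS//; apply: point; first by apply: v01; exact: bS.
    by apply: (le_trans _ sm); have /andP[] := v01 (bS _ bz).
rewrite Ex_sum; last by move=> j _; bmt.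
apply: (@le_trans _ _ (\sum_(j < m.+2) 16 * 2^-1 ^+ j * (c * m.+1%:R `^ (- a)))).
  apply: ler_sum => j _; rewrite ExZ//.
  have p0 : 0 <= (m.+1%:R : R) `^ (- a) by exact: powR_ge0.
  have hj : s j `^ a <= 2 ^+ j * m.+1%:R `^ (- a).
    rewrite /s powRM ?exprn_ge0 ?invr_ge0// -powR_inv1// -powRrM mulN1r.
    rewrite ler_wpM2r//.
    rewrite -[leRHS]powRr1 ?exprn_ge0//; apply: ler_powR => //.
    by rewrite exprn_ege1//; lra.
  apply: (@le_trans _ _ (16 * 4^-1 ^+ j * (c * (2 ^+ j * m.+1%:R `^ (- a))))).
    have q0 : 0 <= 16 * 4^-1 ^+ j :> R by rewrite mulr_ge0// exprn_ge0// invr_ge0.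
    by rewrite ler_wpM2l//; apply: (le_trans (h _ (s0 j))); rewrite ler_wpM2l.
  apply: eq_ler.
  have -> : 2^-1 ^+ j = 4^-1 ^+ j * 2 ^+ j :> R.
    by rewrite -exprMn; congr (_ ^+ _); field.
  by ring.
rewrite -mulr_suml.
have hs : \sum_(j < m.+2) 16 * 2^-1 ^+ j <= 32 :> R.
  rewrite -mulr_sumr.
  have := subrXX (1 : R) 2^-1 m.+2; rewrite expr1n.
  under eq_bigr do rewrite expr1n mul1r.
  have : 0 <= (2^-1 : R) ^+ m.+2 by rewrite exprn_ge0// invr_ge0.
  by set X := _ ^+ _; set Y := \sum_(_ < _) _; lra.
by rewrite -mulrA ler_wpM2r// mulr_ge0// powR_ge0.
Qed.

Lemma powR_alphaK t : 0 <= t -> (t `^ alpha) ^+ dd = t.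
Proof.
move=> t0; rewrite -powR_mulrn ?powR_ge0// -powRrM mulVf ?powRr1//.
by rewrite pnatr_eq0; lia.
Qed.

Lemma alpha01 : 0 < alpha <= 1.
Proof.
have d0 : (0 < dd)%N by lia.
by rewrite invr_gt0 invf_le1 ltr0n// ler1n d0.
Qed.

Lemma Ex_low_le k t : 0 <= t ->
  Ex (fun z => (inS (z k) && (v (z k) <= t))%:R) <= dd%:R * t `^ alpha.
Proof. by move=> t0; have := Ex_low_ub k (powR_ge0 t alpha); rewrite powR_alphaK. Qed.

Lemma Ex_inS_escape k m :
  Ex (fun z => (inS (z k))%:R * escape (z k) ^+ m) <= 32 * dd%:R * m.+1%:R `^ (- alpha).
Proof.
apply: Ex_escape_tail => //; first exact: alpha01.
by move=> t t0; apply: Ex_low_le; exact: ltW.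
Qed.

Lemma measurable_prec1 y : measurable [set x | prec x y].
Proof. by apply: mprec => //; exact: measurable_cst. Qed.

(** Among the points below a fixed [y] the tail of [v] is linear instead of having exponent [alpha].
    The decay [1 / (m + 1)] sums harmonically and is the source of the logarithms in the third
    moments. *)
Lemma Ex_prec_escape k y m :
  Ex (fun z => (prec (z k) y)%:R * escape (z k) ^+ m) <= 32 / m.+1%:R.
Proof.
have h := @Ex_escape_tail (fun x => prec x y) k m 1 1 (measurable_prec1 y).
rewrite mulr1 powR_inv1// in h; apply: h => //.
- by rewrite ltr01 lexx.
- by move=> x /precS /andP[].
- by move=> t t0; rewrite mul1r powRr1 ?(ltW t0)//; exact: Ex_prec_down.
Qed.

Lemma update_same (z : Om) k y : update z k y k = y.
Proof. by rewrite /update eqxx. Qed.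

Lemma update_other (z : Om) k y j : j != k -> update z k y j = z j.
Proof. by rewrite /update => /negbTE ->. Qed.

Lemma nprecE x y : (~~ prec x y)%:R = 1 - (prec x y)%:R :> R.
Proof. by case: (prec x y); rewrite ?subrr ?subr0. Qed.

(** The points of [s] are integrated out one at a time; given point [k], each contributes a factor
    [escape], absorbed into [F] for the next step. So [F] may depend on point [k], but on no point
    of [s]. *)
Lemma Ex_prod_nprec_le (s : seq nat) k F : bmeas F -> (forall z, 0 <= F z) -> k \notin s -> uniq s ->
  (forall i, i \in s -> free_of i F) ->
  Ex (fun z => F z * (inS (z k))%:R * \prod_(i <- s) (~~ prec (z k) (z i))%:R) <=
  Ex (fun z => F z * (inS (z k))%:R * escape (z k) ^+ size s).
Proof.
elim: s F => [|i s ih] F bF F0 /=.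
  by move=> _ _ _; apply: eq_ler; congr (expct Q);
     apply/funext => z; rewrite big_nil expr0.
rewrite inE negb_or => /andP[ki ks] /andP[si us] nF.
have bS := bmeas_inS k; have bw := bmeas_escape k.
have bN j := bmeas_nprec k j.
apply: (@le_trans _ _ (Ex (fun z => (F z * \prod_(j <- s) (~~ prec (z k) (z j))%:R) *
    ((inS (z k))%:R * escape (z k))))); last first.
  have := ih (fun z => F z * escape (z k)).
  rewrite (_ : (fun z => F z * escape (z k) * _ * escape (z k) ^+ _) =
    (fun z => F z * (inS (z k))%:R * escape (z k) ^+ (size s).+1)); last first.
    by apply/funext => z; rewrite exprS; ring.
  move=> /(_ _ _ ks us) h; apply: le_trans (h _ _ _).
  - apply: eq_ler; congr (expct Q).
    by apply/funext => z; ring.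
  - by bmt.
  - by move=> z; rewrite mulr_ge0//; have /andP[] := escape01 (z k).
  - move=> j js z y; rewrite update_other; first by rewrite nF// inE js orbT.
    by apply: contraNneq ks => ->.
rewrite (_ : (fun z => _) = fun z => (F z * \prod_(j <- s) (~~ prec (z k) (z j))%:R) *
    ((inS (z k))%:R * (~~ prec (z k) (z i))%:R)); last first.
  by apply/funext => z; rewrite big_cons; ring.
apply: (Ex_coord_le (k := i) Qind); try by bmt.
- by move=> z; rewrite mulr_ge0// prodr_ge0.
- move=> z y; rewrite nF ?inE ?eqxx//; congr (_ * _).
  rewrite update_other//; apply: eq_big_seq => j js; rewrite update_other//.
  by apply: contraNneq si => <-.
- move=> z'; under eq_fun do rewrite update_other// update_same.
  case: (boolP (inS (z' k))) => h.
    rewrite /escape h mul1r.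
    under eq_fun do rewrite mul1r nprecE.
    rewrite ExB ?Ex_cst ?Ex_prec_up//; first exact: bmeas_cst.
    by apply: bmeas_coordb; apply: mprec => //; exact: measurable_cst.
  rewrite mul0r (_ : (fun z : Om => _) = fun=> 0) ?Ex_cst//.
  by apply/funext => z; rewrite mul0r.
Qed.

(** * Records, blocked points and third moments of deletion differences *)

Section Theta.
(* Records at time [k] are counted only if [theta k] holds; [theta] will be either
   membership in the simplex or the truncation [k.+1 * v x <= L]. *)
Variable theta : nat -> E -> bool.
Hypothesis thetaS : forall k x, theta k x -> inS x.
Hypothesis mtheta : forall k, measurable [set x | theta k x].

(** Indicators are written as real products, the form in which points are integrated out;
    [record_bool] and [blocked_bool] give the Boolean form for pointwise arguments. *)
Definition record k (z : Om) : R :=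
  (theta k (z k))%:R * \prod_(i <- iota 0 k) (~~ prec (z k) (z i))%:R.

Definition blocked i k (z : Om) : R := (i < k)%N%:R * (theta k (z k))%:R * (prec (z k) (z i))%:R *
  \prod_(j <- iota 0 k | j != i) (~~ prec (z k) (z j))%:R.

Definition nrecords n (z : Om) : R := \sum_(k < n) record k z.
Definition nblocked i n (z : Om) : R := \sum_(k < n) blocked i k z.

Lemma bmeas_theta k : bmeas (fun z : Om => (theta k (z k))%:R : R).
Proof. exact: bmeas_coordb. Qed.

Lemma bmeas_record k : bmeas (record k).
Proof. by apply: bmeasM; [exact: bmeas_theta|apply: bmeas_prod => i _; exact: bmeas_nprec]. Qed.

Lemma bmeas_blocked i k : bmeas (blocked i k).
Proof.
apply: bmeasM; last by apply: bmeas_prod => j _; exact: bmeas_nprec.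
by apply: bmeasM; [apply: bmeasM; [exact: bmeas_cst|exact: bmeas_theta]|exact: bmeas_prec].
Qed.

Lemma bmeas_nrecords n : bmeas (nrecords n).
Proof. by apply: bmeas_sum => k _; exact: bmeas_record. Qed.

Lemma bmeas_nblocked i n : bmeas (nblocked i n).
Proof. by apply: bmeas_sum => k _; exact: bmeas_blocked. Qed.

Lemma prod_bool (I : eqType) (s : seq I) (P : pred I) (b : I -> bool) :
  \prod_(i <- s | P i) (b i)%:R = (all (fun i => P i ==> b i) s)%:R :> R.
Proof.
elim: s => [|i s ih]; first by rewrite big_nil.
by rewrite big_cons /= ih; case: (P i); case: (b i); rewrite /= ?mul1r ?mul0r.
Qed.

Lemma record_bool k z : record k z = (theta k (z k) && all (fun i => ~~ prec (z k) (z i)) (iota 0 k))%:R.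
Proof. by rewrite /record prod_bool -natrM mulnb. Qed.

Lemma blocked_bool i k z : blocked i k z = [&& (i < k)%N, theta k (z k), prec (z k) (z i) &
  all (fun j => (j != i) ==> ~~ prec (z k) (z j)) (iota 0 k)]%:R.
Proof. by rewrite /blocked prod_bool -!natrM !mulnb -!andbA. Qed.

Lemma dep_record k : dep_below k.+1 (record k).
Proof.
move=> z z' h; rewrite /record h//; congr (_ * _); apply: eq_big_seq => i.
by rewrite mem_iota add0n => /andP[_ ik]; rewrite h// ltnW.
Qed.

Lemma dep_blocked i k : dep_below k.+1 (blocked i k).
Proof.
move=> z z' h; rewrite /blocked; case: (ltnP i k) => ik; last by rewrite !mul0r.
rewrite !h ?ltnS ?(ltnW ik)//; congr (_ * _).
rewrite big_seq_cond [RHS]big_seq_cond; apply: eq_bigr => j.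
by rewrite mem_iota add0n => /andP[/andP[_ jk] _]; rewrite h// ltnW.
Qed.

Lemma dep_le n m F : (n <= m)%N -> dep_below n F -> dep_below m F.
Proof. by move=> nm dF z z' h; apply: dF => i /leq_trans-/(_ _ nm); exact: h. Qed.

Lemma dep_nrecords n : dep_below n (nrecords n).
Proof.
move=> z z' h; apply: eq_bigr => -[k /= kn] _.
by apply: (dep_le kn (@dep_record k)).
Qed.

Lemma prec_e0r y : prec y e0 = false.
Proof. by apply/negP => /precS; rewrite (negbTE e0S) andbF. Qed.

Lemma Df_record i k z : Df i (record k) z = (i == k)%:R * record k z - blocked i k z.
Proof.
rewrite /dropdiff; case: (ltngtP i k) => [ik|ki|<-].
- rewrite mul0r /record /blocked ik mul1r update_other ?gtn_eqF//.
  have im : i \in iota 0 k by rewrite mem_iota.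
  rewrite (bigD1_seq i) ?iota_uniq//= [X in _ - _ * X](bigD1_seq i) ?iota_uniq//=.
  rewrite update_same prec_e0r mul1r.
  have -> : \prod_(j <- iota 0 k | j != i) (~~ prec (z k) (update z i e0 j))%:R =
      \prod_(j <- iota 0 k | j != i) (~~ prec (z k) (z j))%:R :> R.
    by apply: eq_bigr => j ji; rewrite update_other.
  by rewrite nprecE; ring.
- rewrite mul0r sub0r /blocked ltnNge ltnW// !mul0r oppr0.
  by rewrite (dep_record (z := update z i e0) (z' := z)) ?subrr// => j jk; rewrite update_other//; lia.
- rewrite mul1r /blocked ltnn !mul0r subr0 [X in _ - X](_ : _ = 0) ?subr0//.
  rewrite /record update_same (_ : theta i e0 = false) ?mul0r//.
  by apply/negP => /thetaS; rewrite (negbTE e0S).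
Qed.

Lemma Df_nrecords i n z : (i < n)%N -> Df i (nrecords n) z = record i z - nblocked i n z.
Proof.
move=> iN; rewrite /dropdiff /nrecords /nblocked -!sumrB.
under eq_bigr do rewrite -/(Df i (record _) z) Df_record.
rewrite sumrB; congr (_ - _).
rewrite (bigD1 (Ordinal iN))//= eqxx mul1r big1 ?addr0// => k ki.
by rewrite (_ : (i == k :> nat) = false) ?mul0r//; apply/eqP => h; case/eqP: ki; apply/val_inj.
Qed.

Lemma Ex_record k : Ex (record k) <= 32 * dd%:R * k.+1%:R `^ (- alpha).
Proof.
apply: le_trans (Ex_inS_escape k k).
have bS := bmeas_inS k; have bw := bmeas_escape k; have bN j := bmeas_nprec k j.
apply: (@le_trans _ _ (Ex (fun z => 1 * (inS (z k))%:R * \prod_(i <- iota 0 k) (~~ prec (z k) (z i))%:R))).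
  apply: Ex_le; [exact: bmeas_record|by bmt|move=> z].
  rewrite /record mul1r ler_wpM2r ?prodr_ge0//.
  by case: (boolP (theta k (z k))) => // /thetaS ->.
apply: (le_trans (Ex_prod_nprec_le _ _ _ _ _)) => //.
- exact: bmeas_cst.
- by rewrite mem_iota; lia.
- exact: iota_uniq.
- rewrite size_iota; apply: eq_ler; congr (expct Q).
  by apply/funext => z; rewrite mul1r.
Qed.

Lemma blocked_le i k z : (i < k)%N -> blocked i k z <= (prec (z k) (z i))%:R * (inS (z k))%:R *
   \prod_(j <- [seq j <- iota 0 k | j != i]) (~~ prec (z k) (z j))%:R.
Proof.
move=> ik; rewrite /blocked ik mul1r big_filter (mulrC (prec _ _)%:R) -mulrA -[leRHS]mulrA.
apply: ler_wpM2r; first by rewrite mulr_ge0// prodr_ge0.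
by case: (boolP (theta k (z k))) => // /thetaS ->.
Qed.

Lemma size_iota_neq i k : (i < k)%N -> size [seq j <- iota 0 k | j != i] = k.-1.
Proof. by move=> ik; rewrite -rem_filter ?iota_uniq// size_rem ?size_iota// mem_iota. Qed.

Lemma Ex_prec_out F i k : i != k -> bmeas F -> (forall z, 0 <= F z) -> free_of i F ->
  Ex (fun z => F z * (prec (z k) (z i))%:R) <= Ex (fun z => F z * (1 - escape (z k))).
Proof.
move=> ik bF F0 nF.
apply: (Ex_coord_le (k := i) Qind) => //.
- exact: bmeas_prec.
- by apply: bmeasB; [exact: bmeas_cst|exact: bmeas_escape].
- move=> z'; under eq_fun do rewrite update_other 1?eq_sym// update_same.
  case: (boolP (inS (z' k))) => h; first by rewrite Ex_prec_up// /escape h subKr.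
  rewrite /escape (negbTE h) subr0 (_ : (fun z : Om => _) = fun=> 0) ?Ex_cst//.
  apply/funext => z; case: (boolP (prec _ _)) => // /precS.
  by rewrite (negbTE h).
Qed.

Lemma Ex_blocked i k : (i < k)%N -> Ex (blocked i k) <=
  Ex (fun z => (inS (z k))%:R * ((1 - escape (z k)) * escape (z k) ^+ k.-1)).
Proof.
move=> ik; have bS := bmeas_inS k; have bw := bmeas_escape k; have bN j := bmeas_nprec k j; have bP := bmeas_prec k i.
have ki : i != k by rewrite ltn_eqF.
apply: (@le_trans _ _ (Ex (fun z => ((inS (z k))%:R * escape (z k) ^+ k.-1) * (prec (z k) (z i))%:R))).
  apply: (@le_trans _ _ (Ex (fun z => (prec (z k) (z i))%:R * (inS (z k))%:R *
     \prod_(j <- [seq j <- iota 0 k | j != i]) (~~ prec (z k) (z j))%:R))).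
    by apply: Ex_le; [exact: bmeas_blocked|by bmt|move=> z; exact: blocked_le].
  apply: (le_trans (Ex_prod_nprec_le _ _ _ _ _)) => //.
  - by rewrite mem_filter mem_iota add0n ltnn !andbF.
  - by rewrite filter_uniq// iota_uniq.
  - move=> j; rewrite mem_filter mem_iota add0n => /andP[ji jk] z y.
    by rewrite !update_other//; [rewrite eq_sym|rewrite gtn_eqF].
  - rewrite size_iota_neq//; apply: eq_ler; congr (expct Q).
    by apply/funext => z; ring.
apply: (le_trans (Ex_prec_out ki _ _ _)).
- by bmt.
- by move=> z; rewrite mulr_ge0// exprn_ge0//; have /andP[] := escape01 (z k).
- by move=> z y; rewrite update_other// eq_sym.
- apply: eq_ler; congr (expct Q).
  by apply/funext => z; ring.
Qed.

(** There are [k] candidates for the single dominator, and [mid_pow_le] bounds their total weight by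
    twice a power of [escape] with about half the exponent. Up to a constant, being blocked is then
    no likelier than the bound for being a record. *)
Lemma Ex_blocked_sum k : \sum_(i < k) Ex (blocked i k) <= 128 * dd%:R * k.+1%:R `^ (- alpha).
Proof.
case: k => [|k]; first by rewrite big_ord0 !mulr_ge0// powR_ge0.
have bS := bmeas_inS k.+1; have bw := bmeas_escape k.+1.
apply: (@le_trans _ _ (\sum_(i < k.+1) Ex (fun z => (inS (z k.+1))%:R * ((1 - escape (z k.+1)) * escape (z k.+1) ^+ k)))).
  by apply: ler_sum => -[i /= ik] _; exact: Ex_blocked.
rewrite sumr_const card_ord -[leLHS]mulr_natl -ExZ; last by bmt.
apply: (@le_trans _ _ (Ex (fun z => 2 * ((inS (z k.+1))%:R * escape (z k.+1) ^+ (k - k %/ 2)%N)))).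
  apply: Ex_le; [by bmt|by bmt|move=> z].
  rewrite mulrCA [leRHS]mulrCA ler_wpM2l//; apply: mid_pow_le; exact: escape01.
rewrite ExZ; last by bmt.
have := Ex_inS_escape k.+1 (k - k %/ 2)%N; rewrite -(ler_pM2l (ltr0n R 2)) => /le_trans; apply.
have := @powRN_half R k.+1 (k - k %/ 2)%N alpha _ alpha01.
have -> : (k.+2 <= 2 * (k - k %/ 2).+1)%N by lia.
move=> /(_ isT); set p := _ `^ _; set q := _ `^ _ => pq.
have d0 : 0 <= dd%:R :> R by [].
have : dd%:R * p <= dd%:R * (2 * q) by rewrite ler_wpM2l.
lra.
Qed.

(** Given the points up to [l], point [m] must lie below point [i] and escape the points strictly
    between [l] and [m]; [Ex_prec_escape] turns this into the reciprocal of [m - l]. *)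
Lemma blocked_step i l m F : (i <= l < m)%N -> bmeas F -> (forall z, 0 <= F z) -> dep_below l.+1 F ->
  Ex (fun z => F z * blocked i m z) <= 32 / (m - l)%:R * Ex F.
Proof.
move=> /andP[il lm] bF F0 dF.
have im : (i < m)%N := leq_ltn_trans il lm.
have bS := bmeas_inS m; have bw := bmeas_escape m; have bN j := bmeas_nprec m j; have bP := bmeas_prec m i.
pose s := iota l.+1 (m - l.+1).
apply: (@le_trans _ _ (Ex (fun z => (F z * (prec (z m) (z i))%:R) * (inS (z m))%:R *
     \prod_(j <- s) (~~ prec (z m) (z j))%:R))).
  apply: Ex_le; [by apply: bmeasM => //; exact: bmeas_blocked|by bmt|move=> z].
  rewrite -!mulrA ler_wpM2l// blocked_bool im/= prod_bool -natrM mulnb -natrM mulnb ler_nat.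
  case: (boolP (theta m (z m))) => //= /thetaS ->/=.
  case: (prec (z m) (z i)) => //=; set a := all _ _; set b := all _ _.
  suff ab : a -> b by case: a ab => // ->.
  move=> /allP h; apply/allP => j js.
  apply: (implyP (h j _)); move: js; rewrite !mem_iota => js; lia.
apply: (le_trans (Ex_prod_nprec_le _ _ _ _ _)); try by bmt.
- by move=> z; rewrite mulr_ge0.
- by rewrite mem_iota; lia.
- exact: iota_uniq.
- move=> j; rewrite mem_iota => js z y.
  rewrite !update_other; [|lia|lia].
  by congr (_ * _); apply: (dep_free dF); lia.
rewrite size_iota.
have -> : (m - l)%N = (m - l.+1).+1 by lia.
apply: (@le_trans _ _ (Ex (fun z => F z * ((prec (z m) (z i))%:R * escape (z m) ^+ (m - l.+1))))).
  apply: Ex_le; [by bmt|by bmt|move=> z].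
  rewrite -!mulrA ler_wpM2l// ler_wpM2l// ler_piMl ?exprn_ge0//; first by have /andP[] := escape01 (z m).
  by case: (inS _).
apply: (Ex_coord_le_cst (k := m) Qind) => //; first by bmt.
  by apply: (dep_free dF).
move=> z'; under eq_fun do rewrite update_same update_other ?ltn_eqF//.
exact: Ex_prec_escape.
Qed.

(** After a success at [l], a success at [m] has conditional probability at most [beta (m - l)],
    whatever happened before [l]. The cube is expanded along the last success into the terms
    [J l * (3 * K l^2 + 3 * K l + 1)], and each power of [K] costs a factor of order [B]. *)
Lemma Ex_sum_cube_le (J : nat -> Om -> R) (beta : nat -> R) (B : R) n :
  (forall k, bmeas (J k)) -> (forall k z, J k z = 0 \/ J k z = 1) -> (forall k, dep_below k.+1 (J k)) ->
  (forall l m F, (l < m < n)%N -> bmeas F -> (forall z, 0 <= F z) -> dep_below l F ->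
     Ex (fun z => F z * J l z * J m z) <= beta (m - l)%N * Ex (fun z => F z * J l z)) ->
  1 <= B -> (forall l, (l < n)%N -> \sum_(m < n | (l < m)%N) beta (m - l)%N <= B) ->
  Ex (fun z => (\sum_(k < n) J k z) ^+ 3) <= 13 * B ^+ 2 * Ex (fun z => \sum_(k < n) J k z).
Proof.
move=> bJ J01 dJ step B1 hB.
pose K m z := \sum_(k < m) J k z.
have bK m : bmeas (K m) by apply: bmeas_sum => k _; exact: bJ.
have J0 k z : 0 <= J k z by case: (J01 k z) => ->.
have JJ k z : J k z * J k z = J k z by case: (J01 k z) => ->; ring.
have K0 m z : 0 <= K m z by apply: sumr_ge0.
have KS m z : K m.+1 z = K m z + J m z by rewrite /K big_ord_recr.
have dK m : dep_below m (K m).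
  by move=> z z' h; apply: eq_bigr => -[k /= km] _; apply: (dep_le km (@dJ k)).
have S1 (F : nat -> Om -> R) : (forall l, bmeas (F l)) -> (forall l z, 0 <= F l z) ->
    (forall l, dep_below l (F l)) ->
    \sum_(m < n) Ex (fun z => J m z * \sum_(l < m) F l z * J l z) <=
    B * Ex (fun z => \sum_(l < n) F l z * J l z).
  move=> bF F0 dF.
  rewrite Ex_sum; last by move=> l _; apply: bmeasM.
  have a0 l : 0 <= Ex (fun z => F l z * J l z) by apply: Ex_ge0 => z; rewrite mulr_ge0.
  apply: (@le_trans _ _ (\sum_(m < n) \sum_(l < n | (l < m)%N) beta (m - l)%N * Ex (fun z => F l z * J l z))).
    apply: ler_sum => -[m /= mn] _.
    have -> : (fun z => J m z * \sum_(l < m) F l z * J l z) = (fun z => \sum_(l < m) F l z * J l z * J m z).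
      by apply/funext => z; rewrite mulrC mulr_suml.
    rewrite Ex_sum; last by move=> l _; apply: bmeasM => //; apply: bmeasM.
    rewrite -(big_mkord xpredT (fun l => Ex (fun z => F l z * J l z * J m z))).
    rewrite (big_nat_widen 0 m n)// ?(ltnW mn)// big_mkord; apply: ler_sum => -[l /= ln] lm.
    by apply: step => //; rewrite lm.
  rewrite (exchange_big_dep xpredT)//=.
  rewrite (eq_bigr (fun l : 'I_n => (\sum_(m < n | (l < m)%N) beta (m - l)%N) * Ex (fun z => F l z * J l z))); last first.
    by move=> l _; rewrite mulr_suml.
  rewrite mulr_sumr; apply: ler_sum => -[l /= ln] _; rewrite ler_wpM2r//; exact: hB.
have sq m z : K m z ^+ 2 = \sum_(l < m) (2 * K l z + 1) * J l z.
  elim: m => [|m ih]; first by rewrite /K !big_ord0 expr0n.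
  by rewrite big_ord_recr/= -ih KS; have := JJ m z; rewrite !expr2; nra.
have cu m z : K m z ^+ 3 = \sum_(l < m) J l z * (3 * K l z ^+ 2 + 3 * K l z + 1).
  elim: m => [|m ih]; first by rewrite /K !big_ord0 expr0n.
  rewrite big_ord_recr/= -ih KS; case: (J01 m z) => ->; ring.
set a := Ex (K n).
have aE : a = \sum_(l < n) Ex (J l) by rewrite /a /K (Ex_sum Q).
have e1 : \sum_(m < n) Ex (fun z => J m z * K m z) <= B * a.
  have := S1 (fun _ _ => 1) (fun=> bmeas_cst _ _) (fun _ _ => ler01) (fun _ _ _ _ => erefl).
  have -> : (fun z => \sum_(l < n) 1 * J l z) = K n.
    by apply/funext => z; apply: eq_bigr => l _; rewrite mul1r.
  apply: le_trans; apply: eq_ler; apply: eq_bigr => m _; congr (expct Q).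
  by apply/funext => z; congr (_ * _); apply: eq_bigr => l _; rewrite mul1r.
have a0 : 0 <= a by apply: Ex_ge0 => z.
have bF2 l : bmeas (fun z => 2 * K l z + 1) by apply: bmeasD; [apply: bmeasM => //; exact: bmeas_cst|exact: bmeas_cst].
have e2 : \sum_(m < n) Ex (fun z => J m z * K m z ^+ 2) <= B * (2 * (B * a) + a).
  have := S1 (fun l z => 2 * K l z + 1) bF2.
  have F0 l z : 0 <= 2 * K l z + 1 by have := K0 l z; lra.
  have dF l : dep_below l (fun z => 2 * K l z + 1) by move=> z z' /dK ->.
  move=> /(_ F0 dF) h.
  have -> : \sum_(m < n) Ex (fun z => J m z * K m z ^+ 2) =
     \sum_(m < n) Ex (fun z => J m z * \sum_(l < m) (2 * K l z + 1) * J l z).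
    by apply: eq_bigr => m _; congr (expct Q); apply/funext => z; rewrite sq.
  apply: (le_trans h); rewrite ler_wpM2l//; first lra.
  rewrite Ex_sum; last by move=> l _; apply: bmeasM.
  have -> : \sum_(l < n) Ex (fun z => (2 * K l z + 1) * J l z) =
      \sum_(l < n) (2 * Ex (fun z => J l z * K l z) + Ex (J l)).
    apply: eq_bigr => l _; rewrite -ExZ -?ExD; try by bmt; try (by apply: bmeasM => //; bmt).
    by congr (expct Q); apply/funext => z; ring.
  rewrite big_split/= -mulr_sumr; apply: lerD; first by rewrite ler_wpM2l.
  by rewrite -aE.
rewrite -/(K n).
have -> : Ex (fun z => (\sum_(k < n) J k z) ^+ 3) =
   \sum_(m < n) (3 * Ex (fun z => J m z * K m z ^+ 2) + (3 * Ex (fun z => J m z * K m z) + Ex (J m))).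
  rewrite (_ : (fun z => _) = fun z => \sum_(m < n) J m z * (3 * K m z ^+ 2 + 3 * K m z + 1)); last first.
    by apply/funext => z; rewrite -cu.
  have b1 m : bmeas (fun z => J m z * K m z) by apply: bmeasM.
  have b2 m : bmeas (fun z => J m z * K m z ^+ 2) by apply: bmeasM => //; apply: bmeasX.
  rewrite Ex_sum; last by move=> m _; apply: bmeasM => //; bmt; exact: bK.
  apply: eq_bigr => m _; rewrite -!ExZ// -!ExD//; try by bmt.
  by congr (expct Q); apply/funext => z; ring.
rewrite !big_split/= -!mulr_sumr -aE.
(* The terms add up to [3 * (2 * B^2 + B) + 3 * B + 1] times [a], hence the constant 13. *)
have B2 : B <= B ^+ 2 by rewrite expr2; nra.
have : B * (2 * (B * a) + a) = 2 * (B ^+ 2 * a) + B * a by ring.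
have : B * a <= B ^+ 2 * a by rewrite ler_wpM2r.
have : a <= B * a by rewrite ler_peMl.
move: e1 e2; set x := \sum_(_ < _) _; set y := \sum_(_ < _) _; lra.
Qed.

Lemma Ex_nblocked_cube (B : R) i n : 1 <= B ->
  (forall l, (l < n)%N -> \sum_(m < n | (l < m)%N) 32 / (m - l)%:R <= B) ->
  Ex (fun z => nblocked i n z ^+ 3) <= 13 * B ^+ 2 * Ex (nblocked i n).
Proof.
move=> B1 hB; apply: (@Ex_sum_cube_le (blocked i) (fun j => 32 / j%:R)) => //.
- exact: bmeas_blocked.
- by move=> k z; rewrite blocked_bool; case: andb; [right|left].
- exact: dep_blocked.
move=> l m F /andP[lm mn] bF F0 dF.
have bFJ : bmeas (fun z => F z * blocked i l z) by apply: bmeasM => //; exact: bmeas_blocked.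
have J0 z : 0 <= blocked i l z by rewrite blocked_bool.
have [il|li] := ltnP i l; last first.
  have z0 z : blocked i l z = 0 by rewrite blocked_bool ltnNge li.
  rewrite (_ : (fun z => F z * blocked i l z * blocked i m z) = fun=> 0); last first.
    by apply/funext => z; rewrite z0 mulr0 mul0r.
  by rewrite Ex_cst mulr_ge0 ?divr_ge0//; apply: Ex_ge0 => z; rewrite z0 mulr0.
apply: (blocked_step (l := l)) => //; first by rewrite ltnW.
- by move=> z; rewrite mulr_ge0.
- move=> z z' h; rewrite (@dep_blocked i l z z')//; congr (_ * _).
  by apply: dF => j jl; apply: h; rewrite ltnW.
Qed.

(** [(a + b)^3 <= 4 * a^3 + 4 * b^3] separates the lost record from the created ones, whose total
    expectation is summed over the blocked point instead of the blocker. The constant is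
    [4 * 64 + 4 * 13 * 256]. *)
Lemma sum_Df_cube (B : R) n : 1 <= B ->
  (forall l, (l < n)%N -> \sum_(m < n | (l < m)%N) 32 / (m - l)%:R <= B) ->
  \sum_(i < n) Ex (fun z => `|Df i (nrecords n) z| ^+ 3) <=
  13568 * dd%:R * B ^+ 2 * n%:R `^ (1 - alpha).
Proof.
move=> B1 hB.
have r0 k z : 0 <= record k z by rewrite record_bool.
have k0 i z : 0 <= nblocked i n z by apply: sumr_ge0 => k _; rewrite blocked_bool.
have bD i := bmeas_Df e0 i (bmeas_nrecords n).
apply: (@le_trans _ _ (\sum_(i < n) (4 * Ex (record i) + 4 * (13 * B ^+ 2 * Ex (nblocked i n))))).
  apply: ler_sum => -[i /= iN] _.
  apply: (@le_trans _ _ (Ex (fun z => 4 * record i z + 4 * nblocked i n z ^+ 3))).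
    apply: Ex_le; first by bmt.
      apply: bmeasD; apply: bmeasM; try exact: bmeas_cst; first exact: bmeas_record.
      by apply: bmeasX; exact: bmeas_nblocked.
    move=> z; rewrite Df_nrecords//.
    have rr : record i z ^+ 3 = record i z by rewrite record_bool -natrX; case: (_ && _).
    rewrite -[X in 4 * X + _]rr.
    move: (r0 i z) (k0 i z); set a := record i z; set b := nblocked i n z => a0 b0.
    have h : `|a - b| ^+ 3 <= (a + b) ^+ 3.
      rewrite lerXn2r ?nnegrE ?addr_ge0//.
      by rewrite ler_norml; apply/andP; split; lra.
    apply: (le_trans h); rewrite -subr_ge0.
    have -> : 4 * a ^+ 3 + 4 * b ^+ 3 - (a + b) ^+ 3 = 3 * ((a + b) * (a - b) ^+ 2) by ring.
    by rewrite mulr_ge0// mulr_ge0 ?sqr_ge0// addr_ge0.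
  have bk := bmeas_nblocked i n; have br := bmeas_record i.
  rewrite ExD; [|by apply: bmeasM => //; exact: bmeas_cst|by apply: bmeasM; [exact: bmeas_cst|exact: bmeasX]].
  rewrite ExZ// lerD2l ExZ; last exact: bmeasX.
  by rewrite ler_wpM2l//; exact: Ex_nblocked_cube.
rewrite big_split/= -!mulr_sumr.
have a12 : 0 < alpha <= 2^-1.
  have /andP[-> _] := alpha01; rewrite /= lef_pV2 ?posrE ?ltr0n ?ler_nat//; lia.
have s1 : \sum_(i < n) Ex (record i) <= 32 * dd%:R * (2 * n%:R `^ (1 - alpha)).
  apply: (@le_trans _ _ (\sum_(i < n) 32 * dd%:R * i.+1%:R `^ (- alpha))).
    by apply: ler_sum => i _; exact: Ex_record.
  by rewrite -mulr_sumr ler_wpM2l ?mulr_ge0//; exact: sum_powRN_le.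
have s2 : \sum_(i < n) Ex (nblocked i n) <= 128 * dd%:R * (2 * n%:R `^ (1 - alpha)).
  have -> : \sum_(i < n) Ex (nblocked i n) = \sum_(k < n) \sum_(i < k) Ex (blocked i k).
    have ek i : Ex (nblocked i n) = \sum_(k < n) Ex (blocked i k).
      by rewrite /nblocked (Ex_sum Q)// => k _; exact: bmeas_blocked.
    under eq_bigr do rewrite ek.
    rewrite exchange_big/=; apply: eq_bigr => -[k /= kn] _.
    rewrite -[RHS](big_mkord xpredT (fun i => Ex (blocked i k))) [RHS](big_nat_widen 0 k n) ?(ltnW kn)//.
    rewrite [RHS]big_mkord [LHS](bigID (fun i : 'I_n => (i < k)%N))/= [X in _ + X]big1 ?addr0//.
    move=> i ik; rewrite (_ : blocked i k = fun=> 0) ?Ex_cst//.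
    by apply/funext => z; rewrite blocked_bool (negbTE ik).
  apply: (@le_trans _ _ (\sum_(k < n) 128 * dd%:R * k.+1%:R `^ (- alpha))).
    by apply: ler_sum => k _; exact: Ex_blocked_sum.
  by rewrite -mulr_sumr ler_wpM2l ?mulr_ge0//; exact: sum_powRN_le.
have B2 : 1 <= B ^+ 2 by rewrite exprn_ege1.
have q0 : 0 <= dd%:R * n%:R `^ (1 - alpha) by rewrite mulr_ge0 ?powR_ge0.
set q := n%:R `^ _ in s1 s2 q0 *; set s := \sum_(_ < _) _ in s1 *; set s' := \sum_(_ < _) _ in s2 *.
have h1 : 13 * B ^+ 2 * s' <= 13 * B ^+ 2 * (128 * dd%:R * (2 * q)).
  by rewrite ler_wpM2l// mulr_ge0// sqr_ge0.
have h2 : dd%:R * q <= B ^+ 2 * (dd%:R * q) by rewrite ler_peMl.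
lra.
Qed.

(** * Lower bound on the variance *)

Definition low_pt (n : nat) i (z : Om) : R :=
  (inS (z i) && (v (z i) <= (4 * n%:R)^-1))%:R.

Lemma bmeas_low_pt n i : bmeas (low_pt n i).
Proof.
apply: (@bmeas_coordb (fun x => inS x && (v x <= (4 * n%:R)^-1))).
by apply: measurable_setb_and => //; exact: measurable_vle.
Qed.

Lemma free_low_pt n i j : i != j -> free_of j (low_pt n i).
Proof. by move=> ij z y; rewrite /low_pt update_other. Qed.

Lemma Ex_low_pt_center n i F : bmeas F -> free_of i F ->
  Ex (fun z => F z * (low_pt n i z - Ex (low_pt n i))) = 0.
Proof.
move=> bF nF; have bl := bmeas_low_pt n i.
have bc : bmeas (fun z => low_pt n i z - Ex (low_pt n i)) by apply: bmeasB => //; exact: bmeas_cst.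
rewrite (Ex_update Qind i); last by bmt.
rewrite -[RHS](Ex_cst Q); congr (expct Q); apply/funext => z'.
rewrite (_ : (fun z => _) = fun z => F z' * (low_pt n i z - Ex (low_pt n i))).
  by rewrite ExZ// ExB ?Ex_cst ?subrr ?mulr0//; exact: bmeas_cst.
by apply/funext => z; rewrite nF; congr (_ * (_ - _)); rewrite /low_pt update_same.
Qed.

Lemma prod_ge_1subsum (s : seq nat) (b : nat -> bool) :
  1 - \sum_(i <- s) (b i)%:R <= \prod_(i <- s) (~~ b i)%:R :> R.
Proof.
elim: s => [|i s ih]; first by rewrite !big_nil subr0.
rewrite !big_cons; have p0 : 0 <= \prod_(i <- s) (~~ b i)%:R :> R by apply: prodr_ge0.
have s0 : 0 <= \sum_(i <- s) (b i)%:R :> R by apply: sumr_ge0.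
by case: (b i); rewrite /= ?mul0r ?mul1r ?add0r//; lra.
Qed.

(* Cauchy-Schwarz against the number of points with [v x <= (4 * n)^-1] among the last
   [n %/ 256]: such points are records with probability bounded below. *)
Lemma variance_lower n : (256 <= n)%N ->
  (forall k x, (k < n)%N -> inS x -> v x <= (4 * n%:R)^-1 -> theta k x) ->
  (forall i, (n - n %/ 256 <= i)%N -> 32 * dd%:R * i.+1%:R `^ (- alpha) <= 8^-1) ->
  16^-1 * ((n %/ 256)%:R * (4 * n%:R)^-1 `^ alpha) <=
  Ex (fun z => nrecords n z ^+ 2) - Ex (nrecords n) ^+ 2.
Proof.
move=> n256 thlow h8.
(* At this threshold [t] a low point has on average at most 1/4 dominators among [n] points. *)
pose b := (n %/ 256)%N; pose t : R := (4 * n%:R)^-1.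
have n0 : 0 < (n%:R : R) by rewrite ltr0n; lia.
have t0 : 0 < t by rewrite invr_gt0 mulr_gt0.
have t1 : t <= 1 by rewrite invf_le1 ?mulr_gt0// -natrM ler1n; lia.
pose p i := Ex (low_pt n i).
have bl i := bmeas_low_pt n i.
have l01 i z : 0 <= low_pt n i z <= 1 by rewrite /low_pt ler0n lern1 leq_b1.
have pt i : t `^ alpha <= p i.
  have /= := Ex_low_lb i (u := t `^ alpha); rewrite powR_alphaK ?(ltW t0)// powR_ge0/=; apply.
  have /andP[a0 _] := alpha01.
  rewrite -[leRHS](powRr0 t); apply: ger_powR; rewrite ?t0//; exact: ltW.
have p0 i : 0 <= p i by apply: Ex_ge0 => z; have /andP[] := l01 i z.
have bg := bmeas_nrecords n.
pose c i z := low_pt n i z - p i.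
have bc i : bmeas (c i) by apply: bmeasB => //; exact: bmeas_cst.
have cov i : (n - b <= i < n)%N -> p i / 4 <= Ex (fun z => nrecords n z * c i z).
  move=> /andP[bi iN].
  have brc := bmeas_record i; have bkc := bmeas_nblocked i n.
  have bD := bmeas_Df e0 i bg.
  (* The count without point [i] is independent of the centred indicator of [i], so only the effect
     of [i] remains. *)
  have -> : Ex (fun z => nrecords n z * c i z) = Ex (fun z => Df i (nrecords n) z * c i z).
    have bu := bmeas_update i e0 bg.
    have : Ex (fun z => nrecords n (update z i e0) * c i z) = 0.
      apply: Ex_low_pt_center => // z y; congr nrecords; apply/funext => j; rewrite /update.
      by case: eqP.
    move=> h; rewrite (_ : (fun z => Df i (nrecords n) z * c i z) =
       fun z => nrecords n z * c i z - nrecords n (update z i e0) * c i z); last first.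
      by apply/funext => z; rewrite /dropdiff mulrBl.
    by rewrite ExB ?h ?subr0; [|by bmt|by bmt].
  have ea : (3 / 4) * p i <= Ex (fun z => record i z * low_pt n i z).
    apply: (@le_trans _ _ (Ex (fun z => low_pt n i z - \sum_(j <- iota 0 i) low_pt n i z * (prec (z i) (z j))%:R))).
      rewrite ExB//; last by apply: bmeas_sum => j _; apply: bmeasM => //; exact: bmeas_prec.
      rewrite Ex_sum; last by move=> j _; apply: bmeasM => //; exact: bmeas_prec.
      have : \sum_(j <- iota 0 i) Ex (fun z => low_pt n i z * (prec (z i) (z j))%:R) <= \sum_(j <- iota 0 i) t * p i.
        rewrite big_seq [leRHS]big_seq; apply: ler_sum => j; rewrite mem_iota add0n => /andP[_ ji].
        have ji' : j != i by rewrite ltn_eqF.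
        apply: (le_trans (Ex_prec_out ji' (bl i) _ _)).
        - by move=> z; have /andP[] := l01 i z.
        - by apply: free_low_pt; rewrite eq_sym.
        rewrite -/p -ExZ//; apply: Ex_le; [|by bmt|].
          by apply: bmeasM => //; apply: bmeasB; [exact: bmeas_cst|exact: bmeas_escape].
        move=> z; rewrite mulrC /low_pt /escape; case: (boolP (inS (z i))) => /= iS; last by rewrite !mulr0.
        by rewrite subKr; case: (boolP (v (z i) <= _)) => h; rewrite ?mulr0// !mulr1.
      rewrite big_const_seq count_predT size_iota iter_addr addr0 -mulr_natl -/(p i).
      have : i%:R * (t * p i) <= 4^-1 * p i.
        rewrite mulrA ler_wpM2r// /t invfM mulrCA -[leRHS]mulr1 ler_wpM2l//.
        by rewrite ler_pdivrMr// mul1r ler_nat ltnW.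
      by lra.
    apply: Ex_le; [|by bmt|].
      by apply: bmeasB => //; apply: bmeas_sum => j _; apply: bmeasM => //; exact: bmeas_prec.
    move=> z; rewrite -mulr_sumr /low_pt /record; case: (boolP (inS _ && _)) => [/andP[iS vi]|_]; last first.
      by rewrite mul0r subr0 mulr0.
    by rewrite thlow// !mul1r mulr1; exact: (prod_ge_1subsum _ (fun j => prec (z i) (z j))).
  (* Only the fewer than [b] points after [i] can be blocked by [i], each with conditional
     probability at most [32 / (n - b)]. The block size makes [32 * b / (n - b) <= 1/7]. *)
  have eb : Ex (fun z => nblocked i n z * low_pt n i z) <= p i / 7.
    rewrite (_ : (fun z => _) = fun z => \sum_(k < n) blocked i k z * low_pt n i z); last first.
      by apply/funext => z; rewrite mulr_suml.
    rewrite Ex_sum; last by move=> k _; apply: bmeasM => //; exact: bmeas_blocked.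
    have jb k : Ex (fun z => blocked i k z * low_pt n i z) <= (i < k)%N%:R * (32 / k%:R * p i).
      case: (ltnP i k) => ik; last first.
        rewrite mul0r (_ : (fun z => _) = fun=> 0) ?Ex_cst//.
        by apply/funext => z; rewrite blocked_bool ltnNge ik mul0r.
      rewrite mul1r.
      have bS := bmeas_inS k; have bw := bmeas_escape k; have bN j := bmeas_nprec k j; have bP := bmeas_prec k i.
      apply: (@le_trans _ _ (Ex (fun z => (low_pt n i z * (prec (z k) (z i))%:R) * (inS (z k))%:R *
       \prod_(j <- [seq j <- iota 0 k | j != i]) (~~ prec (z k) (z j))%:R))).
        apply: Ex_le; [by apply: bmeasM => //; exact: bmeas_blocked|by bmt|move=> z].
        rewrite mulrC -!mulrA; apply: ler_wpM2l; first by have /andP[] := l01 i z.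
        by rewrite mulrA; exact: blocked_le.
      apply: (le_trans (Ex_prod_nprec_le _ _ _ _ _)); try by bmt.
      - by move=> z; rewrite mulr_ge0//; have /andP[] := l01 i z.
      - by rewrite mem_filter mem_iota add0n ltnn !andbF.
      - by rewrite filter_uniq// iota_uniq.
      - move=> j; rewrite mem_filter mem_iota add0n => /andP[ji jk] z y.
        rewrite !update_other//; [|by rewrite eq_sym|by rewrite gtn_eqF].
        by congr (_ * _); apply: free_low_pt; rewrite eq_sym.
      rewrite size_iota_neq//.
      apply: (@le_trans _ _ (Ex (fun z => low_pt n i z * ((prec (z k) (z i))%:R * escape (z k) ^+ k.-1)))).
        apply: Ex_le; [by bmt|by bmt|move=> z].
        have w0 : 0 <= escape (z k) by have /andP[] := escape01 (z k).
        rewrite -!mulrA; apply: ler_wpM2l; first by have /andP[] := l01 i z.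
        by rewrite ler_wpM2l// ler_piMl ?exprn_ge0//; case: (inS _).
      apply: (Ex_coord_le_cst (k := k) Qind (bl i)); first by bmt.
      - by move=> z; have /andP[] := l01 i z.
      - by apply: free_low_pt; rewrite ltn_eqF.
      move=> z'; under eq_fun do rewrite update_same update_other ?ltn_eqF//.
      by have := Ex_prec_escape k (z' i) k.-1; rewrite prednK//; lia.
    apply: (@le_trans _ _ (\sum_(k < n) (i < k)%N%:R * (32 / k%:R * p i))).
      by apply: ler_sum => k _; exact: jb.
    have nb0 : 0 < ((n - b)%:R : R) by rewrite ltr0n subn_gt0 /b; lia.
    apply: (@le_trans _ _ (\sum_(k < n) (n - b <= k)%N%:R * (32 / (n - b)%:R * p i))).
      apply: ler_sum => k _; case: (ltnP i k) => ik; last by rewrite mul0r mulr_ge0// mulr_ge0// divr_ge0.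
      have bk : (n - b <= k)%N by lia.
      rewrite bk !mul1r ler_wpM2r// ler_wpM2l// lef_pV2 ?posrE ?ltr0n ?ler_nat//; lia.
    rewrite -mulr_suml.
    have -> : \sum_(k < n) (n - b <= k)%N%:R = b%:R :> R.
      rewrite -natr_sum; congr _%:R.
      rewrite -(big_mkord xpredT (fun k => (n - b <= k)%N : nat)) (big_cat_nat (n := n - b))//=; last by lia.
      rewrite big_nat big1 ?add0n; last by move=> k /andP[_ kb]; rewrite leqNgt kb.
      rewrite big_nat (eq_bigr (fun=> 1%N)); last by move=> k /andP[kb _]; rewrite kb.
      by rewrite -big_nat sum_nat_const_nat muln1 subKn// /b; lia.
    have h7 : b%:R * (32 / (n - b)%:R) <= 7^-1 :> R.
      by rewrite mulrA ler_pdivrMr// ler_pdivlMl// -!natrM ler_nat /b; lia.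
    by rewrite mulrA [leRHS]mulrC ler_wpM2r.
  have ec : p i * Ex (record i) <= p i / 8.
    by rewrite ler_wpM2l//; apply: le_trans (h8 i bi); exact: Ex_record.
  have ed : 0 <= p i * Ex (nblocked i n).
    by rewrite mulr_ge0//; apply: Ex_ge0 => z; apply: sumr_ge0 => k _; rewrite blocked_bool.
  have -> : Ex (fun z => Df i (nrecords n) z * c i z) = Ex (fun z => record i z * low_pt n i z) -
     Ex (fun z => nblocked i n z * low_pt n i z) - p i * Ex (record i) + p i * Ex (nblocked i n).
    rewrite -!ExZ// -ExB; try by bmt.
    rewrite -ExB; try by bmt.
    rewrite -ExD; try by bmt.
    congr (expct Q); apply/funext => z; rewrite Df_nrecords// /c; ring.
  (* The margin is [3/4 - 1/7 - 1/8 >= 1/4]. *)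
  have := p0 i; move: ea eb ec ed.
  move: (Ex (fun z => record i z * low_pt n i z)) (Ex (fun z => nblocked i n z * low_pt n i z))
    (p i * Ex (record i)) (p i * Ex (nblocked i n)) (p i) => *; lra.
pose Y z := \sum_(n - b <= i < n) c i z.
have bY : bmeas Y by apply: bmeas_sum => i _.
have EY : Ex Y = 0.
  rewrite /Y (Ex_sum Q)// big1// => i _.
  by rewrite /c ExB ?Ex_cst ?subrr//; exact: bmeas_cst.
have EgY : (\sum_(n - b <= i < n) p i) / 4 <= Ex (fun z => nrecords n z * Y z).
  rewrite (_ : (fun z => _) = fun z => \sum_(n - b <= i < n) nrecords n z * c i z); last first.
    by apply/funext => z; rewrite mulr_sumr.
  rewrite (Ex_sum Q); last by move=> i _; bmt.
  by rewrite mulr_suml big_nat [leRHS]big_nat; apply: ler_sum => i; exact: cov.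
have EYY : Ex (fun z => Y z ^+ 2) <= \sum_(n - b <= i < n) p i.
  rewrite (_ : (fun z => _) = fun z => \sum_(n - b <= i < n) \sum_(n - b <= j < n) c j z * c i z); last first.
    by apply/funext => z; rewrite expr2 {2}/Y mulr_sumr; apply: eq_bigr => i _; rewrite mulr_suml.
  rewrite (Ex_sum Q); last by move=> i _; apply: bmeas_sum => j _; bmt.
  rewrite big_nat [leRHS]big_nat; apply: ler_sum => i ib.
  rewrite (Ex_sum Q); last by move=> j _; bmt.
  rewrite (bigD1_seq i) ?iota_uniq ?mem_index_iota//= big1 ?addr0; last first.
    move=> j ji; apply: Ex_low_pt_center => // z y; rewrite /c; congr (_ - _).
    exact: free_low_pt.
  rewrite (_ : (fun z => _) = fun z => (low_pt n i z - (2 * p i) * low_pt n i z) + p i ^+ 2); last first.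
    apply/funext => z; rewrite /c.
    have ll : low_pt n i z * low_pt n i z = low_pt n i z by rewrite /low_pt; case: (_ && _); rewrite ?mulr1 ?mulr0.
    by rewrite -[X in _ = X - _ + _]ll; ring.
  rewrite ExD; [|by bmt|by bmt].
  rewrite ExB; [|by bmt|by bmt].
  by rewrite ExZ// Ex_cst -/(p i); have := sqr_ge0 (p i); rewrite expr2; lra.
have bt : b%:R * t `^ alpha <= \sum_(n - b <= i < n) p i.
  apply: (@le_trans _ _ (\sum_(n - b <= i < n) t `^ alpha)).
    rewrite sumr_const_nat subKn ?mulr_natl// /b; lia.
  by apply: ler_sum => i _.
set m := Ex (nrecords n).
(* This square gives Var >= E[nrecords Y] / 2 - E[Y^2] / 16, at least [1/8 - 1/16] times the sum of
   the [p i]. *)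
have : 0 <= Ex (fun z => (nrecords n z - m - 4^-1 * Y z) ^+ 2) by apply: Ex_ge0 => z; exact: sqr_ge0.
have -> : Ex (fun z => (nrecords n z - m - 4^-1 * Y z) ^+ 2) =
    Ex (fun z => nrecords n z ^+ 2) - m ^+ 2 - 2^-1 * Ex (fun z => nrecords n z * Y z) +
    16^-1 * Ex (fun z => Y z ^+ 2).
  rewrite (_ : (fun z => _) = fun z => nrecords n z ^+ 2 - (2 * m) * nrecords n z + m ^+ 2 - 2^-1 * (nrecords n z * Y z) +
    (2^-1 * m) * Y z + 16^-1 * Y z ^+ 2); last first.
    by apply/funext => z; field.
  rewrite ExD; [|by bmt|by bmt].
  rewrite ExD; [|by bmt|by bmt].
  rewrite ExB; [|by bmt|by bmt].
  rewrite ExD; [|by bmt|by bmt].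
  rewrite ExB; [|by bmt|by bmt].
  rewrite !ExZ ?Ex_cst ?EY//; try by bmt.
  by rewrite -/m; ring.
by move: EgY EYY bt; set S := \sum_(_ <= _ < _) _; rewrite -/b -/t; lra.
Qed.

(** * Second differences of the record count *)

Definition link k a (y : Om) : bool := [&& (a < k)%N, theta k (y k) & prec (y k) (y a)].

Lemma blocked_le_link b k y : blocked b k y <= (link k b y)%:R.
Proof.
rewrite blocked_bool /link ler_nat; case: (b < k)%N; case: (theta _ _); case: (prec _ _) => //=.
exact: leq_b1.
Qed.

Lemma blocked_ge0 b k y : 0 <= blocked b k y.
Proof. by rewrite blocked_bool. Qed.

Lemma theta_e0 k : theta k e0 = false.
Proof. by apply/negP => /thetaS; rewrite (negbTE e0S). Qed.

(** Deleting [a] and [b] interacts in [record k] only if one of them is [k] and the other dominates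
    it, or if both dominate it. Otherwise the deletion of [a] leaves [Df b (record k)] unchanged. *)
Lemma Df_Df_record a b k y : a != b -> `|Df a (Df b (record k)) y| <=
  (b == k)%:R * (link k a y)%:R + (a == k)%:R * (link k b y)%:R + (link k a y)%:R * (link k b y)%:R.
Proof.
move=> ab; have -> : Df a (Df b (record k)) y = Df b (record k) y - Df b (record k) (update y a e0) by [].
rewrite !Df_record.
set y' := update y a e0.
have [bk|bk] := eqVneq b k.
  rewrite /= !mul1r -bk (_ : blocked b b y = 0); last by rewrite blocked_bool ltnn.
  rewrite (_ : blocked b b y' = 0); last by rewrite blocked_bool ltnn.
  rewrite !subr0 -[record b y - _]/(Df a (record b) y) Df_record (negbTE ab) mul0r sub0r normrN.
  rewrite ger0_norm ?blocked_ge0// mul0r addr0 (le_trans (blocked_le_link _ _ _))//.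
  by rewrite lerDl mulr_ge0.
rewrite /= !mul0r !sub0r opprK add0r.
have [ak|ak] := eqVneq a k.
  rewrite (_ : blocked b k y' = 0); last by rewrite blocked_bool /y' ak update_same theta_e0 andbF.
  rewrite addr0 normrN ger0_norm ?blocked_ge0// mul1r (le_trans (blocked_le_link _ _ _))//.
  by rewrite lerDl mulr_ge0.
rewrite mul0r add0r.
have e' : link k b y' = link k b y by rewrite /link /y' !update_other// eq_sym.
case: (boolP (link k a y)) => [_|ne].
  rewrite mul1r; have := blocked_le_link b k y; have := blocked_le_link b k y'; rewrite e'.
  have := blocked_ge0 b k y; have := blocked_ge0 b k y'; move=> *.
  by rewrite ler_norml; apply/andP; split; lra.
rewrite mul0r (_ : blocked b k y = blocked b k y') ?addNr ?normr0//.
rewrite !blocked_bool /y' !(@update_other _ a _ k) 1?eq_sym// (@update_other _ a _ b) 1?eq_sym//.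
case: (boolP (theta k (y k))) => tk; rewrite ?andbF//=.
congr (nat_of_bool _)%:R; congr (_ && (_ && _)); apply: eq_in_all => j.
rewrite mem_iota add0n => /andP[_ jk]; congr (_ ==> ~~ _).
have [ja|ja] := eqVneq j a; last by rewrite update_other.
rewrite ja update_same prec_e0r; move: ne; rewrite /link tk -ja jk /=.
by case: (prec _ _).
Qed.

Lemma sum_eq_ord n a (f : nat -> R) : (a < n)%N -> \sum_(k < n) (a == k)%:R * f k = f a.
Proof.
move=> an; rewrite (bigD1 (Ordinal an))//= eqxx mul1r big1 ?addr0// => k ka.
by rewrite (_ : (a == k :> nat) = false) ?mul0r//; apply/eqP => h; case/eqP: ka; apply/val_inj.
Qed.

Lemma Df_Df_nrecords n a b y : a != b -> (a < n)%N -> (b < n)%N ->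
  `|Df a (Df b (nrecords n)) y| <=
  (link b a y)%:R + (link a b y)%:R + \sum_(k < n) (link k a y)%:R * (link k b y)%:R.
Proof.
move=> ab an bn.
have -> : Df a (Df b (nrecords n)) y = \sum_(k < n) Df a (Df b (record k)) y.
  by rewrite /dropdiff /nrecords -!sumrB.
apply: (le_trans (ler_norm_sum _ _ _)).
apply: (@le_trans _ _ (\sum_(k < n) ((b == k)%:R * (link k a y)%:R + (a == k)%:R * (link k b y)%:R +
   (link k a y)%:R * (link k b y)%:R))).
  by apply: ler_sum => k _; exact: Df_Df_record.
by rewrite !big_split/= (sum_eq_ord (fun k => (link k a y)%:R))// (sum_eq_ord (fun k => (link k b y)%:R)).
Qed.

Lemma Df_nrecords_le n a y : (a < n)%N ->
  `|Df a (nrecords n) y| <= (theta a (y a))%:R + \sum_(k < n) (link k a y)%:R.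
Proof.
move=> an; rewrite Df_nrecords//; apply: (le_trans (ler_normB _ _)); apply: lerD.
  rewrite ger0_norm record_bool// ler_nat.
  by case: (theta _ _) => //=; exact: leq_b1.
apply: (le_trans (ler_norm_sum _ _ _)); apply: ler_sum => k _.
by rewrite ger0_norm ?blocked_ge0//; exact: blocked_le_link.
Qed.

(** * The variance of T over two copies of the sample *)

Section exchT.
Variable n : nat.

(* The indices [n <= q < 2 * n] are independent copies of those below [n]; [time] forgets
   the copy, and [fold2], [sum2] sum over both copies. *)
Definition time q : nat := if (q < n)%N then q else (q - n)%N.

Definition edge q r (z : Om) : bool :=
  [&& (time r < time q)%N, theta (time q) (z q) & prec (z q) (z r)].

Definition fold2 (f : nat -> R) i : R := f i + f (n + i)%N.
Definition sum2 (f : nat -> R) : R := \sum_(k < n) fold2 f k.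

Definition indeg q z : R := sum2 (fun r => (edge r q z)%:R).
Definition outdeg q z : R := sum2 (fun r => (edge q r z)%:R).

(** Summing over both copies makes the bounds independent of how many points were exchanged: after
    any [swap_first n j], position [i] holds one of its two copies. [Dbound] controls first
    differences, [DDbound] second ones. *)
Definition Dbound i (z : Om) : R := fold2 (fun q => (theta i (z q))%:R + indeg q z) i.
Definition DDbound i q z : R := fold2 (fun r => (edge q r z)%:R + (edge r q z)%:R +
   sum2 (fun k => (edge k q z)%:R * (edge k r z)%:R)) i.

Lemma fold2_ge0 f i : (forall q, 0 <= f q) -> 0 <= fold2 f i.
Proof. by move=> f0; rewrite addr_ge0. Qed.

Lemma sum2_ge0 f : (forall q, 0 <= f q) -> 0 <= sum2 f.
Proof. by move=> f0; apply: sumr_ge0 => k _; exact: fold2_ge0. Qed.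

Lemma fold2_le f f' i : (forall q, f q <= f' q) -> fold2 f i <= fold2 f' i.
Proof. by move=> h; apply: lerD. Qed.

Lemma sum2_le f f' : (forall q, f q <= f' q) -> sum2 f <= sum2 f'.
Proof. by move=> h; apply: ler_sum => k _; exact: fold2_le. Qed.

Lemma swap_fold2 j i f : (j <= n)%N -> (i < n)%N -> (forall q, 0 <= f q) -> f (swap_first n j i) <= fold2 f i.
Proof.
move=> jn iN f0; rewrite /swap_first /fold2; case: ifP => _; first by rewrite addnC lerDr.
by rewrite (_ : (n <= i < n + j)%N = false) ?lerDl//; lia.
Qed.

Lemma time_swap j i : (j <= n)%N -> (i < n)%N -> time (swap_first n j i) = i.
Proof.
move=> jn iN; rewrite /swap_first; case: ifP => _; first by rewrite /time ltnNge leq_addl/= addnK.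
by rewrite (_ : (n <= i < n + j)%N = false) /time ?iN//; lia.
Qed.

Lemma link_edge j k a z : (j <= n)%N -> (k < n)%N -> (a < n)%N ->
  link k a (relabel (swap_first n j) z) = edge (swap_first n j k) (swap_first n j a) z.
Proof. by move=> jn kn an; rewrite /link /edge !time_swap. Qed.

Lemma sum_link j (f : nat -> R) : (j <= n)%N -> (forall q, 0 <= f q) ->
  \sum_(k < n) f (swap_first n j k) <= sum2 f.
Proof. by move=> jn f0; apply: ler_sum => -[k /= kn] _; exact: swap_fold2. Qed.

Lemma sum2_pull (f : nat -> R) c : sum2 (fun r => c * f r) = c * sum2 f.
Proof. by rewrite /sum2 mulr_sumr; apply: eq_bigr => k _; rewrite /fold2 mulrDr. Qed.

Definition Dswap j i (z : Om) : R := Df i (nrecords n) (relabel (swap_first n j) z).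

Lemma Dswap_le j i z : (j <= n)%N -> (i < n)%N -> `|Dswap j i z| <= Dbound i z.
Proof.
move=> jn iN; apply: (le_trans (Df_nrecords_le _ iN)).
apply: (@le_trans _ _ ((theta i (z (swap_first n j i)))%:R + indeg (swap_first n j i) z)).
  rewrite lerD2l; apply: (le_trans _ (sum_link (f := fun r => (edge r (swap_first n j i) z)%:R) jn _)) => //.
  by apply: ler_sum => -[k /= kn] _; rewrite link_edge.
apply: (swap_fold2 (f := fun q => (theta i (z q))%:R + indeg q z)) => // q.
by rewrite addr_ge0// sum2_ge0.
Qed.

Lemma Df_relabel j q F z : (j <= n)%N -> dep_below n F ->
  Df q (fun z => F (relabel (swap_first n j) z)) z =
  if (swap_first n j q < n)%N then Df (swap_first n j q) F (relabel (swap_first n j) z) else 0.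
Proof.
move=> jn dF; rewrite /dropdiff.
have -> : relabel (swap_first n j) (update z q e0) = update (relabel (swap_first n j) z) (swap_first n j q) e0.
  apply/funext => m; rewrite /relabel /update.
  by rewrite (can2_eq (swap_firstK jn) (swap_firstK jn)).
case: ifP => // /negbT; rewrite -leqNgt => h.
by rewrite (dep_free dF)// subrr.
Qed.

Lemma dep_Df i F : dep_below n F -> dep_below n (Df i F).
Proof.
move=> dF z z' h; rewrite /dropdiff (dF z z')//; congr (_ - _); apply: dF => m mn.
by rewrite /update; case: eqP => // _; exact: h.
Qed.

Lemma DDbound_ge0 i q z : 0 <= DDbound i q z.
Proof.
by apply: fold2_ge0 => r; rewrite addr_ge0 ?addr_ge0// sum2_ge0.
Qed.

Lemma Dbound_ge0 i z : 0 <= Dbound i z.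
Proof. by apply: fold2_ge0 => q; rewrite addr_ge0 ?sum2_ge0. Qed.

(** In the swapped sequence coordinate [q] either sits at position [time q] or lies beyond [n] and
    is invisible. At position [i], deleting the same point again returns the first difference
    itself, hence the extra term. *)
Lemma Df_Dswap_le j i q z : (j <= n)%N -> (i < n)%N ->
  `|Df q (Dswap j i) z| <= DDbound i q z + (time q == i)%:R * Dbound i z.
Proof.
move=> jn iN.
have dg := @dep_nrecords n.
rewrite (@Df_relabel j q (Df i (nrecords n)) z jn (dep_Df i dg)).
case: ifP => an; last by rewrite normr0 addr_ge0 ?DDbound_ge0// mulr_ge0// Dbound_ge0.
set a := swap_first n j q in an *.
have qa : q = swap_first n j a by rewrite /a swap_firstK.
have tq : time q = a by rewrite qa time_swap.
rewrite tq; have [->|ai] := eqVneq a i.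
  have -> : Df i (Df i (nrecords n)) (relabel (swap_first n j) z) = Dswap j i z.
    rewrite /Dswap {1}/dropdiff [X in _ - X](_ : _ = 0) ?subr0// /dropdiff.
    by rewrite (_ : update (update _ _ _) _ _ = update (relabel (swap_first n j) z) i e0) ?subrr//;
       apply/funext => m; rewrite /update; case: eqP.
  by rewrite mul1r; apply: (le_trans (Dswap_le z jn iN)); rewrite lerDr DDbound_ge0.
rewrite mul0r addr0.
apply: (le_trans (Df_Df_nrecords _ ai an iN)).
rewrite !link_edge// -qa.
apply: (@le_trans _ _ ((edge (swap_first n j i) q z)%:R + (edge q (swap_first n j i) z)%:R +
   sum2 (fun k => (edge k q z)%:R * (edge k (swap_first n j i) z)%:R))).
  rewrite lerD2l.
  apply: (le_trans _ (sum_link (f := fun r => (edge r q z)%:R * (edge r (swap_first n j i) z)%:R) jn _)); last first.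
    by move=> r; rewrite mulr_ge0.
  by apply: ler_sum => -[k /= kn] _; rewrite !link_edge// -qa.
apply: (le_trans _ (swap_fold2 (f := fun r => (edge q r z)%:R + (edge r q z)%:R +
   sum2 (fun k => (edge k q z)%:R * (edge k r z)%:R)) jn iN _)); last first.
  by move=> r; rewrite addr_ge0 ?addr_ge0// sum2_ge0.
by rewrite /= lerD2r addrC.
Qed.

Lemma edge_update q r k z : edge q r (update z k e0) -> edge q r z.
Proof.
rewrite /edge /update; case: eqP => [->|_]; first by rewrite theta_e0 andbF.
by case: eqP => // _; rewrite prec_e0r !andbF.
Qed.

Lemma Dbound_update i q z : Dbound i (update z q e0) <= Dbound i z.
Proof.
apply: fold2_le => r; apply: lerD.
  rewrite ler_nat /update; case: eqP => // _; rewrite theta_e0; exact: leq0n.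
apply: sum2_le => k; rewrite ler_nat; by case: (boolP (edge k r (update z q e0))) => [/edge_update ->|_].
Qed.

Definition exchT (z : Om) : R :=
  \sum_(i < n) Df i (nrecords n) z * (Dswap i i z - Dswap i.+1 i z).

Lemma Dswap0 i z : Dswap 0 i z = Df i (nrecords n) z.
Proof. by rewrite /Dswap relabel_swap0. Qed.

Definition DDsum q z : R := \sum_(i < n) (DDbound i q z + (time q == i)%:R * Dbound i z).

Lemma Df_exchT_le q z (M : R) : (forall i, (i < n)%N -> Dbound i z <= 4 * M) ->
  `|Df q exchT z| <= 16 * M * DDsum q z.
Proof.
move=> hM.
(* Discrete product rule. In the second product the first factor is taken after the deletion, which
   by [Dbound_update] cannot increase its bound. *)
have -> : Df q exchT z = \sum_(i < n) (Df q (Dswap 0 i) z * (Dswap i i z - Dswap i.+1 i z) +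
   Dswap 0 i (update z q e0) * (Df q (Dswap i i) z - Df q (Dswap i.+1 i) z)).
  rewrite /exchT {1}/dropdiff -sumrB; apply: eq_bigr => i _; rewrite -!Dswap0 /dropdiff; ring.
apply: (le_trans (ler_norm_sum _ _ _)); rewrite /DDsum mulr_sumr; apply: ler_sum => -[i /= iN] _.
set u := _ + _ * Dbound i z.
have u0 : 0 <= u by rewrite addr_ge0 ?DDbound_ge0// mulr_ge0// Dbound_ge0.
have h j : (j <= n)%N -> `|Df q (Dswap j i) z| <= u by move=> jn; exact: Df_Dswap_le.
have t0 := Dbound_ge0 i z; have tM := hM i iN.
have g j : (j <= n)%N -> `|Dswap j i z| <= 4 * M by move=> jn; apply: le_trans tM; exact: Dswap_le.
have g' : `|Dswap 0 i (update z q e0)| <= 4 * M.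
  by apply: le_trans tM; apply: le_trans (Dbound_update _ _ _); exact: Dswap_le.
apply: (le_trans (ler_normD _ _)); rewrite !normrM.
have -> : 16 * M * u = u * (8 * M) + (4 * M) * (2 * u) by ring.
apply: lerD; apply: ler_pM => //.
- exact: h.
- by apply: (le_trans (ler_normB _ _)); have := g i (ltnW iN); have := g i.+1 iN; lra.
- by apply: (le_trans (ler_normB _ _)); have := h i (ltnW iN); have := h i.+1 iN; lra.
Qed.

Lemma sum2E f : sum2 f = \sum_(q < n + n) f q.
Proof. by rewrite big_split_ord /sum2 /fold2 big_split. Qed.

Lemma sum2_exchange (f : nat -> nat -> R) :
  sum2 (fun r => sum2 (fun k => f k r)) = sum2 (fun k => sum2 (fun r => f k r)).
Proof.
rewrite !sum2E; under eq_bigr do rewrite sum2E; rewrite exchange_big/=.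
by apply: eq_bigr => k _; rewrite sum2E.
Qed.

Lemma sum2D f f' : sum2 (fun q => f q + f' q) = sum2 f + sum2 f'.
Proof. by rewrite !sum2E big_split. Qed.

Definition degload (M : nat) q z : R := outdeg q z + M.+1%:R * indeg q z + Dbound (time q) z.

Lemma outdeg_ge0 q z : 0 <= outdeg q z. Proof. exact: sum2_ge0. Qed.
Lemma indeg_ge0 q z : 0 <= indeg q z. Proof. exact: sum2_ge0. Qed.

Lemma degload_ge0 M q z : 0 <= degload M q z.
Proof. by rewrite !addr_ge0 ?mulr_ge0 ?outdeg_ge0 ?indeg_ge0 ?Dbound_ge0. Qed.

Lemma time_lt q : (q < n + n)%N -> (time q < n)%N.
Proof. by rewrite /time; case: ifP => // ?; lia. Qed.

(** Summed over [i], the common-neighbour terms count an edge from some [k] into [q] together with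
    an edge out of [k]; at most [M] edges leave each [k], so they are bounded by [M * indeg q z]. *)
Lemma DDsum_le q z (M : nat) : (q < n + n)%N -> (forall k, (k < n + n)%N -> outdeg k z <= M%:R) ->
  DDsum q z <= degload M q z.
Proof.
move=> qn hu; rewrite /DDsum big_split/=.
rewrite (sum_eq_ord (fun i => Dbound i z)) ?time_lt// lerD2r.
rewrite -/(sum2 (fun r => (edge q r z)%:R + (edge r q z)%:R +
   sum2 (fun k => (edge k q z)%:R * (edge k r z)%:R))) !sum2D sum2_exchange.
rewrite -/(outdeg q z) -/(indeg q z) -addrA lerD2l -natr1 mulrDl mul1r addrC lerD2r.
rewrite -sum2_pull !sum2E; apply: ler_sum => -[k /= kn] _.
by rewrite sum2_pull mulrC ler_wpM2r//; exact: hu.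
Qed.

(** Only one factor [degload] of the square is replaced by its maximum [7 * M^2]. The other stays
    linear, so that its expectations sum to the order of counted points and edges rather than to
    [n]. The constant is [256 * 7]. *)
Lemma Df_exchT_sqr_good q z (M : nat) : (1 <= M)%N -> (q < n + n)%N ->
  (forall k, (k < n + n)%N -> outdeg k z <= M%:R /\ indeg k z <= M%:R) ->
  Df q (exchT) z ^+ 2 <= 1792 * M%:R ^+ 4 * degload M q z.
Proof.
move=> M1 qn h.
have M1' : 1 <= M%:R :> R by rewrite ler1n.
have hT i : (i < n)%N -> Dbound i z <= 4 * M%:R.
  move=> iN; rewrite /Dbound /fold2.
  have [_ h1] := h i (ltn_addr _ iN).
  have [_ h2] : outdeg (n + i)%N z <= M%:R /\ indeg (n + i)%N z <= M%:R by apply: h; rewrite ltn_add2l.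
  have t1 k : (theta i (z k))%:R <= 1 :> R by rewrite lern1 leq_b1.
  by have := t1 i; have := t1 (n + i)%N; lra.
have hU : DDsum q z <= degload M q z by apply: DDsum_le => // k /h[].
have U0 : 0 <= DDsum q z.
  by apply: sumr_ge0 => i _; rewrite addr_ge0 ?DDbound_ge0// mulr_ge0// Dbound_ge0.
have hb : degload M q z <= 7 * M%:R ^+ 2.
  have [h1 h2] := h q qn; have h3 := hT _ (time_lt qn).
  rewrite /degload -natr1 expr2.
  have : M%:R * indeg q z <= M%:R * M%:R by rewrite ler_wpM2l.
  have : M%:R <= M%:R * M%:R :> R by rewrite ler_peMl.
  by rewrite mulrDl mul1r; lra.
have h1 := Df_exchT_le q hT.
have b0 := degload_ge0 M q z.
have h2 : `|Df q exchT z| <= 16 * M%:R * degload M q z.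
  by apply: (le_trans h1); rewrite ler_wpM2l// mulr_ge0.
rewrite -real_normK ?num_real//.
apply: (@le_trans _ _ ((16 * M%:R * degload M q z) ^+ 2)).
  by rewrite ler_pXn2r// nnegrE mulr_ge0// mulr_ge0.
have -> : (16 * M%:R * degload M q z) ^+ 2 = (256 * M%:R ^+ 2 * degload M q z) * degload M q z by ring.
have -> : 1792 * M%:R ^+ 4 * degload M q z = (256 * M%:R ^+ 2 * degload M q z) * (7 * M%:R ^+ 2) by ring.
apply: ler_wpM2l; last exact: hb.
apply: mulr_ge0; last exact: b0.
exact: mulr_ge0 (ler0n _ _) (exprn_ge0 _ (ler0n _ _)).
Qed.

(* [2 ^ outdeg] and [2 ^ indeg]: exponential moments that bound the probability of large
   degrees. *)
Definition outprod q z : R := \prod_(r <- iota 0 (n + n)) (1 + (edge q r z)%:R).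
Definition inprod q z : R := \prod_(r <- iota 0 (n + n)) (1 + (edge r q z)%:R).

Lemma prod_pow2 (s : seq nat) (b : nat -> bool) :
  \prod_(r <- s) (1 + (b r)%:R) = 2 ^+ (\sum_(r <- s) b r)%N :> R.
Proof.
elim: s => [|r s ih]; first by rewrite !big_nil.
by rewrite !big_cons ih; case: (b r); rewrite /= ?addr0 ?mul1r// exprS.
Qed.

Lemma pow2_gt (b : nat -> bool) (M : nat) : M%:R < sum2 (fun r => (b r)%:R) ->
  1 <= 2^-1 ^+ M * \prod_(r <- iota 0 (n + n)) (1 + (b r)%:R) :> R.
Proof.
rewrite sum2E prod_pow2 -natr_sum ltr_nat => h.
have -> : (\sum_(r <- iota 0 (n + n)) b r = \sum_(q < n + n) b q)%N.
  by rewrite (_ : iota 0 (n + n) = index_iota 0 (n + n)) ?big_mkord// /index_iota subn0.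
rewrite exprVn ler_pdivlMl ?exprn_gt0// mulr1.
by rewrite ler_eXn2l ?ltr1n// ltnW.
Qed.

Lemma nrecords_le z : 0 <= nrecords n z <= n%:R.
Proof.
rewrite sumr_ge0//=; last by move=> k _; rewrite record_bool.
apply: (@le_trans _ _ (\sum_(k < n) 1)); last by rewrite sumr_const card_ord.
by apply: ler_sum => k _; rewrite record_bool lern1 leq_b1.
Qed.

Lemma Df_nrecords_crude i z : `|Df i (nrecords n) z| <= n%:R.
Proof.
rewrite /dropdiff; have := nrecords_le z; have := nrecords_le (update z i e0).
move=> /andP[? ?] /andP[? ?]; rewrite ler_norml; apply/andP; split; lra.
Qed.

Lemma exchT_crude z : `|exchT z| <= 2 * n%:R ^+ 3.
Proof.
apply: (le_trans (ler_norm_sum _ _ _)).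
apply: (@le_trans _ _ (\sum_(i < n) n%:R * (2 * n%:R))).
  apply: ler_sum => i _; rewrite normrM; apply: ler_pM => //; first exact: Df_nrecords_crude.
  apply: (le_trans (ler_normB _ _)).
  by have := Df_nrecords_crude i (relabel (swap_first n i) z); have := Df_nrecords_crude i (relabel (swap_first n i.+1) z);
     rewrite /Dswap; lra.
rewrite sumr_const card_ord -[leLHS]mulr_natl; apply: eq_ler; ring.
Qed.

(** If some degree exceeds [M], the crude bound [(4 * n^3)^2] applies, multiplied by a sum of terms
    [2^(deg - M)] that is then at least 1. The bad event is thus handled pointwise, without
    splitting the expectation. *)
Lemma exchT_pointwise q z (M : nat) : (1 <= M)%N -> (q < n + n)%N ->
  Df q exchT z ^+ 2 <= 1792 * M%:R ^+ 4 * degload M q z +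
   16 * n%:R ^+ 6 * \sum_(k < n + n) 2^-1 ^+ M * (outprod k z + inprod k z).
Proof.
move=> M1 qn.
have n6 : 0 <= 16 * n%:R ^+ 6 :> R := mulr_ge0 (ler0n _ _) (exprn_ge0 _ (ler0n _ _)).
have f0 : 0 <= 1792 * M%:R ^+ 4 * degload M q z :=
  mulr_ge0 (mulr_ge0 (ler0n _ _) (exprn_ge0 _ (ler0n _ _))) (degload_ge0 M q z).
have crude : Df q exchT z ^+ 2 <= 16 * n%:R ^+ 6.
  have -> : 16 * n%:R ^+ 6 = (4 * n%:R ^+ 3) ^+ 2 :> R by ring.
  have h : `|Df q exchT z| <= 4 * n%:R ^+ 3.
    apply: (le_trans (ler_normB _ _)).
    by have := exchT_crude z; have := exchT_crude (update z q e0); lra.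
  by rewrite -real_normK ?num_real// lerXn2r// nnegrE (le_trans _ h).
have gc := @Df_exchT_sqr_good q z M M1 qn.
move: (1792 * M%:R ^+ 4 * degload M q z) (16 * n%:R ^+ 6) gc crude f0 n6 => A B gc crude f0 n6.
have P0 (b : nat -> bool) : 0 <= \prod_(r <- iota 0 (n + n)) (1 + (b r)%:R) :> R.
  by apply: prodr_ge0 => r _; rewrite addr_ge0.
have m0 : 0 <= (2^-1 : R) ^+ M by rewrite exprn_ge0// invr_ge0.
have u0 k : 0 <= 2^-1 ^+ M * outprod k z := mulr_ge0 m0 (P0 _).
have d0 k : 0 <= 2^-1 ^+ M * inprod k z := mulr_ge0 m0 (P0 _).
have pk k : 0 <= 2^-1 ^+ M * (outprod k z + inprod k z) by rewrite mulrDr addr_ge0.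
have s0 : 0 <= \sum_(k < n + n) 2^-1 ^+ M * (outprod k z + inprod k z) by apply: sumr_ge0.
have [good|] := pselect (forall k, (k < n + n)%N -> outdeg k z <= M%:R /\ indeg k z <= M%:R).
  by apply: (le_trans (gc good)); rewrite lerDl mulr_ge0.
move=> /existsNP[k /not_implyP[kn bad]].
have s1 : 1 <= \sum_(k < n + n) 2^-1 ^+ M * (outprod k z + inprod k z).
  rewrite (bigD1 (Ordinal kn))//=; apply: ler_wpDr; first by apply: sumr_ge0 => j _.
  rewrite mulrDr; have := u0 k; have := d0 k.
  have [hu|hu] := leP (outdeg k z) M%:R; last by have := pow2_gt hu; rewrite -/(outprod k z); lra.
  have [hd|hd] := leP (indeg k z) M%:R; last by have := pow2_gt hd; rewrite -/(inprod k z); lra.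
  by case: bad.
apply: (le_trans crude); apply: ler_wpDl => //.
by rewrite ler_peMr.
Qed.

Lemma bmeas_edge q r : bmeas (fun z : Om => (edge q r z)%:R : R).
Proof.
rewrite (_ : (fun z => _) = fun z : Om => (time r < time q)%N%:R * ((theta (time q) (z q))%:R * (prec (z q) (z r))%:R)); last first.
  by apply/funext => z; rewrite -!natrM !mulnb.
apply: bmeasM; first exact: bmeas_cst.
apply: bmeasM; last exact: bmeas_prec.
exact: (bmeas_coordb q (mtheta (time q))).
Qed.

Lemma bmeas_sum2 (f : nat -> Om -> R) : (forall k, bmeas (f k)) -> bmeas (fun z => sum2 (fun k => f k z)).
Proof. by move=> bf; apply: bmeas_sum => k _; apply: bmeasD. Qed.

Lemma Ex_sum2 (f : nat -> Om -> R) : (forall k, bmeas (f k)) ->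
  Ex (fun z => sum2 (fun k => f k z)) = sum2 (fun k => Ex (f k)).
Proof.
move=> bf; rewrite sum2E -(Ex_sum Q)//; congr (expct Q); apply/funext => z.
by rewrite sum2E.
Qed.

Lemma bmeas_outdeg q : bmeas (outdeg q). Proof. by apply: bmeas_sum2 => r; exact: bmeas_edge. Qed.
Lemma bmeas_indeg q : bmeas (indeg q). Proof. by apply: bmeas_sum2 => r; exact: bmeas_edge. Qed.

Lemma bmeas_Dbound i : bmeas (Dbound i).
Proof.
by apply: bmeasD; (apply: bmeasD; [exact: (bmeas_coordb _ (mtheta i))|exact: bmeas_indeg]).
Qed.

Lemma bmeas_degload M q : bmeas (degload M q).
Proof.
apply: bmeasD; last exact: bmeas_Dbound.
by apply: bmeasD; [exact: bmeas_outdeg|apply: bmeasM; [exact: bmeas_cst|exact: bmeas_indeg]].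
Qed.

Lemma bmeas_Dswap j i : bmeas (Dswap j i).
Proof. exact: (bmeas_relabel (swap_first n j) (bmeas_Df e0 i (bmeas_nrecords n))). Qed.

Lemma bmeas_exchT : bmeas exchT.
Proof.
apply: bmeas_sum => i _; apply: bmeasM; first by apply: bmeas_Df; exact: bmeas_nrecords.
by apply: bmeasB; exact: bmeas_Dswap.
Qed.

Lemma dep_exchT : dep_below (n + n) exchT.
Proof.
move=> z z' h; apply: eq_bigr => -[i /= iN] _.
have dD := dep_Df i (@dep_nrecords n).
rewrite (dD z z'); last by move=> m mn; apply: h; rewrite ltn_addr.
congr (_ * (_ - _)); apply: dD => m mn; rewrite /relabel; apply: h.
  by rewrite /swap_first; case: ifP => _; [rewrite ltn_add2r|case: ifP => _; lia].
by rewrite /swap_first; case: ifP => _; [rewrite ltn_add2r|case: ifP => _; lia].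
Qed.

(** Each factor is integrated at its own coordinate, of which the others are free, and
    [1 + x <= exp x]. *)
Lemma prod_exp (s : seq nat) (G : nat -> Om -> R) (x : nat -> R) : uniq s ->
  (forall r, bmeas (G r)) -> (forall r z, 0 <= G r z) ->
  (forall r r', r \in s -> r' \in s -> r != r' -> free_of r (G r')) ->
  (forall r z', r \in s -> Ex (fun z => G r (update z' r (z r))) <= 1 + x r) ->
  Ex (fun z => \prod_(r <- s) G r z) <= expR (\sum_(r <- s) x r).
Proof.
elim: s => [|r s ih] /=.
  move=> _ _ _ _ _; rewrite big_nil expR0 -[leRHS](Ex_cst Q); apply: eq_ler.
  by congr (expct Q); apply/funext => z; rewrite big_nil.
move=> /andP[rs us] bG G0 nG hx.
rewrite big_cons expRD.
rewrite (_ : (fun z => _) = fun z => (\prod_(j <- s) G j z) * G r z); last first.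
  by apply/funext => z; rewrite big_cons mulrC.
have P0 z : 0 <= \prod_(j <- s) G j z by apply: prodr_ge0.
have bP : bmeas (fun z => \prod_(j <- s) G j z) by apply: bmeas_prod.
apply: (le_trans (Ex_coord_le_cst (k := r) (b := 1 + x r) Qind bP (bG r) P0 _ _)).
- move=> z y; apply: eq_big_seq => j js; apply: nG; rewrite ?inE ?eqxx ?js ?orbT//.
  by apply: contraNneq rs => ->.
- by move=> z'; apply: hx; rewrite inE eqxx.
- have h0 : 0 <= Ex (fun z => \prod_(j <- s) G j z) by apply: Ex_ge0.
  apply: (@le_trans _ _ (expR (x r) * Ex (fun z => \prod_(j <- s) G j z))).
    by rewrite ler_wpM2r// expR_ge1Dx.
  rewrite ler_wpM2l ?expR_ge0//; apply: ih => //.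
  + by move=> a b as_ bs; apply: nG; rewrite inE ?as_ ?bs orbT.
  + by move=> a z' as_; apply: hx; rewrite inE as_ orbT.
Qed.

(** * Exponential moments of the degrees and the expected number of edges *)

Variable L : R.
Hypothesis L1 : 1 <= L.
Hypothesis thetaL : forall k x, theta k x -> k.+1%:R * v x <= L.

Let HN : R := \sum_(k < n) k.+1%:R^-1.

Lemma iota_sum (f : nat -> R) : \sum_(r <- iota 0 (n + n)) f r = sum2 f.
Proof.
by rewrite sum2E (_ : iota 0 (n + n) = index_iota 0 (n + n)) ?big_mkord// /index_iota subn0.
Qed.

Lemma time_small k : (k < n)%N -> time k = k.
Proof. by rewrite /time => ->. Qed.

Lemma time_big k : time (n + k) = k.
Proof. by rewrite /time ltnNge leq_addr/= addKn. Qed.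

Lemma sum2_time (f : nat -> R) : sum2 (fun q => f (time q)) = 2 * \sum_(k < n) f k.
Proof.
rewrite /sum2 mulr_sumr; apply: eq_bigr => -[k /= kn] _.
by rewrite /fold2 time_small// time_big; ring.
Qed.

Lemma sum_ltn_le t : \sum_(k < n) (k < t)%N%:R <= t%:R :> R.
Proof.
have h m : (\sum_(k < m) (k < t) = minn m t)%N.
  elim: m => [|m ih]; first by rewrite big_ord0 min0n.
  by rewrite big_ord_recr /= ih; case: ltnP; lia.
by rewrite -natr_sum h ler_nat geq_minr.
Qed.

Lemma iota_filter_sum (f : nat -> R) (p : pred nat) :
  \sum_(r <- [seq r <- iota 0 (n + n) | p r]) f r = sum2 (fun r => (p r)%:R * f r).
Proof.
rewrite big_filter big_mkcond -iota_sum; apply: eq_bigr => r _.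
by case: (p r); rewrite ?mul1r ?mul0r.
Qed.

Lemma iota_filter_prod (b p : pred nat) : (forall r, b r -> p r) ->
  \prod_(r <- iota 0 (n + n)) (1 + (b r)%:R) =
  \prod_(r <- [seq r <- iota 0 (n + n) | p r]) (1 + (b r)%:R) :> R.
Proof.
move=> bp; rewrite big_filter [RHS]big_mkcond; apply: eq_bigr => r _.
by case: (boolP (p r)) => // /negP pr'; case: (boolP (b r)) => [/bp//|_]; rewrite addr0.
Qed.

Lemma Lk0 k : 0 <= L / k.+1%:R.
Proof. by rewrite divr_ge0//; have := L1; lra. Qed.

Lemma theta_v k x : theta k x -> v x <= L / k.+1%:R.
Proof. by move=> /thetaL; rewrite ler_pdivlMr// mulrC. Qed.

(** By truncation, each of the at most [2 * k] points of earlier time dominates a counted point at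
    time [k] with probability at most [L / (k + 1)]. Restricting the product to earlier times keeps
    [q] itself out of the coordinates integrated. *)
Lemma Ex_outprod q : Ex (outprod q) <= expR (2 * L).
Proof.
pose p r := (time r < time q)%N.
have h := @prod_exp [seq r <- iota 0 (n + n) | p r] (fun r z => 1 + (edge q r z)%:R) (fun=> L / (time q).+1%:R).
rewrite (_ : outprod q = fun z => \prod_(r <- [seq r <- iota 0 (n + n) | p r]) (1 + (edge q r z)%:R)); last first.
  by apply/funext => z; rewrite /outprod (iota_filter_prod (p := p))// => r /and3P[].
apply: (le_trans (h _ _ _ _ _)).
- by rewrite filter_uniq// iota_uniq.
- by move=> r; apply: bmeasD; [exact: bmeas_cst|exact: bmeas_edge].
- by move=> r z; rewrite addr_ge0.
- move=> r r'; rewrite !mem_filter /p => /andP[rq _] _ rr z y.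
  by rewrite /edge !update_other// ?[r' == r]eq_sym//; apply: contraTneq rq => ->; rewrite ltnn.
- move=> r z'; rewrite mem_filter /p => /andP[rq _].
  have qr : q != r by apply: contraTneq rq => ->; rewrite ltnn.
  have bz : bmeas (fun z : Om => (theta (time q) (z' q))%:R * (prec (z' q) (z r))%:R : R).
    apply: bmeasM; first exact: bmeas_cst.
    by apply: (bmeas_coordb (b := fun x => prec (z' q) x)); apply: mprec => //; exact: measurable_cst.
  rewrite (_ : (fun z => _) = fun z => 1 + (theta (time q) (z' q))%:R * (prec (z' q) (z r))%:R); last first.
    by apply/funext => z; rewrite /edge rq update_same update_other//= -natrM mulnb.
  rewrite ExD ?Ex_cst//; last exact: bmeas_cst.
  rewrite lerD2l; case: (boolP (theta (time q) (z' q))) => h'; last first.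
    rewrite (_ : (fun z => _) = fun=> 0) ?Ex_cst ?Lk0//.
    by apply/funext => z; rewrite mul0r.
  rewrite (_ : (fun z => _) = fun z => (prec (z' q) (z r))%:R); last first.
    by apply/funext => z; rewrite mul1r.
  by rewrite Ex_prec_up; [exact: theta_v|exact: thetaS h'].
rewrite ler_expR iota_filter_sum (_ : sum2 _ = (L / (time q).+1%:R) * sum2 (fun r => (time r < time q)%N%:R)); last first.
  by rewrite -sum2_pull /sum2 /fold2; apply: eq_bigr => r _; rewrite /p; ring.
rewrite (sum2_time (fun k => (k < time q)%N%:R)) mulrCA ler_wpM2l//.
rewrite mulrAC ler_pdivrMr// ler_wpM2l//; first by have := L1; lra.
by apply: (le_trans (sum_ltn_le _)); rewrite ler_nat.
Qed.

(** A later counted point at time [k] has [v <= L / (k + 1)], so by [Ex_prec_down] it lies below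
    point [q] with probability at most [L / (k + 1)]. Summed over all times this is harmonic, which
    costs a further logarithm in the exponent. *)
Lemma Ex_inprod q : Ex (inprod q) <= expR (2 * L * HN).
Proof.
pose p r := (time q < time r)%N.
have h := @prod_exp [seq r <- iota 0 (n + n) | p r] (fun r z => 1 + (edge r q z)%:R) (fun r => L / (time r).+1%:R).
rewrite (_ : inprod q = fun z => \prod_(r <- [seq r <- iota 0 (n + n) | p r]) (1 + (edge r q z)%:R)); last first.
  by apply/funext => z; rewrite /inprod (iota_filter_prod (p := p))// => r /and3P[].
apply: (le_trans (h _ _ _ _ _)).
- by rewrite filter_uniq// iota_uniq.
- by move=> r; apply: bmeasD; [exact: bmeas_cst|exact: bmeas_edge].
- by move=> r z; rewrite addr_ge0.
- move=> r r'; rewrite !mem_filter /p => /andP[rq _] _ rr z y.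
  by rewrite /edge !update_other// ?[r' == r]eq_sym//; apply: contraTneq rq => ->; rewrite ltnn.
- move=> r z'; rewrite mem_filter /p => /andP[rq _].
  have qr : q != r by apply: contraTneq rq => ->; rewrite ltnn.
  have L0 : 0 < L / (time r).+1%:R by rewrite divr_gt0//; have := L1; lra.
  have mb : measurable [set x | prec x (z' q) && (v x <= L / (time r).+1%:R)].
    by apply: measurable_setb_and; [exact: measurable_prec1|exact: measurable_vle].
  apply: (@le_trans _ _ (Ex (fun z => 1 + (prec (z r) (z' q) && (v (z r) <= L / (time r).+1%:R))%:R))).
    apply: Ex_le.
    - apply: bmeasD; first exact: bmeas_cst.
      rewrite (_ : (fun z => _) = fun z => (theta (time r) (z r) && prec (z r) (z' q))%:R); last first.
        by apply/funext => z; rewrite /edge rq update_same update_other.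
      apply: (bmeas_coordb (b := fun x => theta (time r) x && prec x (z' q))).
      by apply: measurable_setb_and => //; exact: measurable_prec1.
    - by apply: bmeasD; [exact: bmeas_cst|exact: (bmeas_coordb r mb)].
    - move=> z; rewrite lerD2l ler_nat /edge rq update_same update_other//=.
      case: (boolP (theta _ _)) => //= /theta_v ->; rewrite andbT; exact: leqnn.
  rewrite ExD ?Ex_cst; [|exact: bmeas_cst|exact: (bmeas_coordb r mb)].
  by rewrite lerD2l; exact: Ex_prec_down.
rewrite ler_expR iota_filter_sum.
apply: (@le_trans _ _ (sum2 (fun r => L / (time r).+1%:R))).
  by apply: sum2_le => r; rewrite ler_piMl ?Lk0// lern1 leq_b1.
by rewrite (sum2_time (fun k => L / k.+1%:R)) -mulr_sumr mulrA.
Qed.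

Definition mean_theta q : R := Ex (fun z => (theta (time q) (z q))%:R).

Lemma Ex_edge q r : Ex (fun z => (edge q r z)%:R) <= (time r < time q)%N%:R * (L / (time q).+1%:R * mean_theta q).
Proof.
have bt := bmeas_coordb q (mtheta (time q)).
have bw := bmeas_escape q; have bP := bmeas_prec q r.
case: (ltnP (time r) (time q)) => rq; last first.
  rewrite mul0r (_ : (fun z => _) = fun=> 0) ?Ex_cst//.
  by apply/funext => z; rewrite /edge ltnNge rq.
have rq' : r != q by apply: contraTneq rq => ->; rewrite ltnn.
rewrite mul1r (_ : (fun z => _) = fun z => (theta (time q) (z q))%:R * (prec (z q) (z r))%:R); last first.
  by apply/funext => z; rewrite /edge rq -natrM mulnb.
apply: (le_trans (Ex_prec_out rq' _ _ _)) => //.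
  by move=> z y; rewrite update_other// eq_sym.
rewrite /mean_theta -ExZ//; apply: Ex_le; [by bmt|by bmt|move=> z].
case: (boolP (theta _ _)) => [t|_]; last by rewrite mul0r mulr0.
by rewrite mul1r mulr1 /escape (thetaS t) subKr; exact: theta_v.
Qed.

Lemma mean_theta_ge0 q : 0 <= mean_theta q. Proof. exact: Ex_ge0. Qed.

(** A counted point has expected out-degree at most [2 * L], so edges outnumber counted points by at
    most a logarithm. *)
Lemma sum2_edge_le : sum2 (fun q => Ex (outdeg q)) <= 2 * L * sum2 mean_theta.
Proof.
rewrite -sum2_pull; apply: sum2_le => q.
rewrite /outdeg Ex_sum2; last by move=> r; exact: bmeas_edge.
apply: (@le_trans _ _ (sum2 (fun r => (L / (time q).+1%:R * mean_theta q) * (time r < time q)%N%:R))).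
  by apply: sum2_le => r; rewrite mulrC; exact: Ex_edge.
rewrite sum2_pull (sum2_time (fun k => (k < time q)%N%:R)).
have h : (\sum_(k < n) (k < time q)%N%:R) / (time q).+1%:R <= 1 :> R.
  by rewrite ler_pdivrMr// mul1r; apply: (le_trans (sum_ltn_le _)); rewrite ler_nat.
have t0 := mean_theta_ge0 q; have L0 : 0 <= L by have := L1; lra.
have -> : L / (time q).+1%:R * mean_theta q * (2 * \sum_(k < n) (k < time q)%N%:R) =
  (2 * L * mean_theta q) * ((\sum_(k < n) (k < time q)%N%:R) / (time q).+1%:R) by ring.
by rewrite ler_piMr// !mulr_ge0.
Qed.

Lemma sum2_outdeg_indeg z : sum2 (fun q => indeg q z) = sum2 (fun q => outdeg q z).
Proof. by rewrite /indeg /outdeg sum2_exchange. Qed.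

Lemma sum2_mean_theta : sum2 mean_theta <= 4 * dd%:R * L * n%:R `^ (1 - alpha).
Proof.
have L0 : 0 <= L by have := L1; lra.
have hth q : mean_theta q <= dd%:R * L * (time q).+1%:R `^ (- alpha).
  apply: (@le_trans _ _ (Ex (fun z => (inS (z q) && (v (z q) <= L / (time q).+1%:R))%:R))).
    apply: Ex_le.
    - exact: (bmeas_coordb q (mtheta (time q))).
    - apply: (bmeas_coordb (b := fun x => inS x && (v x <= L / (time q).+1%:R))).
      by apply: measurable_setb_and => //; exact: measurable_vle.
    - move=> z; rewrite ler_nat; case: (boolP (theta _ _)) => // t.
      by rewrite (thetaS t) (theta_v t).
  apply: (le_trans (Ex_low_le _ (Lk0 _))).
  have -> : (L / (time q).+1%:R) `^ alpha = L `^ alpha * (time q).+1%:R `^ (- alpha).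
    by rewrite powRM ?invr_ge0// -[_.+1%:R^-1]powR_inv1// -powRrM mulN1r.
  rewrite -mulrA ler_wpM2l// ler_wpM2r ?powR_ge0//.
  by rewrite -[leRHS]powRr1//; apply: ler_powR => //; have /andP[] := alpha01.
apply: (le_trans (sum2_le hth)); rewrite sum2_pull (sum2_time (fun k => k.+1%:R `^ (- alpha))).
have a12 : 0 < alpha <= 2^-1.
  have /andP[-> _] := alpha01; rewrite /= lef_pV2 ?posrE ?ltr0n ?ler_nat//; lia.
have -> : 4 * dd%:R * L * n%:R `^ (1 - alpha) = (dd%:R * L) * (2 * (2 * n%:R `^ (1 - alpha))) by ring.
by rewrite ler_wpM2l ?mulr_ge0// ler_wpM2l//; exact: sum_powRN_le.
Qed.

(** Out-degrees and in-degrees have the same total. With [t] the expected number of counted points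
    and [u <= 2 * L * t] that of edges, the sum is [(M + 4) * u + 2 * t]. *)
Lemma sum2_degload (M : nat) : (1 <= M)%N -> sum2 (fun q => Ex (degload M q)) <= 12 * M%:R * L * sum2 mean_theta.
Proof.
move=> M1; have M1' : 1 <= M%:R :> R by rewrite ler1n.
have bu := bmeas_outdeg; have bd := bmeas_indeg; have bT := bmeas_Dbound.
have E1 q : Ex (degload M q) = Ex (outdeg q) + M.+1%:R * Ex (indeg q) + Ex (Dbound (time q)).
  rewrite /degload ExD; [|apply: bmeasD; [exact: bmeas_outdeg|apply: bmeasM; [exact: bmeas_cst|exact: bmeas_indeg]]|exact: bmeas_Dbound].
  by rewrite ExD; [rewrite ExZ//|exact: bmeas_outdeg|apply: bmeasM; [exact: bmeas_cst|exact: bmeas_indeg]].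
have -> : sum2 (fun q => Ex (degload M q)) = sum2 (fun q => Ex (outdeg q)) + M.+1%:R * sum2 (fun q => Ex (indeg q)) +
    sum2 (fun q => Ex (Dbound (time q))).
  by rewrite -sum2_pull -!sum2D; congr sum2; apply/funext => q; rewrite E1.
have -> : sum2 (fun q => Ex (indeg q)) = sum2 (fun q => Ex (outdeg q)).
  rewrite -!Ex_sum2//; congr (expct Q); apply/funext => z; exact: sum2_outdeg_indeg.
have -> : sum2 (fun q => Ex (Dbound (time q))) = 2 * (sum2 mean_theta + sum2 (fun q => Ex (outdeg q))).
  rewrite (sum2_time (fun i => Ex (Dbound i))); congr (_ * _).
  have bt i q : bmeas (fun z : Om => (theta i (z q))%:R : R) by exact: (bmeas_coordb q (mtheta i)).
  have -> : sum2 (fun q => Ex (outdeg q)) = sum2 (fun q => Ex (indeg q)).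
    rewrite -!Ex_sum2//; congr (expct Q); apply/funext => z; apply/esym; exact: sum2_outdeg_indeg.
  rewrite -sum2D /sum2; apply: eq_bigr => -[i /= iN] _; rewrite /Dbound /fold2 /mean_theta.
  rewrite time_small// time_big ExD; [|by apply: bmeasD|by apply: bmeasD].
  by rewrite ExD// ExD.
have hu := sum2_edge_le; set u := sum2 (fun q => Ex (outdeg q)) in hu *.
have u0 : 0 <= u by apply: sum2_ge0 => q; apply: Ex_ge0 => z; exact: outdeg_ge0.
have t0 : 0 <= sum2 mean_theta by apply: sum2_ge0 => q; exact: mean_theta_ge0.
set t := sum2 mean_theta in hu t0 *.
rewrite -natr1 mulrDl mul1r.
have h1 : t <= L * t by rewrite ler_peMl.
have Lt : 0 <= L * t by rewrite mulr_ge0//; have := L1; lra.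
have h2 : L * t <= M%:R * (L * t) by rewrite ler_peMl.
have h3 : M%:R * u <= M%:R * (2 * (L * t)) by rewrite ler_wpM2l// mulrA.
have -> : 12 * M%:R * L * t = 12 * (M%:R * (L * t)) by ring.
by move: hu; rewrite -mulrA; lra.
Qed.

(** Efron-Stein over the [2 * n] coordinates on which [exchT] depends. The last term is the bad
    event: [256 * n^8] collects the crude bound, the sum over deleted points and the union over
    degrees. *)
Theorem exchT_variance (M : nat) : (1 <= M)%N -> (0 < n)%N ->
  Ex (fun z => exchT z ^+ 2) - Ex exchT ^+ 2 <=
  2 * (1792 * M%:R ^+ 4 * (12 * M%:R * L * (4 * dd%:R * L * n%:R `^ (1 - alpha)))) +
  256 * n%:R ^+ 8 * 2^-1 ^+ M * expR (2 * L * HN).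
Proof.
move=> M1 n0; have M1' : 1 <= M%:R :> R by rewrite ler1n.
have L0 : 0 <= L by have := L1; lra.
have HN1 : 1 <= HN.
  rewrite /HN (bigD1 (Ordinal n0))//= invr1 lerDl; apply: sumr_ge0 => k _.
  by rewrite invr_ge0.
apply: (le_trans (efron_stein Qind e0 bmeas_exchT (@dep_exchT))).
have bP2u k : bmeas (outprod k) by apply: bmeas_prod => r _; apply: bmeasD; [exact: bmeas_cst|exact: bmeas_edge].
have bP2d k : bmeas (inprod k) by apply: bmeas_prod => r _; apply: bmeasD; [exact: bmeas_cst|exact: bmeas_edge].
have bbr q := bmeas_degload M q.
have bad : Ex (fun z => \sum_(k < n + n) 2^-1 ^+ M * (outprod k z + inprod k z)) <=
   4 * n%:R * (2^-1 ^+ M * expR (2 * L * HN)).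
  rewrite (Ex_sum Q); last by move=> k _; apply: bmeasM; [exact: bmeas_cst|apply: bmeasD].
  apply: (@le_trans _ _ (\sum_(k < n + n) 2 * (2^-1 ^+ M * expR (2 * L * HN)))).
    apply: ler_sum => k _; rewrite ExZ; last by apply: bmeasD.
    rewrite mulrCA ler_wpM2l ?exprn_ge0 ?invr_ge0// ExD//.
    have h1 := Ex_outprod k; have h2 := Ex_inprod k.
    have : expR (2 * L) <= expR (2 * L * HN) by rewrite ler_expR ler_peMr// mulr_ge0.
    by lra.
  rewrite sumr_const card_ord -[leLHS]mulr_natl natrD.
  by apply: eq_ler; ring.
have one q : (q < n + n)%N -> Ex (fun z => Df q exchT z ^+ 2) <= 1792 * M%:R ^+ 4 * Ex (degload M q) +
   16 * n%:R ^+ 6 * (4 * n%:R * (2^-1 ^+ M * expR (2 * L * HN))).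
  move=> qn.
  have bs : bmeas (fun z => \sum_(k < n + n) 2^-1 ^+ M * (outprod k z + inprod k z)).
    by apply: bmeas_sum => k _; apply: bmeasM; [exact: bmeas_cst|apply: bmeasD].
  apply: (@le_trans _ _ (Ex (fun z => 1792 * M%:R ^+ 4 * degload M q z +
      16 * n%:R ^+ 6 * \sum_(k < n + n) 2^-1 ^+ M * (outprod k z + inprod k z)))).
    apply: Ex_le.
    - by apply: bmeasX; apply: bmeas_Df; exact: bmeas_exchT.
    - by apply: bmeasD; apply: bmeasM => //; exact: bmeas_cst.
    - by move=> z; exact: exchT_pointwise.
  rewrite ExD; [|by apply: bmeasM => //; exact: bmeas_cst|by apply: bmeasM => //; exact: bmeas_cst].
  by rewrite !ExZ// lerD2l ler_wpM2l// mulr_ge0// exprn_ge0.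
apply: (@le_trans _ _ (2 * (\sum_(q < n + n) (1792 * M%:R ^+ 4 * Ex (degload M q) +
   16 * n%:R ^+ 6 * (4 * n%:R * (2^-1 ^+ M * expR (2 * L * HN))))))).
  by rewrite ler_wpM2l//; apply: ler_sum => -[q /= qn] _; exact: one.
rewrite big_split/= -mulr_sumr -(sum2E (fun q => Ex (degload M q))) sumr_const card_ord.
have hb := sum2_degload M1; have ht := sum2_mean_theta.
have h1 : 1792 * M%:R ^+ 4 * sum2 (fun q => Ex (degload M q)) <=
    1792 * M%:R ^+ 4 * (12 * M%:R * L * (4 * dd%:R * L * n%:R `^ (1 - alpha))).
  apply: ler_wpM2l; first exact: (mulr_ge0 (ler0n _ _) (exprn_ge0 _ (ler0n _ _))).
  apply: (le_trans hb); apply: ler_wpM2l ht.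
  exact: (mulr_ge0 (mulr_ge0 (ler0n _ _) (ler0n _ _)) L0).
rewrite mulrDr; apply: lerD.
  exact: (ler_wpM2l (ler0n _ _) h1).
rewrite -[X in 2 * X]mulr_natl natrD; apply: eq_ler; ring.
Qed.

End exchT.

End Theta.

Notation full := (fun (_ : nat) (x : E) => inS x).

(** * Cost of discarding records with a large dominance probability *)

Section Truncation.
Variable L : R.
Hypothesis L1 : 1 <= L.

Definition crit k (x : E) : bool := inS x && (k.+1%:R * v x <= L).
Notation g0 := (nrecords full).
Notation g := (nrecords crit).

Lemma measurable_scaled_vle (c t : R) : measurable [set x | c * v x <= t].
Proof.
rewrite -[X in measurable X]setTI.
exact: (measurable_fun_ler (measurable_funM (measurable_cst c) mv) (measurable_cst t)).
Qed.

Lemma measurable_crit k : measurable [set x | crit k x].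
Proof. by apply: measurable_setb_and => //; exact: measurable_scaled_vle. Qed.

Lemma measurable_full (k : nat) : measurable [set x | full k x].
Proof. exact: minS. Qed.

Lemma critS k x : crit k x -> inS x. Proof. by case/andP. Qed.

(** A discarded point escapes its [k] predecessors with probability at most [exp(- k * v)], and
    [(k + 1) * v > L] gives [k * v > L / 2]; the case [k = 0] is excluded by [v <= 1 <= L]. *)
Lemma Ex_record_trunc k : Ex (fun z => record full k z - record crit k z) <= expR (- (L / 2)).
Proof.
pose F (z : Om) : R := (inS (z k) && ~~ (k.+1%:R * v (z k) <= L))%:R.
have bF : bmeas F.
  apply: (@bmeas_coordb (fun x => inS x && ~~ (k.+1%:R * v x <= L))).
  apply: measurable_setb_and => //; rewrite (_ : [set x | _] = ~` [set x | k.+1%:R * v x <= L]).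
    exact/measurableC/measurable_scaled_vle.
  by apply/seteqP; split => x /= /negP.
have -> : (fun z => record full k z - record crit k z) =
   (fun z => F z * (inS (z k))%:R * \prod_(i <- iota 0 k) (~~ prec (z k) (z i))%:R).
  apply/funext => z; rewrite /record /F /crit -mulrBl; congr (_ * _).
  by case: (inS _); case: (_ <= _); rewrite /= ?mulr1 ?mulr0 ?subrr ?subr0.
have kI : k \notin iota 0 k by rewrite mem_iota add0n ltnn andbF.
have F0 z : 0 <= F z by rewrite /F ler0n.
have nF i : i \in iota 0 k -> free_of i F.
  by rewrite mem_iota add0n => /andP[_ ik] z y; rewrite /F update_other// gt_eqF.
apply: (le_trans (Ex_prod_nprec_le bF F0 kI (iota_uniq 0 k) nF)).
rewrite size_iota -[leRHS](Ex_cst Q); apply: Ex_le; last 1 first.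
- move=> z; rewrite /F /escape; case: ifPn => zS; rewrite /= ?mul0r ?expR_ge0// mulr1.
  case: (leP (k.+1%:R * v (z k)) L) => h /=; rewrite ?mul0r ?expR_ge0// mul1r.
  have /andP[v0 v1] := v01 zS.
  have k1 : (1 <= k)%N.
    rewrite lt0n; apply/eqP => k0; move: h; rewrite {1}k0 mul1r => h.
    by have := lt_le_trans h v1; rewrite ltNge L1.
  apply: (@le_trans _ _ (expR (- v (z k)) ^+ k)).
    by rewrite lerXn2r ?nnegrE ?expR_ge0 ?subr_ge0//; exact: expR_ge1Dx.
  rewrite -expRM_natl ler_expR mulrN lerN2.
  have k2 : k.+1%:R <= 2 * k%:R :> R by rewrite -natrM ler_nat; lia.
  have := ler_wpM2r v0 k2; move: h; rewrite -mulrA; lra.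
- by apply: bmeasM; [apply: bmeasM => //; exact: bmeas_inS|apply: bmeasX; exact: bmeas_escape].
- exact: bmeas_cst.
Qed.

Lemma record_trunc k z : 0 <= record full k z - record crit k z.
Proof.
rewrite subr_ge0 !record_bool ler_nat; case: (boolP (crit k _)) => [/critS ->//|_].
by rewrite leq0n.
Qed.

(** Both counts are integers, so they agree or differ by at least 1. In [Ex_lt_trunc] this lets the
    expected difference bound the probability of disagreement. *)
Lemma nrecords_trunc n z : (0 <= g0 n z - g n z) && ((g0 n z == g n z) || (1 <= g0 n z - g n z)).
Proof.
have E1 th : nrecords th n z = (\sum_(k < n) (th k (z k) && all (fun i => ~~ prec (z k) (z i)) (iota 0 k)))%:R :> R.
  by rewrite natr_sum; apply: eq_bigr => k _; exact: record_bool.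
have h : 0 <= g0 n z - g n z.
  by rewrite /nrecords -sumrB; apply: sumr_ge0 => k _; exact: record_trunc.
rewrite h/=; move: h; rewrite subr_ge0 lerBrDr !E1 nat1r eqr_nat !ler_nat.
by rewrite eq_sym -leq_eqVlt.
Qed.

Lemma Ex_trunc n : 0 <= Ex (g0 n) - Ex (g n) <= n%:R * expR (- (L / 2)).
Proof.
have b0 k := bmeas_record measurable_full k.
have b1 k := bmeas_record measurable_crit k.
rewrite -ExB; [|exact: bmeas_nrecords measurable_full _|exact: bmeas_nrecords measurable_crit _].
apply/andP; split; first by apply: Ex_ge0 => z; have /andP[] := nrecords_trunc n z.
rewrite (_ : (fun z => _ - _) = (fun z => \sum_(k < n) (record full k z - record crit k z))); last first.
  by apply/funext => z; rewrite sumrB.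
rewrite Ex_sum; last by move=> k _; exact: bmeasB.
apply: (@le_trans _ _ (\sum_(k < n) expR (- (L / 2)))).
  by apply: ler_sum => k _; exact: Ex_record_trunc.
by rewrite sumr_const card_ord -[leLHS]mulr_natl.
Qed.

Lemma var_trunc n : `|(Ex (fun z => g0 n z ^+ 2) - Ex (g0 n) ^+ 2) -
    (Ex (fun z => g n z ^+ 2) - Ex (g n) ^+ 2)| <= 4 * n%:R * (n%:R * expR (- (L / 2))).
Proof.
have b0 := bmeas_nrecords measurable_full n.
have b1 := bmeas_nrecords measurable_crit n.
have b02 := bmeasX 2 b0; have b12 := bmeasX 2 b1.
have /andP[h0 h1] := Ex_trunc n; set D := n%:R * _ in h1 *.
have c0 th z := nrecords_le th n z.
have hE (th : nat -> E -> bool) : (forall k, measurable [set x | th k x]) -> 0 <= Ex (nrecords th n) <= n%:R.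
  move=> mth; have Dswap := bmeas_nrecords mth n; apply/andP; split.
    by apply: Ex_ge0 => z; have /andP[] := c0 th z.
  rewrite -[leRHS](Ex_cst Q); apply: Ex_le => //; first exact: bmeas_cst.
  by move=> z; have /andP[] := c0 th z.
have /andP[p0 p1] := hE _ measurable_full; have /andP[q0 q1] := hE _ measurable_crit.
have s0 : 0 <= Ex (fun z => g0 n z ^+ 2) - Ex (fun z => g n z ^+ 2) <= 2 * n%:R * D.
  rewrite -ExB//; apply/andP; split.
    apply: Ex_ge0 => z; rewrite subr_sqr mulr_ge0//; first by have /andP[] := nrecords_trunc n z.
    by rewrite addr_ge0//; [have /andP[] := c0 full z|have /andP[] := c0 crit z].
  apply: (@le_trans _ _ (2 * n%:R * (Ex (g0 n) - Ex (g n)))); last first.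
    by rewrite ler_wpM2l ?mulr_ge0.
  rewrite -ExB// -ExZ; last exact: bmeasB.
  apply: Ex_le.
  - exact: bmeasB.
  - by apply: bmeasM; [exact: bmeas_cst|exact: bmeasB].
  move=> z; rewrite subr_sqr mulrC ler_wpM2r//; first by have /andP[] := nrecords_trunc n z.
  have /andP[_ k1] := c0 full z; have /andP[_ k2] := c0 crit z.
  by rewrite mulr_natl mulr2n lerD.
have s1 : 0 <= Ex (g0 n) ^+ 2 - Ex (g n) ^+ 2 <= 2 * n%:R * D.
  rewrite subr_sqr; apply/andP; split; first by apply: mulr_ge0 => //; exact: addr_ge0.
  rewrite mulrC; apply: ler_pM => //; first exact: addr_ge0.
  by rewrite mulr_natl mulr2n lerD.
have -> : 4 * n%:R * D = 2 * n%:R * D + 2 * n%:R * D by ring.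
move: s0 s1; set a := 2 * n%:R * D.
move=> /andP[x1 x2] /andP[y1 y2]; rewrite ler_norml; apply/andP; split; lra.
Qed.

Lemma Ex_lt_trunc n (m s x : R) :
  `|Ex (fun z => ((g0 n z - m) / s < x)%R%:R) - Ex (fun z => ((g n z - m) / s < x)%R%:R)| <=
  n%:R * expR (- (L / 2)).
Proof.
have bI F : bmeas F -> bmeas (fun z => ((F z - m) / s < x)%R%:R : R).
  move=> bF; have bW : bmeas (fun z => (F z - m) / s).
    by apply: bmeasM; [apply: bmeasB => //; exact: bmeas_cst|exact: bmeas_cst].
  apply: bmeas_pred; have [mW _] := bW.
  by rewrite -[X in measurable X]setTI; apply: (measurable_fun_ltr mW (measurable_cst x)).
have b0 := bmeas_nrecords measurable_full n.
have b1 := bmeas_nrecords measurable_crit n.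
have /andP[_] := Ex_trunc n; apply: le_trans.
rewrite -!ExB//; [|exact: bI|exact: bI].
apply: (le_trans (Ex_abs Q (bmeasB (bI _ b0) (bI _ b1)))).
apply: Ex_le; [by apply/bmeas_abs/bmeasB; exact: bI|exact: bmeasB|].
move=> z; have /andP[h0 /orP[/eqP ->|h1]] := nrecords_trunc n z; first by rewrite !subrr normr0.
by apply: le_trans h1; case: (_ < x); case: (_ < x); rewrite /= ?subrr ?normr0 ?subr0 ?sub0r ?normrN ?normr1.
Qed.

End Truncation.

(** * Assembling the estimates at truncation level 20 log n *)

Notation variance F := (Ex (fun z => F z ^+ 2) - Ex F ^+ 2).

Lemma alpha_gt0 : 0 < alpha.
Proof. by rewrite invr_gt0 ltr0n (leq_trans _ dd2). Qed.

Lemma alpha_le_half : alpha <= 2^-1.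
Proof. by rewrite lef_pV2 ?posrE ?ltr0n ?(leq_trans _ dd2)// ler_nat. Qed.

(** Beyond the threshold [b] a record has probability at most [32 / 256 = 1/8], as [variance_lower]
    demands, and [n >= 2 * b + 256] places the whole last block beyond it. *)
Lemma variance_full_lower b n : 256 * dd%:R <= b%:R `^ alpha -> (2 * b + 256 <= n)%N ->
  n%:R `^ (1 - alpha) <= 256 ^+ 2 * variance (nrecords full n).
Proof.
move=> hb nN; have n256 : (256 <= n)%N by apply: leq_trans nN; rewrite leq_addl.
have a0 := alpha_gt0; have a2 := alpha_le_half.
have h8 i : (n - n %/ 256 <= i)%N -> 32 * dd%:R * i.+1%:R `^ (- alpha) <= 8^-1 :> R.
  move=> ni; have hi : (b <= i.+1)%N by move: ni nN; clear; lia.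
  have i0 : 0 < i.+1%:R `^ alpha :> R by apply: powR_gt0; rewrite ltr0n.
  have h : 256 * dd%:R <= i.+1%:R `^ alpha :> R.
    apply: (le_trans hb); apply: ge0_ler_powR; rewrite ?nnegrE ?(ltW a0)//.
    by rewrite ler_nat.
  rewrite powRN ler_pdivrMr//.
  by move: h; set u := i.+1%:R `^ alpha; lra.
have := variance_lower (theta := full) (fun k x h => h) (fun k => minS) n256 (fun k x _ h _ => h) h8.
move=> h; apply: (le_trans (powR_block_lower _ n256)); first by rewrite a0 (le_trans a2)//; lra.
exact: (ler_wpM2l (exprn_ge0 2 (ler0n _ 256)) h).
Qed.

Lemma exch_variance n (l : R) : 1 <= l -> (0 < n)%N -> n%:R = expR l ->
  \sum_(k < n) k.+1%:R^-1 <= 1 + l ->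
  variance (exch_var e0 n (nrecords (crit (20 * l)) n)) <=
  (2 * (1792 * (12 * (4 * dd%:R))) * (177 ^+ 5 * 20 ^+ 2) + 256) * l ^+ 12 * n%:R `^ (1 - alpha).
Proof.
move=> l1 n0 nl harm; have L1 : 1 <= 20 * l by lra.
have l0 : 0 <= l by lra.
(* [2^(-m) <= exp(-88 * l^2)] must beat [n^8 = exp(8 * l)] times the moment [exp(40 * l * (1 + l))],
   and [8 + 40 + 40 = 88]. *)
pose m := (Num.trunc (176 * l ^+ 2)).+1.
have l21 : 1 <= l ^+ 2 by rewrite exprn_ege1.
have m1 : 176 * l ^+ 2 <= m%:R by rewrite ltW// truncnS_gt.
have m2 : m%:R <= 177 * l ^+ 2.
  rewrite /m -(natr1 (Num.trunc _)); have : (Num.trunc (176 * l ^+ 2))%:R <= 176 * l ^+ 2.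
    by rewrite truncn_le (mulr_ge0 (ler0n _ _) (exprn_ge0 _ l0)).
  by move: l21; set u := l ^+ 2; set t := (Num.trunc _)%:R; lra.
have thL k x : crit (20 * l) k x -> k.+1%:R * v x <= 20 * l by case/andP.
have y1 : 1 <= n%:R `^ (1 - alpha).
  rewrite -[leLHS](powRr0 n%:R); apply: ler_powR; first by rewrite ler1n.
  by have := alpha_le_half; lra.
have X1 : n%:R ^+ 8 * 2^-1 ^+ m * expR (2 * (20 * l) * \sum_(k < n) k.+1%:R^-1) <= 1 :> R.
  rewrite nl -expRM_natl -[leRHS]expR0.
  apply: (@le_trans _ _ (expR (8%:R * l) * expR (- (m%:R / 2)) * expR (2 * (20 * l) * (1 + l)))).
    apply: ler_pM; rewrite ?mulr_ge0 ?expR_ge0 ?exprn_ge0 ?invr_ge0//.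
      by rewrite ler_wpM2l ?expR_ge0// half_expn_le.
    by rewrite ler_expR ler_wpM2l// mulr_ge0// mulr_ge0.
  rewrite -!expRD ler_expR.
  have l2 : l <= l ^+ 2 by rewrite expr2 ler_peMr.
  have -> : 2 * (20 * l) * (1 + l) = 40 * l + 40 * l ^+ 2 by ring.
  move: m1 l2; set u := l ^+ 2; set M := m%:R; lra.
have hT := exchT_variance (critS (L := 20 * l)) (measurable_crit (20 * l)) L1 thL (isT : (1 <= m)%N) n0.
have TE : exchT (crit (20 * l)) n = exch_var e0 n (nrecords (crit (20 * l)) n) by [].
rewrite TE in hT; apply: (le_trans hT).
set y := n%:R `^ _ in y1 *.
move: X1; set X := expR _ => X1.
have -> : 256 * n%:R ^+ 8 * 2^-1 ^+ m * X = 256 * (n%:R ^+ 8 * 2^-1 ^+ m * X) by rewrite !mulrA.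
have -> : 2 * (1792 * m%:R ^+ 4 * (12 * m%:R * (20 * l) * (4 * dd%:R * (20 * l) * y))) =
  2 * (1792 * (12 * (4 * dd%:R))) * (m%:R ^+ 5 * (20 * l) ^+ 2) * y by ring.
have c0 : 0 <= 2 * (1792 * (12 * (4 * dd%:R))) :> R.
  exact: (mulr_ge0 (ler0n _ _) (mulr_ge0 (ler0n _ _) (mulr_ge0 (ler0n _ _) (mulr_ge0 (ler0n _ _) (ler0n _ _))))).
move: c0; set c := 2 * (1792 * _) => c0.
have y0 : 0 <= y by exact: powR_ge0.
have hm : m%:R ^+ 5 * (20 * l) ^+ 2 <= 177 ^+ 5 * 20 ^+ 2 * l ^+ 12.
  apply: (@le_trans _ _ ((177 * l ^+ 2) ^+ 5 * (20 * l) ^+ 2)).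
    apply: ler_wpM2r; first by apply: exprn_ge0; apply: mulr_ge0 l0; exact: ler0n.
    by apply: lerXn2r m2; rewrite nnegrE ?ler0n//; apply: mulr_ge0 (ler0n _ _) (exprn_ge0 _ l0).
  by apply: eq_ler; ring.
have h1 := ler_wpM2r y0 (ler_wpM2l c0 hm).
have h2 : 256 * (n%:R ^+ 8 * 2^-1 ^+ m * X) <= 256 * (l ^+ 12 * y).
  apply: (ler_wpM2l (ler0n _ _)); apply: (le_trans X1).
  by rewrite mulr_ege1// exprn_ege1.
apply: (le_trans (lerD h1 h2)).
move: (177 ^+ 5 * 20 ^+ 2) => k5.
by apply: eq_ler; ring.
Qed.

(** The existential shields later arithmetic from the large numerals; [1 <= c] allows [c] in place
    of its square root. *)
Lemma exch_variance_le : exists2 c : R, 1 <= c & forall n (l : R),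
  1 <= l -> (0 < n)%N -> n%:R = expR l -> \sum_(k < n) k.+1%:R^-1 <= 1 + l ->
  variance (exch_var e0 n (nrecords (crit (20 * l)) n)) <= c * l ^+ 12 * n%:R `^ (1 - alpha).
Proof.
eexists; last exact: exch_variance.
apply: (@le_trans _ _ 256); first by rewrite ler1n.
rewrite lerDr; apply: mulr_ge0; last first.
  exact: (mulr_ge0 (exprn_ge0 _ (ler0n _ _)) (exprn_ge0 _ (ler0n _ _))).
exact: (mulr_ge0 (ler0n _ _) (mulr_ge0 (ler0n _ _) (mulr_ge0 (ler0n _ _) (mulr_ge0 (ler0n _ _) (ler0n _ _))))).
Qed.

Lemma Df_cube_le : exists2 c : R, 0 <= c & forall n (l : R),
  1 <= l -> (0 < n)%N -> n%:R = expR l ->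
  \sum_(i < n) Ex (fun z => `|Df i (nrecords (crit (20 * l)) n) z| ^+ 3) <=
  c * l ^+ 2 * n%:R `^ (1 - alpha).
Proof.
exists (13568 * dd%:R * 64 ^+ 2).
  exact: (mulr_ge0 (mulr_ge0 (ler0n _ _) (ler0n _ _)) (exprn_ge0 _ (ler0n _ _))).
move=> n l l1 n0 nl; have B1 : 1 <= 64 * l by lra.
have hB j : (j < n)%N -> \sum_(m < n | (j < m)%N) 32 / (m - j)%:R <= 64 * l.
  by move=> jn; apply: (le_trans (harmonic_gap_le _ jn)) => //; rewrite nl expRK; lra.
have := sum_Df_cube (critS (L := 20 * l)) (measurable_crit (20 * l)) B1 hB.
move=> /le_trans; apply.
by apply: eq_ler; ring.
Qed.

Theorem records_berry_esseen : exists (C : R) (N : nat), forall n, (N <= n)%N -> forall x : R,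
  `|Ex (fun z => ((nrecords full n z - Ex (nrecords full n)) / Num.sqrt (variance (nrecords full n)) < x)%R%:R)
    - Phi x| <= C * (n%:R `^ (- ((1 - alpha) / 4)) * ln n%:R ^+ 2).
Proof.
have [K K0 hK] := stein_kolmogorov Qind e0.
have a0 := alpha_gt0; have a2 := alpha_le_half.
have [b hb] : exists b : nat, 256 * dd%:R <= b%:R `^ alpha by exact: (exists_powR_ge a0 (mulr_ge0 (ler0n _ _) (ler0n _ _))).
have [av av1 hav] := exch_variance_le.
have [a3 a30 ha3] := Df_cube_le.
pose C := 1 + K * (1 + 256 ^+ 2 * (4 + av * 32 ^+ 4) + 256 + 8 * 256 ^+ 3 * a3).
exists C, (2 * b + 256)%N => n nN x.
have n256 : (256 <= n)%N by apply: leq_trans nN; rewrite leq_addl.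
have n0 : (0 < n)%N by apply: leq_trans n256.
have nr0 : 0 < n%:R :> R by rewrite ltr0n.
have n1 : 1 <= n%:R :> R by rewrite ler1n.
set l := ln n%:R.
have l1 : 1 <= l by apply: ln_ge1; apply: leq_trans n256.
have nl : n%:R = expR l by rewrite /l lnK.
have harm := harmonic_le R n0; rewrite -/l in harm.
(* [q ^+ 4] is the order of the variance, and [l / q] the width of the smoothing. *)
pose q : R := n%:R `^ ((1 - alpha) / 4).
have qX k : q ^+ k = n%:R `^ ((1 - alpha) / 4 * k%:R) by rewrite -powR_mulrn ?powR_ge0// -powRrM.
have q4 : q ^+ 4 = n%:R `^ (1 - alpha) by rewrite qX divfK ?pnatr_eq0.
have q1 : 1 <= q.
  by rewrite -[leLHS](powRr0 n%:R); apply: ler_powR => //; lra.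
have qn : q <= n%:R by rewrite -[leRHS]powRr1// ler_powR//; lra.
have q0 : 0 < q by lra.
have vlow := variance_full_lower hb nN; rewrite -q4 in vlow.
set V := variance (nrecords full n) in vlow *.
pose s := Num.sqrt V.
have V0 : 0 < V.
  have : 0 < q ^+ 4 by exact: exprn_gt0.
  move=> /lt_le_trans-/(_ _ vlow).
  by rewrite (pmulr_rgt0 _ (exprn_gt0 2 (ltr0n R 256))).
have s0 : 0 < s by rewrite sqrtr_gt0.
have s2 : s ^+ 2 = V by rewrite sqr_sqrtr// ltW.
have qs : q ^+ 2 <= 256 * s.
  have q20 := exprn_ge0 2 (ltW q0).
  have s20 := mulr_ge0 (ler0n R 256) (ltW s0).
  by rewrite -(ler_pXn2r (ltn0Sn 1) q20 s20) -exprM exprMn s2; exact: vlow.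
have L1 : 1 <= 20 * l by lra.
pose g := nrecords (crit (20 * l)) n.
have bg : bmeas g by apply: bmeas_nrecords; exact: measurable_crit.
have dg : dep_below n g by exact: (@dep_nrecords _).
(* At level [20 * l] the truncation error is [n * exp(-10 * l) = n^(-9)]; the factor [4 * n] for the
   variances leaves it bounded. *)
pose dl := n%:R * expR (- (20 * l / 2)).
have dlE : dl = n%:R^-1 ^+ 9.
  rewrite /dl (_ : 20 * l / 2 = 10%:R * l); last by field.
  rewrite expRN expRM_natl -nl exprVn (exprS _ 9) invfM mulrA divff ?mul1r//.
  by rewrite gt_eqF.
have ni0 : 0 < n%:R^-1 :> R by rewrite invr_gt0.
have ni2 : n%:R^-1 <= 1 :> R by rewrite invf_le1.
have dl0 : 0 <= dl by rewrite dlE exprn_ge0// ltW.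
have dl1 : dl <= q^-1.
  rewrite dlE; apply: (@le_trans _ _ n%:R^-1); last by rewrite lef_pV2// posrE.
  by rewrite exprS ler_piMr ?(ltW ni0)// exprn_ile1// ltW.
have A4 : 0 <= 4 * n%:R * dl <= 4.
  rewrite !mulr_ge0//= -mulrA ler_piMr// dlE exprS mulrA divff ?mul1r ?gt_eqF//.
  by rewrite exprn_ile1// ltW.
have l4 : l ^+ 4 <= 32 ^+ 4 * q.
  apply: (le_trans (ln_pow4_le R n0)); apply: ler_wpM2l; first exact: exprn_ge0.
  by rewrite ler_powR//; lra.
pose S3 := \sum_(i < n) Ex (fun z => `|Df i g z| ^+ 3).
have S30 : 0 <= S3 by apply: sumr_ge0 => i _; apply: Ex_ge0 => z; exact: exprn_ge0.
have S31 : S3 <= a3 * l ^+ 2 * q ^+ 4 by rewrite q4; exact: ha3.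
pose sv := Num.sqrt (variance (exch_var e0 n g)).
have sv1 : sv <= av * l ^+ 6 * q ^+ 2.
  have r0 : 0 <= av * l ^+ 6 * q ^+ 2.
    exact: (mulr_ge0 (mulr_ge0 (le_trans ler01 av1) (exprn_ge0 _ (le_trans ler01 l1))) (exprn_ge0 _ (ltW q0))).
  rewrite /sv -[leRHS]ger0_norm// -sqrtr_sqr ler_wsqrtr//.
  apply: (le_trans (hav n l l1 n0 nl harm)); rewrite -q4.
  have -> : (av * l ^+ 6 * q ^+ 2) ^+ 2 = av * (av * l ^+ 12 * q ^+ 4) by ring.
  apply: (ler_peMl _ av1).
  exact: (mulr_ge0 (mulr_ge0 (le_trans ler01 av1) (exprn_ge0 _ (le_trans ler01 l1))) (exprn_ge0 _ (ltW q0))).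
pose mm := Ex (nrecords full n).
have h1 := Ex_lt_trunc L1 n mm s x; rewrite -/dl -/g in h1.
have h2 := hK n g mm s (l / q) bg dg s0 (divr_gt0 (lt_le_trans ltr01 l1) q0) x.
have h3 := var_trunc L1 n; rewrite -/V -/dl -/g -s2 in h3.
have /andP[h40 h41] := Ex_trunc L1 n; rewrite -/mm -/g -/dl in h40 h41.
have asm := kolmogorov_bound_assembly (ltW K0) (ler0n R 256) (le_trans ler01 av1) a30 (exprn_ge0 4 (ler0n R 32))
  q1 l1 s0 qs (introT andP (conj dl0 dl1)) A4 (introT andP (conj (sqrtr_ge0 _) sv1)) l4
  (introT andP (conj S30 S31)).
rewrite powRN -/q; apply: le_trans asm.
(* Triangle inequality through the truncated count, standardized by the mean and deviation of the
   full one. *)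
apply: (le_trans (ler_distD (Ex (fun z => ((g z - mm) / s < x)%R%:R)) _ _)).
apply: lerD; first exact: h1.
apply: (le_trans h2); apply: ler_wpM2l; first exact: ltW.
apply: lerD; last by [].
apply: lerD.
  apply: lerD => //; apply: ler_wpM2r; first by rewrite invr_ge0 exprn_ge0// ltW.
  by apply: lerD.
by apply: ler_wpM2r; [rewrite invr_ge0 ltW|rewrite distrC ger0_norm].
Qed.

End Records.

(** * Transfer to the given probability space *)

Section Transfer.
Context (R : realType) (d : nat) (dT : measure_display) (T : measurableType dT) (P : probability T R).
Notation E := (d.-tuple R).
Notation Om := (seqspace E).
Variable p : nat -> T -> E.
Hypothesis hd : (2 <= d)%N.
Hypothesis hmeas : forall i, measurable_fun setT (p i).
Hypothesis hind : mutually_independent P p.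
Hypothesis hunif : forall i, uniform_on_simplex P (p i).

Definition sample (w : T) : Om := fun i => p i w.

Lemma measurable_sample : measurable_fun setT sample.
Proof. exact: measurable_to_seqspace. Qed.

HB.instance Definition _ := isMeasurableFun.Build _ _ _ _ sample measurable_sample.
HB.instance Definition _ i := isMeasurableFun.Build _ _ _ _ (p i) (hmeas i).

Let Q : probability Om R := distribution P sample.
Let m : probability E R := distribution P (p 0).
Notation Ex := (expct Q).

Let d0 : (0 < d)%N. Proof. exact: ltnW hd. Qed.

Let mU (A : set E) : measurable A ->
  m A = (fine (vol (A `&` @simplex R d)) / fine (vol (@simplex R d)))%:E.
Proof. exact: hunif. Qed.

Let mE k (A : set E) : measurable A -> P (p k @^-1` A) = m A.
Proof. by move=> mA; rewrite mU//; exact: hunif. Qed.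

Let Qind (s : seq nat) (A : nat -> set E) : uniq s -> (forall i, measurable (A i)) ->
  Q [set z | forall i, i \in s -> A i (z i)] = (\prod_(i <- s) m (A i))%E.
Proof.
move=> us mA; transitivity (P (\bigcap_(i in [set` s]) (p i @^-1` A i))); first by [].
rewrite hind//; apply: eq_bigr => i _; exact: mE.
Qed.

Let Ex_coord (b : E -> bool) k : measurable [set x | b x] ->
  Ex (fun z => (b (z k))%:R) = fine (m [set x | b x]).
Proof.
move=> mb; rewrite -(mE k mb); transitivity (fine (\int[Q]_z (\1_[set z : Om | b (z k)] z)%:E)).
  rewrite /expct /Rintegral; congr fine; apply: eq_integral => z _.
  by rewrite indicE mem_setE.
rewrite integral_indic// ?setIT//.
by rewrite -[X in measurable X]setTI; exact: (@measurable_seqspace_coord _ E k measurableT _ mb).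
Qed.

Let e0 : E := [tuple -1 | j < d].

Let e0S : ~~ in_simplex e0.
Proof.
rewrite negb_and; apply/orP; left; apply/forallPn; exists (Ordinal d0).
by rewrite tnth_mktuple oppr_ge0 ler10.
Qed.

Let precS (x y : E) : prec x y -> in_simplex x && in_simplex y.
Proof. by case/and3P => -> ->. Qed.

Let minS : measurable [set x : E | in_simplex x].
Proof. exact: measurable_in_simplex. Qed.

Let v01 (x : E) : in_simplex x -> 0 <= dom_prob x <= 1.
Proof.
by move=> /slack01/andP[s0 s1]; rewrite exprn_ge0//= exprn_ile1.
Qed.

Let mupv : measurable_fun setT (@dom_prob R d).
Proof. exact: measurable_dom_prob. Qed.

Let Ex_inS k : Ex (fun z => (in_simplex (z k))%:R) = 1.
Proof. by rewrite Ex_coord// law_in_simplex. Qed.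

Let Ex_prec_up k x : in_simplex x -> Ex (fun z => (prec x (z k))%:R) = dom_prob x.
Proof.
move=> xS; rewrite (Ex_coord (b := prec x)) ?(law_up d0 mU)//.
by apply: measurable_prec => //; exact: measurable_cst.
Qed.

Let Ex_prec_down k y t : 0 < t -> Ex (fun z => (prec (z k) y && (dom_prob (z k) <= t))%:R) <= t.
Proof.
move=> t0; rewrite (Ex_coord (b := fun x => prec x y && (dom_prob x <= t))) ?(law_down d0 mU)//.
apply: measurable_setb_and; first by apply: measurable_prec => //; exact: measurable_cst.
exact: (measurable_vle mupv).
Qed.

Let Ex_low_ub k u : 0 <= u -> Ex (fun z => (in_simplex (z k) && (dom_prob (z k) <= u ^+ d))%:R) <= d%:R * u.
Proof.
move=> u0; rewrite (Ex_coord (b := fun x => in_simplex x && (dom_prob x <= u ^+ d))) ?(law_low_le d0 mU)//.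
exact: measurable_low.
Qed.

Let Ex_low_lb k u : 0 <= u <= 1 -> u <= Ex (fun z => (in_simplex (z k) && (dom_prob (z k) <= u ^+ d))%:R).
Proof.
move=> u01; rewrite (Ex_coord (b := fun x => in_simplex x && (dom_prob x <= u ^+ d))) ?(law_low_ge d0 mU)//.
exact: measurable_low.
Qed.

Lemma Ex_sample (F : Om -> R) : bmeas F -> Ex F = \int[P]_w F (sample w).
Proof. by move=> bF; apply: (Ex_pushforward (Q := Q) measurable_sample). Qed.

(** The difference is at most a constant times the number of the first [n] points outside the
    simplex, which has mean zero. This permits the passage from [dominated] to [prec]. *)
Lemma Ex_eq_on_simplex n (F G : Om -> R) : bmeas F -> bmeas G ->
  (forall z : Om, (forall k, (k < n)%N -> in_simplex (z k)) -> F z = G z) -> Ex F = Ex G.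
Proof.
move=> bF bG FG; have bFG := bmeasB bF bG; have [_ [c hc]] := bFG.
have bI k : bmeas (fun z : Om => (in_simplex (z k))%:R : R) by exact: bmeas_inS minS k.
have b1 k : bmeas (fun z : Om => 1 - (in_simplex (z k))%:R : R) by apply: bmeasB => //; exact: bmeas_cst.
have c0 : 0 <= c by apply: le_trans (hc (fun=> e0)).
have bs : bmeas (fun z : Om => \sum_(k < n) (1 - (in_simplex (z k))%:R : R)) by apply: bmeas_sum.
apply/eqP; rewrite -subr_eq0 -normr_le0 -ExB//; apply: (le_trans (Ex_abs Q bFG)).
apply: (@le_trans _ _ (Ex (fun z => c * \sum_(k < n) (1 - (in_simplex (z k))%:R)))).
  apply: Ex_le; [exact: bmeas_abs|by apply: bmeasM => //; exact: bmeas_cst|move=> z].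
  have i0 k : 0 <= 1 - (in_simplex (z k))%:R :> R by rewrite subr_ge0 lern1 leq_b1.
  case: (boolP [forall k : 'I_n, in_simplex (z k)]) => [/forallP h|/forallPn[k hk]].
    rewrite FG ?subrr ?normr0 ?mulr_ge0// ?sumr_ge0//.
    by move=> k kn; exact: (h (Ordinal kn)).
  apply: (le_trans (hc z)); rewrite ler_peMr// (bigD1 k)//= (negbTE hk) subr0 lerDl.
  by apply: sumr_ge0.
rewrite ExZ// Ex_sum// big1 ?mulr0// => k _.
by rewrite ExB ?Ex_cst ?Ex_inS ?subrr//; exact: bmeas_cst.
Qed.

Lemma nrecordsE n (z : Om) :
  nrecords R (@dominated R d) (fun _ _ => true) n z = (pareto_records z n)%:R.
Proof.
rewrite /pareto_records -sum1_count big_mkcond natr_sum /nrecords.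
rewrite -(big_mkord predT (fun k => record R (@dominated R d) (fun _ _ => true) k z)).
rewrite /index_iota subn0; apply: eq_bigr => k _; rewrite record_bool /=.
suff -> : all (fun i => ~~ dominated (z k) (z i)) (iota 0 k) =
  [forall i : 'I_k, ~~ dominated (z k) (z i)] by case: [forall _, _].
apply/allP/forallP => [h i|h i].
  by apply: (h (i : nat)); rewrite mem_iota ltn_ord.
by rewrite mem_iota add0n => /andP[_ ik]; exact: (h (Ordinal ik)).
Qed.

Notation X := (fun n w => (pareto_records (fun i => p i w) n)%:R : R).
Notation F n := (nrecords R (@dominated R d) (fun _ _ => true) n).
Notation G n := (nrecords R (@prec R d) (fun _ (x : E) => in_simplex x) n).

Let bF n : bmeas (F n : Om -> R).
Proof.
apply: bmeas_nrecords => [d' T' f g mf mg|k]; first exact: measurable_dominated.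
by rewrite (_ : [set _ | _] = setT); [exact: measurableT|apply/seteqP; split].
Qed.

Let bG n : bmeas (G n : Om -> R).
Proof.
by apply: bmeas_nrecords => [d' T' f g mf mg|k]; [exact: measurable_prec|exact: minS].
Qed.

Let FG n (z : Om) : (forall k, (k < n)%N -> in_simplex (z k)) -> F n z = G n z.
Proof.
move=> h; apply: eq_bigr => -[k /= kn] _; rewrite !record_bool h//=; congr (nat_of_bool _)%:R.
apply: eq_in_all => i; rewrite mem_iota add0n => /andP[_ ik].
by rewrite /prec !h// (ltn_trans ik).
Qed.

Let XE n w : X n w = F n (sample w).
Proof. by rewrite nrecordsE. Qed.

Lemma expectation_records n : fine 'E_P[X n] = Ex (G n).
Proof.
rewrite -(Ex_eq_on_simplex (bF n) (bG n) (@FG n)) (Ex_sample (bF n)) unlock /Rintegral.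
by congr fine; apply: eq_integral => w _; rewrite XE.
Qed.

Lemma variance_records n : fine 'V_P[X n] = Ex (fun z => G n z ^+ 2) - Ex (G n) ^+ 2.
Proof.
have b2 : bmeas (fun z => (F n z - Ex (G n)) ^+ 2 : R).
  by apply: bmeasX; apply: bmeasB => //; exact: bmeas_cst.
rewrite -(Ex_var Q (bG n)) -(Ex_eq_on_simplex (n := n) b2); last first.
- by move=> z h; rewrite FG.
- by apply: bmeasX; apply: bmeasB => //; exact: bmeas_cst.
rewrite (Ex_sample b2) /variance [in LHS]unlock [in LHS]unlock /Rintegral.
congr fine; apply: eq_integral => w _; rewrite -expectation_records -XE.
by rewrite [in RHS]unlock.
Qed.

Lemma law_records n (c s x : R) :
  P [set w | ((X n w - c) / s < x)%R] = (Ex (fun z => ((G n z - c) / s < x)%R%:R))%:E.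
Proof.
have bI (H : Om -> R) : bmeas H -> bmeas (fun z => ((H z - c) / s < x)%R%:R : R).
  move=> bH; have bW : bmeas (fun z => (H z - c) / s).
    by apply: bmeasM; [apply: bmeasB => //; exact: bmeas_cst|exact: bmeas_cst].
  apply: bmeas_pred; have [mW _] := bW.
  by rewrite -[Y in measurable Y]setTI; apply: (measurable_fun_ltr mW (measurable_cst x)).
rewrite -(Ex_eq_on_simplex (n := n) (bI _ (bF n)) (bI _ (bG n))); last first.
  by move=> z h; rewrite FG.
rewrite (Ex_sample (bI _ (bF n))) /Rintegral.
have mA : measurable [set w | ((X n w - c) / s < x)%R].
  have [mF _] := bmeas_comp measurable_sample (bF n).
  rewrite -[Y in measurable Y]setTI.
  have mX : measurable_fun setT (X n).
    by apply: (eq_measurable_fun _ _ mF) => w _; rewrite XE.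
  have mW : measurable_fun setT (fun w => (X n w - c) / s).
    by apply: measurable_funM; [apply: measurable_funB => //; exact: measurable_cst|exact: measurable_cst].
  exact: (measurable_fun_ltr mW (measurable_cst x)).
rewrite -[LHS]fineK ?fin_num_measure//; congr (_ %:E); congr fine.
rewrite -[in LHS](setIT [set w | _]) -integral_indic//; apply: eq_integral => w _.
rewrite indicE; congr ((nat_of_bool _)%:R%:E); apply/idP/idP => [/set_mem/=|h].
  by rewrite XE.
by apply: mem_set; rewrite /= XE.
Qed.

Lemma records_bound : exists (C : R) (N : nat), forall n, (N <= n)%N -> forall x : R,
  (`| P [set w | ((X n w - fine 'E_P[X n]) / Num.sqrt (fine 'V_P[X n]) < x)%R]
        - normal_prob 0 1 `]-oo, x[ |
      <= (C * (n%:R `^ (- ((1 - (d%:R)^-1) / 4)) * (ln n%:R) ^+ 2))%:E)%E.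
Proof.
have mprec d' (T' : measurableType d') (f g : T' -> E) : measurable_fun setT f ->
  measurable_fun setT g -> measurable [set t | prec (f t) (g t)] by exact: measurable_prec.
have [C [N h]] := records_berry_esseen Qind hd mprec minS mupv v01 precS e0S Ex_prec_up Ex_prec_down Ex_low_ub Ex_low_lb.
exists C, N => n nN x; rewrite law_records expectation_records variance_records.
rewrite -[normal_prob _ _ _]fineK ?fin_num_measure// -EFinB lee_fin.
exact: h.
Qed.

End Transfer.

Theorem theorem2 (R : realType) (d : nat) (hd : (2 <= d)%N)
  (dT : measure_display) (T : measurableType dT) (P : probability T R)
  (p : nat -> T -> d.-tuple R)
  (hmeas : forall i, measurable_fun setT (p i))
  (hind : mutually_independent P p)
  (hunif : forall i, uniform_on_simplex P (p i)) :
  let X := fun (n : nat) (w : T) => (pareto_records (fun i => p i w) n)%:R : R in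
  exists (C : R) (N : nat), forall n : nat, (N <= n)%N -> forall x : R,
    (`| P [set w | ((X n w - fine 'E_P[X n]) / Num.sqrt (fine 'V_P[X n]) < x)%R]
        - normal_prob 0 1 `]-oo, x[ |
      <= (C * (n%:R `^ (- ((d - 1)%:R / (4 * d)%:R)) * (ln n%:R) ^+ 2
               + n%:R `^ (- (d%:R)^-1) * (ln n%:R) `^ (d%:R)^-1))%:E)%E.
Proof.
move=> X; have [C [N h]] := records_bound hd hmeas hind hunif.
(* The bound obtained has only the first error term. The second is nonnegative, and adding it takes
   a factor of known sign, whence the absolute value of [C]. *)
exists `|C|, N => n nN x; apply: (le_trans (h n nN x)); rewrite lee_fin.
have dn0 : d%:R != 0 :> R by rewrite pnatr_eq0; case: (d) hd.
have -> : (1 - d%:R^-1) / 4 = (d - 1)%:R / (4 * d)%:R :> R.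
  by rewrite natrB ?(ltnW hd)// natrM; field.
apply: (@le_trans _ _ (`|C| * (n%:R `^ (- ((d - 1)%:R / (4 * d)%:R)) * (ln n%:R) ^+ 2))).
  by rewrite ler_wpM2r ?ler_norm// mulr_ge0 ?powR_ge0 ?sqr_ge0.
by rewrite ler_wpM2l// lerDl mulr_ge0 ?powR_ge0.
Qed.
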